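(* Let $\mu\in(\mathfrak h_{\mathbb Z}^* )^+$ be a dominant integral weight and let $X^\mu m=g^\vee s^\vee_{i_1}\cdots s^\vee_{i_\ell}$ (with $g^\vee\in\Omega^\vee$, $\ell=\ell(X^\mu m)$) be a reduced word for the minimal length element $X^\mu m$ ($m\in W_0$) of the coset $X^\mu W_0$. For $k=1,\dots,\ell$ let $\beta_k^\vee=s^\vee_{i_\ell}s^\vee_{i_{\ell-1}}\cdots s^\vee_{i_{k+1}}\alpha^\vee_{i_k}$ and $t_{\beta_k^\vee}=t_{i_k}$. Let $$\mathcal P(\vec\mu)=\bigcup_{v\in W_0}\mathcal B(v,\vec w),$$ where $\mathcal B(v,\vec w)$ is the set of alcove walks of type $\vec w=(i_1,\dots,i_\ell)$ beginning at $vg^\vee$ (so beginning at $v$ when $g^\vee=1$), and for $p\in\mathcal B(v,\vec w)$ write $\iota(p)=v\in W_0$. Then the symmetric Macdonald polynomial $P_\mu$ is $$P_\mu=\sum_{p\in\mathcal P(\vec\mu)}X^{\mathrm{wt}(p)}\,t^{1/2}_{\varphi(p)}\,t^{-1/2}_{w_0\iota(p)}\left(\prod_{k\in f^+(p)}\frac{t_{\beta_k^\vee}^{-1/2}(1-t_{\beta_k^\vee})}{1-q^{\langle-\beta_k^\vee,\rho_c\rangle}}\right)\left(\prod_{k\in f^-(p)}\frac{t_{\beta_k^\vee}^{-1/2}(1-t_{\beta_k^\vee})\,q^{\langle-\beta_k^\vee,\rho_c\rangle}}{1-q^{\langle-\beta_k^\vee,\rho_c\rangle}}\right),$$ where $w_0$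 is the longest element of $W_0$ and $X^\nu$ on the right stands for the element $X^\nu\mathbf 1$ of the polynomial representation $\mathbb C[X]$.
   Context: **Root data.** $R$ is an irreducible reduced crystallographic root system with finite Weyl group $W_0$, positive roots $R^+$, coroots $R^\vee$, positive coroots $(R^\vee)^+$, simple roots $\alpha_1,\dots,\alpha_n$ and simple coroots $\alpha_1^\vee,\dots,\alpha_n^\vee$. $\mathfrak h_{\mathbb Z}\supseteq R^\vee$ and $\mathfrak h_{\mathbb Z}^*\supseteq R$ are $W_0$-stable lattices spanning the dual real vector spaces $\mathfrak h_{\mathbb R}$, $\mathfrak h_{\mathbb R}^*$, with pairing $\langle\,,\rangle$ (written in either order) such that $\langle\mathfrak h_{\mathbb Z},R\rangle\subseteq\mathbb Z$ and $\langle R^\vee,\mathfrak h^*_{\mathbb Z}\rangle\subseteq\mathbb Z$; $e$ is the smallest positive integer with $\langle\mathfrak h_{\mathbb Z},\mathfrak h_{\mathbb Z}^*\rangle\subseteq\frac1e\mathbb Z$. The dominant integral weights are $(\mathfrak h_{\mathbb Z}^* )^+=\{\mu\in\mathfrak h_{\mathbb Z}^*\mid\langle\mu,\alpha_i^\vee\rangle\ge0,\ 1\le i\le n\}$. Let $\phi\in R^+$ be the highest root, with coroot $\phi^\vee$, and let $\theta\in R^+$ be the root whose coroot $\theta^\vee$ is the highest coroot. Let $d$ be a formal symbol, and put $\alpha_0^\vee=-\theta^\vee+d$, $\alpha_0=-\theta+\delta$, where $\langle\lambda^\vee,\delta\rangle=0$, so $\langle\lambda^\vee,\alpha_0\rangle=-\langle\lambda^\vee,\theta\rangle$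 for $\lambda^\vee\in\mathfrak h_{\mathbb Z}$. **Affine Weyl group and alcoves.** $W=\{X^\mu w\mid\mu\in\mathfrak h_{\mathbb Z}^*,w\in W_0\}$ with $X^\mu X^\nu=X^{\mu+\nu}$, $wX^\mu=X^{w\mu}w$. It acts on $\mathfrak h_{\mathbb R}^*$ by $X^\mu\cdot\nu=\nu+\mu$, $w\cdot\nu=w\nu$, and linearly on $\mathfrak h_{\mathbb Z}\oplus\frac1e\mathbb Zd$ by $X^\mu\lambda^\vee=\lambda^\vee-\langle\lambda^\vee,\mu\rangle d$, the usual action of $W_0$ on $\mathfrak h_{\mathbb Z}$, and $d$ fixed. For $\alpha^\vee\in(R^\vee)^+$, $j\in\mathbb Z$ let $\mathfrak h^{\alpha^\vee+jd}=\{x\in\mathfrak h_{\mathbb R}^*\mid\langle x,\alpha^\vee\rangle=-j\}$. Alcoves are the connected components of the complement of all these hyperplanes; the fundamental alcove is $A=\{x\mid\langle x,\alpha_i^\vee\rangle>0\ (1\le i\le n),\ \langle x,\theta^\vee\rangle<1\}$. Let $s_i^\vee=s_{\alpha_i}\in W_0$ for $1\le i\le n$ and $s_0^\vee=X^{\theta}s_\theta$. The length $\ell(v)$ of $v\in W$ is the number of hyperplanes separating $A$ and $v\cdot A$; $\Omega^\vee$ is the group of length-zero elements. Every $v\in W$ has reduced words $v=g^\vee s^\vee_{i_1}\cdots s^\vee_{i_\ell}$ with $g^\vee\in\Omega^\vee$, $\ell=\ell(v)$. For $g^\vee\in\Omega^\vee$, $g^\vee s_i^\vee(g^\vee)^{-1}=s^\vee_{\sigma^\vee(i)}$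 defines a permutation $\sigma^\vee$ of $\{0,\dots,n\}$; $m^\vee_{ij}$ is the order of $s_i^\vee s_j^\vee$. Periodic orientation: for $\alpha^\vee\in(R^\vee)^+$ the positive side of $\mathfrak h^{\alpha^\vee+jd}$ is $\{x\mid\langle x,\alpha^\vee\rangle>-j\}$; the other side is negative. For $z\in W$, $z\cdot A$ and $zs_j^\vee\cdot A$ are separated by exactly one hyperplane, $H_{z,j}$; passing from $z$ to $zs_j^\vee$ is a positive (resp. negative) $j$-crossing if $zs_j^\vee\cdot A$ is on the positive (resp. negative) side of $H_{z,j}$. **Parameters.** Parameters $c_{\beta^\vee}$ ($\beta^\vee\in R^\vee+\mathbb Zd$) satisfy $c_{w\beta^\vee}=c_{\beta^\vee}$ for $w\in W$ and $c_{\gamma^\vee+jd}=c_{\gamma^\vee}$ for $\gamma^\vee\in R^\vee$, $j\in\mathbb Z$; write $c_\alpha=c_{\alpha^\vee}$ for $\alpha\in R$. Put $t_{\beta^\vee}=q^{c_{\beta^\vee}}$, $t_i=t_{\alpha_i^\vee}$ ($0\le i\le n$), $t_\alpha=q^{c_\alpha}$. The $t_\alpha^{1/2}$ are treated as independent formal indeterminates, one for each $W_0$-orbit in $R$, and $K$ is the field of rational functions over $\mathbb C$ in $q^{1/e}$ and the $t_\alpha^{1/2}$. For $w\in W_0$ with reduced word $w=s^\vee_{j_1}\cdots s^\vee_{j_r}$, $t_w^{1/2}=t_{j_1}^{1/2}\cdots t_{j_r}^{1/2}$ and $t_w^{-1/2}=(t_w^{1/2})^{-1}$. Let $\rho_c=\frac12\sum_{\alpha\in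 R^+}c_\alpha\alpha$, so for $\lambda^\vee\in\mathfrak h_{\mathbb Z}$, $q^{\langle\lambda^\vee,\rho_c\rangle}$ denotes $\prod_{\alpha\in R^+}(t_\alpha^{1/2})^{\langle\lambda^\vee,\alpha\rangle}$; for $\beta^\vee=-\gamma^\vee+jd$ with $\gamma^\vee\in R^\vee$, $j\in\mathbb Z$, put $q^{\langle-\beta^\vee,\rho_c\rangle}:=q^jq^{\langle\gamma^\vee,\rho_c\rangle}$. **Double affine Hecke algebra.** $\widetilde H$ is the $K$-algebra generated by $T_0^\vee,\dots,T_n^\vee$, the group $\Omega^\vee$ and $Y^{\lambda^\vee}$ ($\lambda^\vee\in\mathfrak h_{\mathbb Z}$), where $Y^{\lambda^\vee}Y^{\sigma^\vee}=Y^{\lambda^\vee+\sigma^\vee}$, $Y^0=1$, with the convention $Y^{d}=q^{-1}$, i.e. $Y^{\lambda^\vee+kd}=q^{-k}Y^{\lambda^\vee}$, subject to: the braid relations $T_i^\vee T_j^\vee\cdots=T_j^\vee T_i^\vee\cdots$ ($m^\vee_{ij}$ factors); $g^\vee T_i^\vee(g^\vee)^{-1}=T^\vee_{\sigma^\vee(i)}$; $g^\vee Y^{\lambda^\vee}=Y^{g^\vee\lambda^\vee}g^\vee$; $(T_i^\vee)^2=(t_i^{1/2}-t_i^{-1/2})T_i^\vee+1$; and $$T_i^\vee Y^{\lambda^\vee}=Y^{s_i^\vee\lambda^\vee}T_i^\vee+(t_i^{1/2}-t_i^{-1/2})\frac{Y^{\lambda^\vee}-Y^{s_i^\vee\lambda^\vee}}{1-Y^{-\alpha_i^\vee}}\qquad(0\le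 i\le n).$$ Expressions with denominators $1-Y^{-\beta^\vee}$ ($\beta^\vee\in R^\vee+\mathbb Zd$) are taken in the Ore localization of $\widetilde H$ at the multiplicative set generated by these elements. Write $T_i=T_i^\vee$ for $1\le i\le n$, and $T_w=T_w^\vee=T_{j_1}\cdots T_{j_r}$ for $w\in W_0$ with reduced word $s^\vee_{j_1}\cdots s^\vee_{j_r}$. For $v\in W$ with reduced word $v=h^\vee s^\vee_{j_1}\cdots s^\vee_{j_r}$, put $X^v=h^\vee(T^\vee_{j_1})^{\epsilon_1}\cdots(T^\vee_{j_r})^{\epsilon_r}\in\widetilde H$, where $\epsilon_k=-1$ if the $k$th step, from $h^\vee s^\vee_{j_1}\cdots s^\vee_{j_{k-1}}$ to $h^\vee s^\vee_{j_1}\cdots s^\vee_{j_k}$, is a positive crossing and $\epsilon_k=+1$ if it is a negative crossing (this is independent of the reduced word). In particular each translation $X^\mu\in W$ gives an element $X^\mu\in\widetilde H$. **Polynomial representation.** Let $W^\vee=\{wY^{\lambda^\vee}\mid w\in W_0,\lambda^\vee\in\mathfrak h_{\mathbb Z}\}$ act on $\mathfrak h_{\mathbb R}$ with $Y^{\lambda^\vee}$ translation by $\lambda^\vee$, and let $\Omega$ be the subgroup preserving $\{x\mid\langle x,\alpha_i\rangle>0\ (1\le i\le n),\ \langle x,\phi\rangle<1\}$. In $\widetilde H$ put $T_0=Y^{\phi^\vee}T_{s_\phi}^{-1}$, and for $g=Y^{\omega^\vee}u\in\Omega$ ($\omega^\vee\in\mathfrak h_{\mathbb Z}$, $u\in W_0$)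 denote also by $g$ the element $Y^{\omega^\vee}T_{u^{-1}}^{-1}$. Let $H$ be the subalgebra generated by $T_0,\dots,T_n$ and $\Omega$. The polynomial representation is $\mathbb C[X]=\mathrm{Ind}_H^{\widetilde H}(\mathbf 1)$, where $T_i\mathbf 1=t_i^{1/2}\mathbf 1$ ($1\le i\le n$), $T_0\mathbf 1=t_\phi^{1/2}\mathbf 1$, $g\mathbf 1=\mathbf 1$ ($g\in\Omega$). It has $K$-basis $X^\mu\mathbf 1$, $\mu\in\mathfrak h_{\mathbb Z}^*$. The elements $1-Y^{-\beta^\vee}$ ($\beta^\vee\in R^\vee+\mathbb Zd$) act on $\mathbf 1$ by nonzero scalars, so elements $hs^{-1}$ of the localization ($s$ a product of such elements, $h\in\widetilde H$) can be applied to $\mathbf 1$. **Macdonald polynomials.** $\tau_i^\vee=T_i^\vee+\dfrac{t_i^{-1/2}(1-t_i)}{1-Y^{-\alpha_i^\vee}}$ for $0\le i\le n$; for a reduced word $w=g^\vee s^\vee_{i_1}\cdots s^\vee_{i_\ell}$ set $\tau_w^\vee=g^\vee\tau^\vee_{i_1}\cdots\tau^\vee_{i_\ell}$ (independent of the reduced word). For $\mu\in\mathfrak h_{\mathbb Z}^*$, the nonsymmetric Macdonald polynomial is $E_\mu=\tau^\vee_{X^\mu m}\mathbf 1$, with $X^\mu m$ the minimal length element of $X^\mu W_0$. For $\mu\in(\mathfrak h_{\mathbb Z}^* )^+$ the symmetric Macdonald polynomial is $$P_\mu=\mathbf 1_0E_\mu,\qquad \mathbf 1_0=\sum_{w\in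 W_0}t_{w_0w}^{-1/2}T_w.$$ **Alcove walks.** An alcove walk of type $(i_1,\dots,i_\ell)$ beginning at $u\in W$ is a sequence $p=(z_0,z_1,\dots,z_\ell)$ in $W$ with $z_0=u$ and $z_k\in\{z_{k-1}s^\vee_{i_k},z_{k-1}\}$ for each $k$. Step $k$ is a crossing if $z_k=z_{k-1}s^\vee_{i_k}$; if $z_k=z_{k-1}$ it is a positive (resp. negative) fold when $z_{k-1}\cdot A$ lies on the positive (resp. negative) side of $H_{z_{k-1},i_k}$. $f^+(p)$ and $f^-(p)$ are the sets of $k$ such that step $k$ is a positive, resp. negative, fold; $\mathrm{end}(p)=z_\ell$. The weight $\mathrm{wt}(p)\in\mathfrak h_{\mathbb Z}^*$ and final direction $\varphi(p)\in W_0$ are defined by $\mathrm{end}(p)=X^{\mathrm{wt}(p)}\varphi(p)$ in $W$ (equivalently $X^{\mathrm{end}(p)}=X^{\mathrm{wt}(p)}T^\vee_{\varphi(p)}$ in $\widetilde H$). *)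

(* Defs.v *)
From HB Require Import structures.
From mathcomp Require Import all_boot all_order all_fingroup all_algebra.
From mathcomp Require Import generic_quotient ring_quotient.
From mathcomp Require Import finmap complex mpoly.
From mathcomp Require Import boolp classical_sets functions cardinality fsbigop.
From mathcomp Require Import reals.

Set Implicit Arguments.
Unset Strict Implicit.
Unset Printing Implicit Defensive.

Import Order.TTheory GRing.Theory Num.Theory.

Local Open Scope ring_scope.
Local Open Scope quotient_scope.

Inductive expr (K G : Type) : Type :=
  | EGen of G
  | ECst of K
  | EAdd of expr K G & expr K G
  | EMul of expr K G & expr K G.
Arguments EGen {K G}.
Arguments ECst {K G}.

HB.instance Definition _ (K G : Type) := gen_eqMixin (expr K G).
HB.instance Definition _ (K G : Type) := gen_choiceMixin (expr K G).

Section PresentedAlgebra.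
Variables (K : fieldType) (G : Type).
Notation E := (expr K G).
Variable rel : E -> E -> Prop.

Inductive pcong : E -> E -> Prop :=
  | pc_refl x : pcong x x
  | pc_sym x y : pcong x y -> pcong y x
  | pc_trans x y z : pcong x y -> pcong y z -> pcong x z
  | pc_add x x' y y' : pcong x x' -> pcong y y' -> pcong (EAdd x y) (EAdd x' y')
  | pc_mul x x' y y' : pcong x x' -> pcong y y' -> pcong (EMul x y) (EMul x' y')
  | pc_addA x y z : pcong (EAdd x (EAdd y z)) (EAdd (EAdd x y) z)
  | pc_addC x y : pcong (EAdd x y) (EAdd y x)
  | pc_add0 x : pcong (EAdd (ECst 0) x) x
  | pc_addN x : pcong (EAdd (EMul (ECst (-1)) x) x) (ECst 0)
  | pc_mulA x y z : pcong (EMul x (EMul y z)) (EMul (EMul x y) z)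
  | pc_mul1 x : pcong (EMul (ECst 1) x) x
  | pc_mulDl x y z : pcong (EMul (EAdd x y) z) (EAdd (EMul x z) (EMul y z))
  | pc_mulDr x y z : pcong (EMul x (EAdd y z)) (EAdd (EMul x y) (EMul x z))
  | pc_cstD a b : pcong (ECst (a + b)) (EAdd (ECst a) (ECst b))
  | pc_cstM a b : pcong (ECst (a * b)) (EMul (ECst a) (ECst b))
  | pc_cstC a x : pcong (EMul (ECst a) x) (EMul x (ECst a))
  | pc_rel x y : rel x y -> pcong x y.

Definition pcongb (x y : E) : bool := `[< pcong x y >].

Lemma pcongb_equiv : equiv_class_of pcongb.
Proof.
split=> [x|x y|y x z]; first by apply/asboolP; apply: pc_refl.
- by apply/asboolP/asboolP => h; apply: pc_sym.
- by move=> /asboolP h1 /asboolP h2; apply/asboolP; apply: pc_trans h1 h2.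
Qed.

Canonical pcongb_canonical := EquivRelPack pcongb_equiv.

(** The [K]-algebra with generators [G] and relations [rel].  It is only given
    the structures of a (possibly zero) ring and of a [K]-module: Mathcomp's
    [algType] would require a proof that [1 != 0]. *)
Definition presAlg : Type := {eq_quot pcongb}.

HB.instance Definition _ := Choice.on presAlg.
HB.instance Definition _ := EqQuotient.on presAlg.

Definition pclass (x : E) : presAlg := \pi_{eq_quot pcongb} x.

Lemma pclassP x y : pclass x = pclass y <-> pcong x y.
Proof.
by split=> [/eqmodP/asboolP|h]; [|apply/eqmodP/asboolP].
Qed.

Lemma pclass_repr x : pcong (repr (pclass x)) x.
Proof. by apply/pclassP; rewrite /pclass reprK. Qed.

Lemma pclassK (x : presAlg) : pclass (repr x) = x.
Proof. exact: reprK. Qed.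

Definition padd (x y : presAlg) := pclass (EAdd (repr x) (repr y)).
Definition pmul (x y : presAlg) := pclass (EMul (repr x) (repr y)).
Definition popp (x : presAlg) := pclass (EMul (ECst (-1)) (repr x)).
Definition pscale (a : K) (x : presAlg) := pclass (EMul (ECst a) (repr x)).

Lemma pclassD x y : padd (pclass x) (pclass y) = pclass (EAdd x y).
Proof. by apply/pclassP; apply: pc_add; apply: pclass_repr. Qed.

Lemma pclassM x y : pmul (pclass x) (pclass y) = pclass (EMul x y).
Proof. by apply/pclassP; apply: pc_mul; apply: pclass_repr. Qed.

Lemma pclassN x : popp (pclass x) = pclass (EMul (ECst (-1)) x).
Proof. by apply/pclassP/pc_mul/pclass_repr; apply: pc_refl. Qed.

Lemma pclassZ a x : pscale a (pclass x) = pclass (EMul (ECst a) x).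
Proof. by apply/pclassP/pc_mul/pclass_repr; apply: pc_refl. Qed.

Definition pclassE := (pclassD, pclassM, pclassN, pclassZ).

Lemma paddA : associative padd.
Proof.
move=> x y z; rewrite -[x]pclassK -[y]pclassK -[z]pclassK !pclassE.
exact/pclassP/pc_addA.
Qed.

Lemma paddC : commutative padd.
Proof.
by move=> x y; rewrite -[x]pclassK -[y]pclassK !pclassE; apply/pclassP/pc_addC.
Qed.

Lemma padd0 : left_id (pclass (ECst 0)) padd.
Proof. by move=> x; rewrite -[x]pclassK !pclassE; apply/pclassP/pc_add0. Qed.

Lemma paddN : left_inverse (pclass (ECst 0)) popp padd.
Proof. by move=> x; rewrite -[x]pclassK !pclassE; apply/pclassP/pc_addN. Qed.

HB.instance Definition _ := GRing.isZmodule.Build presAlg paddA paddC padd0 paddN.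

Lemma pmulA : associative pmul.
Proof.
move=> x y z; rewrite -[x]pclassK -[y]pclassK -[z]pclassK !pclassE.
exact/pclassP/pc_mulA.
Qed.

Lemma pmul1 : left_id (pclass (ECst 1)) pmul.
Proof. by move=> x; rewrite -[x]pclassK !pclassE; apply/pclassP/pc_mul1. Qed.

Lemma pmulr1 : right_id (pclass (ECst 1)) pmul.
Proof.
move=> x; rewrite -[x]pclassK !pclassE; apply/pclassP.
by apply: pc_trans (pc_mul1 _); apply/pc_sym/pc_cstC.
Qed.

Lemma pmulDl : left_distributive pmul +%R.
Proof.
move=> x y z; rewrite -[x]pclassK -[y]pclassK -[z]pclassK.
by rewrite /GRing.add /= !pclassE; apply/pclassP/pc_mulDl.
Qed.

Lemma pmulDr : right_distributive pmul +%R.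
Proof.
move=> x y z; rewrite -[x]pclassK -[y]pclassK -[z]pclassK.
by rewrite /GRing.add /= !pclassE; apply/pclassP/pc_mulDr.
Qed.

HB.instance Definition _ :=
  GRing.Zmodule_isPzRing.Build presAlg pmulA pmul1 pmulr1 pmulDl pmulDr.

Lemma pscaleA a b x : pscale a (pscale b x) = pscale (a * b) x.
Proof.
rewrite -[x]pclassK !pclassE; apply/pclassP; apply: pc_trans (pc_mulA _ _ _) _.
by apply: pc_mul (pc_refl _); apply/pc_sym/pc_cstM.
Qed.

Lemma pscale1 : left_id 1 pscale.
Proof. by move=> x; rewrite -[x]pclassK !pclassE; apply/pclassP/pc_mul1. Qed.

Lemma pscaleDr : right_distributive pscale +%R.
Proof.
move=> a x y; rewrite -[x]pclassK -[y]pclassK.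
by rewrite /GRing.add /= !pclassE; apply/pclassP/pc_mulDr.
Qed.

Lemma pscaleDl x : {morph pscale^~ x : a b / a + b}.
Proof.
move=> a b; rewrite -[x]pclassK /= {2}/GRing.add /= !pclassE; apply/pclassP.
apply: pc_trans (pc_mulDl _ _ _); apply: pc_mul (pc_refl _); exact: pc_cstD.
Qed.

HB.instance Definition _ :=
  GRing.Zmodule_isLmodule.Build K presAlg pscaleA pscale1 pscaleDr pscaleDl.

Lemma presAlg_scaleAl (a : K) (x y : presAlg) : a *: (x * y) = (a *: x) * y.
Proof.
rewrite -[x]pclassK -[y]pclassK.
rewrite /GRing.scale /= /GRing.mul /= !pclassE; exact/pclassP/pc_mulA.
Qed.

Definition pgen (g : G) : presAlg := pclass (EGen g).

(** The quotient of the algebra by the left ideal generated by [J]. *)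
Section CyclicModule.
Variable J : presAlg -> Prop.

Inductive left_ideal : presAlg -> Prop :=
  | li_zero : left_ideal 0
  | li_add x y : left_ideal x -> left_ideal y -> left_ideal (x + y)
  | li_mul h x : J x -> left_ideal (h * x).

Definition left_idealb : {pred presAlg} := fun x => `[< left_ideal x >].

Lemma left_ideal_mul h x : left_ideal x -> left_ideal (h * x).
Proof.
elim=> [|y z _ hy _ hz|k y hy]; first by rewrite mulr0; apply: li_zero.
- by rewrite mulrDr; apply: li_add.
- by rewrite mulrA; apply: li_mul.
Qed.

Lemma left_idealb_closed : zmod_closed left_idealb.
Proof.
split=> [|x y /asboolP hx /asboolP hy]; apply/asboolP; first exact: li_zero.
by apply: li_add => //; rewrite -mulN1r; apply: left_ideal_mul.
Qed.

HB.instance Definition _ := GRing.isZmodClosed.Build _ left_idealb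
  left_idealb_closed.

Definition left_ideal_zmod : zmodClosed presAlg :=
  GRing.ZmodClosed.clone _ left_idealb _.

Definition cycMod : Type := Quotient.quot left_ideal_zmod.
HB.instance Definition _ := GRing.Zmodule.on cycMod.

Definition cclass (x : presAlg) : cycMod := \pi_(Quotient.quot left_ideal_zmod) x.

Definition cact (h : presAlg) (m : cycMod) : cycMod :=
  cclass (h * repr (m : Quotient.quot left_ideal_zmod)).

Lemma cclassP x y : cclass x = cclass y <-> left_ideal (x - y).
Proof.
rewrite /cclass; split=> [/eqP|h].
  by rewrite -Quotient.idealrBE => /asboolP.
by apply/eqP; rewrite -Quotient.idealrBE; apply/asboolP.
Qed.

Lemma cactE h x : cact h (cclass x) = cclass (h * x).
Proof.
apply/cclassP; rewrite -mulrBr; apply: left_ideal_mul; apply/cclassP.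
exact: reprK.
Qed.

Lemma cclassD x y : cclass (x + y) = cclass x + cclass y.
Proof. exact: (@Quotient.pi_add _ left_ideal_zmod). Qed.

Lemma cclass_ex m : exists x, m = cclass x.
Proof. by exists (repr (m : Quotient.quot left_ideal_zmod)); rewrite /cclass reprK. Qed.

Definition cscale (a : K) (m : cycMod) : cycMod := cact (a *: (1 : presAlg)) m.

Lemma cscaleA a b m : cscale a (cscale b m) = cscale (a * b) m.
Proof.
have [x ->] := cclass_ex m; rewrite /cscale !cactE mulrA; congr (cclass (_ * _)).
by rewrite -presAlg_scaleAl mul1r scalerA.
Qed.

Lemma cscale1 : left_id 1 cscale.
Proof. by move=> m; have [x ->] := cclass_ex m; rewrite /cscale cactE scale1r mul1r. Qed.

Lemma cscaleDr : right_distributive cscale +%R.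
Proof.
move=> a m1 m2; have [x ->] := cclass_ex m1; have [y ->] := cclass_ex m2.
by rewrite /cscale !cactE -!cclassD cactE mulrDr.
Qed.

Lemma cscaleDl m : {morph cscale^~ m : a b / a + b}.
Proof.
by move=> a b; have [x ->] := cclass_ex m; rewrite /cscale !cactE -cclassD scalerDl mulrDl.
Qed.

HB.instance Definition _ :=
  GRing.Zmodule_isLmodule.Build K cycMod cscaleA cscale1 cscaleDr cscaleDl.

End CyclicModule.

End PresentedAlgebra.

(** The two-sided inverse of [x] when it exists. *)
Definition rinv (A : pzRingType) (x : A) : A :=
  xget 0 [set y | y * x = 1 /\ x * y = 1]%classic.

(** Universal algebra under [presAlg rel] in which the elements [s i] become
    invertible.  When the multiplicative set generated by the [s i] satisfies
    the Ore condition, this is the Ore localization. *)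
Section Localization.
Variables (K : fieldType) (G : Type) (rel : expr K G -> expr K G -> Prop).
Notation A := (presAlg rel).
Variables (I : Type) (s : I -> A).

Inductive loc_rel : expr K (A + I) -> expr K (A + I) -> Prop :=
  | loc_cst c : loc_rel (EGen (inl (c *: (1 : A)))) (ECst c)
  | loc_add a b :
      loc_rel (EGen (inl (a + b))) (EAdd (EGen (inl a)) (EGen (inl b)))
  | loc_mul a b :
      loc_rel (EGen (inl (a * b))) (EMul (EGen (inl a)) (EGen (inl b)))
  | loc_invl i : loc_rel (EMul (EGen (inr i)) (EGen (inl (s i)))) (ECst 1)
  | loc_invr i : loc_rel (EMul (EGen (inl (s i))) (EGen (inr i))) (ECst 1).

Definition locAlg : Type := presAlg loc_rel.
HB.instance Definition _ := GRing.PzRing.on locAlg.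
HB.instance Definition _ := GRing.Lmodule.on locAlg.

Definition to_loc (a : A) : locAlg := pgen loc_rel (inl a).

End Localization.

Definition latpair (d : nat) (P : 'M[rat]_d) (l m : 'cV[int]_d) : rat :=
  ((map_mx intr l)^T *m P *m map_mx intr m) 0 0.

(** Integer value of a pairing; only used where [latpair] is integral. *)
Definition zlatpair (d : nat) (P : 'M[rat]_d) (l m : 'cV[int]_d) : int :=
  Num.floor (latpair P l m).

(** Bases of the lattices h_Z and h_Z^* are fixed, so that both lattices are
    Z^dim and their pairing, which takes rational values, is given by the
    invertible matrix [pairM].  The roots need not span h_R^*.  The finite Weyl
    group is given with its (faithful) actions on h_Z^* and h_Z, and is
    generated by the reflections. *)
Record rootDatum := RootDatum {
  dim : nat;
  pairM : 'M[rat]_dim;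
  pairM_unit : pairM \in unitmx;

  denom : nat;
  denom_gt0 : (0 < denom)%N;
  denom_int : forall i j, denom%:R * pairM i j \is a Num.int;
  denom_min : forall k, (0 < k)%N ->
    (forall i j, k%:R * pairM i j \is a Num.int) -> (denom <= k)%N;

  rootI : finType;
  root : rootI -> 'cV[int]_dim;
  coroot : rootI -> 'cV[int]_dim;
  root_inj : injective root;
  coroot_inj : injective coroot;
  root_int : forall (l : 'cV[int]_dim) a,
    latpair pairM l (root a) \is a Num.int;
  coroot_int : forall a (m : 'cV[int]_dim),
    latpair pairM (coroot a) m \is a Num.int;
  root_coroot : forall a, latpair pairM (coroot a) (root a) = 2%:R;
  root_stable : forall a b, exists c,
    root c = root b - root a *~ zlatpair pairM (coroot a) (root b) /\
    coroot c = coroot b - coroot a *~ zlatpair pairM (coroot b) (root a);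
  root_reduced : forall a b (k l : int), k != 0 ->
    root a *~ k = root b *~ l -> root b = root a \/ root b = - root a;
  root_nonempty : (0 < #|rootI|)%N;
  root_irreducible : forall A : {set rootI},
    (exists a, a \in A) -> (exists b, b \notin A) ->
    exists a b, [/\ a \in A, b \notin A &
      latpair pairM (coroot a) (root b) != 0];

  rank : nat;
  simple : 'I_rank -> rootI;
  simple_free : forall c : 'I_rank -> int,
    \sum_i root (simple i) *~ c i = 0 -> forall i, c i = 0;
  simple_base : forall a, exists c : 'I_rank -> nat,
    root a = \sum_i root (simple i) *+ c i \/
    root a = - \sum_i root (simple i) *+ c i;

  W0 : finGroupType;
  wact : W0 -> 'M[int]_dim;
  wactv : W0 -> 'M[int]_dim;
  wactM : forall w u, wact (w * u)%g = wact w *m wact u;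
  wactvM : forall w u, wactv (w * u)%g = wactv w *m wactv u;
  wact_inj : injective wact;
  refl : rootI -> W0;
  wact_refl : forall a (m : 'cV[int]_dim),
    wact (refl a) *m m = m - root a *~ zlatpair pairM (coroot a) m;
  wactv_refl : forall a (l : 'cV[int]_dim),
    wactv (refl a) *m l = l - coroot a *~ zlatpair pairM l (root a);
  refl_gen : <<[set refl a | a : rootI]>>%g = [set: W0];

  phi : rootI;
  phi_highest : forall a, exists c : 'I_rank -> nat,
    root phi = root a + \sum_i root (simple i) *+ c i;
  theta : rootI;
  theta_highest : forall a, exists c : 'I_rank -> nat,
    coroot theta = coroot a + \sum_i coroot (simple i) *+ c i
}.

Definition hZ (D : rootDatum) : Type := 'cV[int]_(dim D).
Definition hZd (D : rootDatum) : Type := 'cV[int]_(dim D).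
HB.instance Definition _ D := GRing.Zmodule.on (hZ D).
HB.instance Definition _ D := GRing.Zmodule.on (hZd D).

Section Weyl.
Variables (Rr : realType) (D : rootDatum).

Local Notation n := (rank D).
Local Notation node := 'I_n.+1.

Definition lpair (l : hZ D) (m : hZd D) : rat := latpair (pairM D) l m.
Definition zpair (l : hZ D) (m : hZd D) : int := zlatpair (pairM D) l m.

Definition posroot (a : rootI D) : bool :=
  `[< exists c : 'I_n -> nat, root a = \sum_i root (simple i) *+ c i >].

Definition dominant (m : hZd D) : Prop :=
  forall i : 'I_n, 0 <= lpair (coroot (simple i)) m.

(** [(mu, w)] stands for X^mu w. *)
Definition W : Type := (hZd D * W0 D)%type.
HB.instance Definition _ := Choice.on W.

Definition Wone : W := (0, 1%g).
Definition Wmul (v v' : W) : W :=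
  (v.1 + (wact v.2 *m v'.1 : hZd D), (v.2 * v'.2)%g).
Definition Wpow (v : W) (k : nat) : W := iter k (Wmul v) Wone.

(** Elements of h_Z + (1/e)Z d; [(l, k)] stands for l + k d. *)
Definition affwt : Type := (hZ D * rat)%type.
HB.instance Definition _ := GRing.Zmodule.on affwt.

Definition Waff (v : W) (b : affwt) : affwt :=
  (wactv v.2 *m b.1 : hZ D, b.2 - lpair (wactv v.2 *m b.1) v.1).

Definition sW (i : node) : W :=
  match unlift ord0 i with
  | Some j => (0, refl (simple j))
  | None => (root (theta D), refl (theta D))
  end.

Definition acoroot (i : node) : affwt :=
  match unlift ord0 i with
  | Some j => (coroot (simple j), 0)
  | None => (- (coroot (theta D) : hZ D), 1)
  end.

(** The pairing of l with alpha_i, where alpha_0 = - theta + delta. *)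
Definition aroot_pair (l : hZ D) (i : node) : int :=
  match unlift ord0 i with
  | Some j => zpair l (root (simple j))
  | None => - zpair l (root (theta D))
  end.

(** The parameter t_0 is t_theta, as alpha_0^vee = - theta^vee + d. *)
Definition node_root (i : node) : rootI D :=
  if unlift ord0 i is Some j then simple j else theta D.

Definition Wword (l : seq node) : W := foldr (fun i v => Wmul (sW i) v) Wone l.

(** The real spaces h_R and h_R^*, in the same coordinates. *)
Definition hR : Type := 'cV[Rr]_(dim D).
Definition hRd : Type := 'cV[Rr]_(dim D).

Definition rpair (x : hR) (y : hRd) : Rr :=
  (x^T *m map_mx ratr (pairM D) *m y) 0 0.

Definition of_hZ (l : hZ D) : hR := map_mx intr l.
Definition of_hZd (m : hZd D) : hRd := map_mx intr m.

Definition Wreal (v : W) (x : hRd) : hRd :=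
  map_mx intr (wact v.2) *m x + of_hZd v.1.

(** [(a, j)] stands for the hyperplane of a^vee + j d. *)
Definition hyp : Type := (rootI D * int)%type.

Definition pos_side (h : hyp) : set hRd :=
  [set x | - h.2%:~R < rpair (of_hZ (coroot h.1)) x]%classic.
Definition neg_side (h : hyp) : set hRd :=
  [set x | rpair (of_hZ (coroot h.1)) x < - h.2%:~R]%classic.

Definition separates (h : hyp) (B C : set hRd) : Prop :=
  posroot h.1 /\
  ((B `<=` pos_side h /\ C `<=` neg_side h) \/
   (B `<=` neg_side h /\ C `<=` pos_side h))%classic.

Definition fund_alcove : set hRd :=
  [set x | (forall i : 'I_n, 0 < rpair (of_hZ (coroot (simple i))) x) /\
           rpair (of_hZ (coroot (theta D))) x < 1]%classic.

Definition alcove (v : W) : set hRd := (Wreal v @` fund_alcove)%classic.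

Definition lengthW (v : W) : nat :=
  #|` fset_set [set h : hyp | separates h fund_alcove (alcove v)]%classic |%fset.

Definition Omegav : Type := {v : W | lengthW v == 0%N}.

Definition reduced (g : Omegav) (l : seq node) : Prop :=
  lengthW (Wmul (val g) (Wword l)) = size l.

(** [alcove y] is on the positive (negative) side of the hyperplane H_{z,i}
    separating [alcove z] from [alcove (z s_i)]. *)
Definition on_pos_side (z : W) (i : node) (y : W) : bool :=
  `[< exists h, separates h (alcove z) (alcove (Wmul z (sW i))) /\
                (alcove y `<=` pos_side h)%classic >].
Definition on_neg_side (z : W) (i : node) (y : W) : bool :=
  `[< exists h, separates h (alcove z) (alcove (Wmul z (sW i))) /\
                (alcove y `<=` neg_side h)%classic >].

Definition w0 : W0 D := [arg max_(w > (1%g : W0 D)) lengthW (0, w)].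

(** The minimal length element X^mu m of X^mu W_0. *)
Definition min_rep (mu : hZd D) : W :=
  (mu, [arg min_(w < (1%g : W0 D)) lengthW (mu, w)]).

Definition W0word (l : seq 'I_n) : W0 D :=
  foldr (fun i w => (refl (simple i) * w)%g) 1%g l.

Definition W0reduced (w : W0 D) (l : seq 'I_n) : Prop :=
  W0word l = w /\ lengthW (0, w) = size l.

(** W^vee: [(om, u)] stands for Y^om u. *)
Definition Wv : Type := (hZ D * W0 D)%type.

Definition Wvreal (v : Wv) (x : hR) : hR :=
  map_mx intr (wactv v.2) *m x + of_hZ v.1.

Definition fund_alcove_dual : set hR :=
  [set x | (forall i : 'I_n, 0 < rpair x (of_hZd (root (simple i)))) /\
           rpair x (of_hZd (root (phi D))) < 1]%classic.

Definition in_Omega (v : Wv) : Prop :=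
  (Wvreal v @` fund_alcove_dual = fund_alcove_dual)%classic.

Definition same_orbit (a b : rootI D) : bool :=
  [exists w : W0 D, wact w *m root a == root b].

Definition orbit_of (a : rootI D) : {set rootI D} := [set b | same_orbit a b].
Definition orbits : {set {set rootI D}} := [set orbit_of a | a : rootI D].

Lemma orbit_of_in a : orbit_of a \in orbits.
Proof. exact: imset_f. Qed.

Definition orbit_index (a : rootI D) : 'I_#|orbits| :=
  enum_rank_in (orbit_of_in a) (orbit_of a).

(** Rational functions over the complex numbers in q^{1/e} (variable 0) and
    the t_alpha^{1/2} (one variable for each orbit). *)
Definition parK : Type := {fraction {mpoly Rr[i][#|orbits|.+1]}}.
HB.instance Definition _ := GRing.Field.on parK.

Definition qe : parK := tofrac ('X_(ord0 : 'I_#|orbits|.+1))%R.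
Definition th (a : rootI D) : parK := tofrac 'X_(lift ord0 (orbit_index a)).

(** q^x for x in (1/e)Z. *)
Definition qpow (x : rat) : parK := qe ^ Num.floor ((denom D)%:R * x).

Definition thn (i : node) : parK := th (node_root i).

(** t_w^{1/2}; the value does not depend on the reduced word. *)
Definition thw (w : W0 D) : parK :=
  xget 0 [set x | exists2 l, W0reduced w l &
                  x = \prod_(i <- l) th (simple i)]%classic.

(** q^{<l, rho_c>} *)
Definition qrho (l : hZ D) : parK :=
  \prod_(a | posroot a) th a ^ zpair l (root a).

(** q^{<- b, rho_c>} for an affine coroot b. *)
Definition qrho_opp (b : affwt) : parK := qpow b.2 * qrho (- b.1).

Inductive dgen : Type :=
  | GT of node
  | GO of Omegav
  | GY of hZ D.

Local Notation E := (expr parK dgen).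

(** Y^{l + k d} = q^{-k} Y^l *)
Definition eY (b : affwt) : E := EMul (ECst (qpow (- b.2))) (EGen (GY b.1)).

Definition esum (l : seq E) : E := foldr (@EAdd _ _) (ECst 0) l.
Definition eprod (l : seq E) : E := foldr (@EMul _ _) (ECst 1) l.

Definition ealt (i j : node) (m : nat) : E :=
  eprod [seq EGen (GT (if odd k then j else i)) | k <- iota 0 m].

(** (Y^l - Y^{s_i l}) / (1 - Y^{- alpha_i^vee}), where
    s_i l = l - <l, alpha_i> alpha_i^vee. *)
Definition ediff (i : node) (l : hZ D) : E :=
  match aroot_pair l i with
  | Posz k => esum [seq eY ((l, 0) - acoroot i *+ j) | j <- iota 0 k]
  | Negz k =>
      EMul (ECst (-1)) (esum [seq eY ((l, 0) + acoroot i *+ j) | j <- iota 1 k.+1])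
  end.

Definition is_order (v : W) (m : nat) : Prop :=
  [/\ (0 < m)%N, Wpow v m = Wone &
      forall k, (0 < k < m)%N -> Wpow v k <> Wone].

Inductive daha_rel : E -> E -> Prop :=
  | dr_Y0 : daha_rel (EGen (GY 0)) (ECst 1)
  | dr_YD l l' : daha_rel (EGen (GY (l + l'))) (EMul (EGen (GY l)) (EGen (GY l')))
  | dr_O1 g : val g = Wone -> daha_rel (EGen (GO g)) (ECst 1)
  | dr_OM g h k : val k = Wmul (val g) (val h) ->
      daha_rel (EGen (GO k)) (EMul (EGen (GO g)) (EGen (GO h)))
  | dr_braid i j m : is_order (Wmul (sW i) (sW j)) m ->
      daha_rel (ealt i j m) (ealt j i m)
  | dr_OT g g' i j : Wmul (val g) (val g') = Wone ->
      Wmul (Wmul (val g) (sW i)) (val g') = sW j ->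
      daha_rel (EMul (EMul (EGen (GO g)) (EGen (GT i))) (EGen (GO g')))
               (EGen (GT j))
  | dr_OY g l : daha_rel (EMul (EGen (GO g)) (EGen (GY l)))
                         (EMul (eY (Waff (val g) (l, 0))) (EGen (GO g)))
  | dr_quad i : daha_rel (EMul (EGen (GT i)) (EGen (GT i)))
      (EAdd (EMul (ECst (thn i - (thn i)^-1)) (EGen (GT i))) (ECst 1))
  | dr_TY i l : daha_rel (EMul (EGen (GT i)) (EGen (GY l)))
      (EAdd (EMul (eY (Waff (sW i) (l, 0))) (EGen (GT i)))
            (EMul (ECst (thn i - (thn i)^-1)) (ediff i l))).

Definition daha : Type := presAlg daha_rel.
HB.instance Definition _ := GRing.PzRing.on daha.
HB.instance Definition _ := GRing.Lmodule.on daha.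

Definition Tv (i : node) : daha := pgen daha_rel (GT i).
Definition Ov (g : Omegav) : daha := pgen daha_rel (GO g).
Definition Yelt (b : affwt) : daha := qpow (- b.2) *: (pgen daha_rel (GY b.1) : daha).

(** T_w for w in W_0; independent of the reduced word. *)
Definition Tw (w : W0 D) : daha :=
  xget 0 [set x | exists2 l, W0reduced w l &
                  x = \prod_(i <- l) Tv (lift ord0 i)]%classic.

Fixpoint Xword (z : W) (l : seq node) : daha :=
  if l is i :: l' then
    (if on_pos_side z i (Wmul z (sW i)) then rinv (Tv i) else Tv i)
      * Xword (Wmul z (sW i)) l'
  else 1.

(** X^v for v in W; independent of the reduced word. *)
Definition Xelt (v : W) : daha :=
  xget 0 [set x | exists g l, [/\ reduced g l, Wmul (val g) (Wword l) = v &
                                  x = Ov g * Xword (val g) l]]%classic.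

Definition one0 : daha := \sum_(w : W0 D) (thw (w0 * w)%g)^-1 *: Tw w.

(** An affine coroot a^vee + j d. *)
Definition affcoroot (b : rootI D * int) : affwt := (coroot b.1, b.2%:~R).

Definition den (b : rootI D * int) : daha := 1 - Yelt (- affcoroot b).

(** The [den b] generate a (commutative) Ore set, as T_i commutes with s s_i(s)
    for every product s of such elements; this is the Ore localization. *)
Definition daha_loc : Type := locAlg den.
HB.instance Definition _ := GRing.PzRing.on daha_loc.
HB.instance Definition _ := GRing.Lmodule.on daha_loc.

Definition iota_loc (h : daha) : daha_loc := to_loc den h.

Definition tauv_simple (i : node) : daha_loc :=
  iota_loc (Tv i) +
  ((thn i)^-1 * (1 - thn i ^+ 2)) *: rinv (iota_loc (1 - Yelt (- acoroot i))).

(** tau_w^vee; independent of the reduced word. *)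
Definition tauv (v : W) : daha_loc :=
  xget 0 [set x | exists g l,
    [/\ reduced g l, Wmul (val g) (Wword l) = v &
        x = iota_loc (Ov g) * \prod_(i <- l) tauv_simple i]]%classic.

(** [sub_char h c] : h belongs to the subalgebra H generated by T_0, T_1, ...
    T_n and Omega, and acts by the scalar c in the representation 1 of H. *)
Inductive sub_char : daha -> parK -> Prop :=
  | sc_T i : sub_char (Tv (lift ord0 i)) (th (simple i))
  | sc_T0 : sub_char (Yelt (coroot (phi D), 0) * rinv (Tw (refl (phi D)))) (th (phi D))
  | sc_O om u : in_Omega (om, u) -> sub_char (Yelt (om, 0) * rinv (Tw u^-1%g)) 1
  | sc_cst c : sub_char (c *: (1 : daha)) c
  | sc_add h h' c c' :
      sub_char h c -> sub_char h' c' -> sub_char (h + h') (c + c')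
  | sc_mul h h' c c' :
      sub_char h c -> sub_char h' c' -> sub_char (h * h') (c * c').

(** Ind_H(1), the quotient of the algebra by the left ideal generated by the
    h - c with h in H acting by c. *)
Definition ind_gen (x : daha) : Prop :=
  exists h c, sub_char h c /\ x = h - c *: (1 : daha).

Definition polrep : Type := cycMod ind_gen.
HB.instance Definition _ := GRing.Lmodule.on polrep.

Definition vac : polrep := cclass ind_gen (1 : daha).
Definition act (h : daha) (m : polrep) : polrep := cact h m.

Definition Xvac (mu : hZd D) : polrep := act (Xelt (mu, 1%g)) vac.

(** x 1 for x = h s^{-1} in the localization, where s is a product of
    denominators, hence acts on 1 by a nonzero scalar c. *)
Definition loc_vac (x : daha_loc) : polrep :=
  xget 0 [set m | exists (h : daha) (bs : seq (rootI D * int)) (c : parK),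
    let s := \prod_(b <- bs) den b in
    [/\ x * iota_loc s = iota_loc h, c != 0, act s vac = c *: vac &
        m = c^-1 *: act h vac]]%classic.

Definition Emac (mu : hZd D) : polrep := loc_vac (tauv (min_rep mu)).
Definition Pmac (mu : hZd D) : polrep := act one0 (Emac mu).

Definition is_walk (u : W) (w : seq node) (p : seq W) : Prop :=
  [/\ size p = (size w).+1, nth Wone p 0 = u &
      forall k, (k < size w)%N ->
        nth Wone p k.+1 = Wmul (nth Wone p k) (sW (nth ord0 w k)) \/
        nth Wone p k.+1 = nth Wone p k].

(** Step [k] goes from [nth Wone p k] to [nth Wone p k.+1]: steps are numbered
    from 0. *)
Definition pos_fold (w : seq node) (p : seq W) (k : nat) : bool :=
  (nth Wone p k.+1 == nth Wone p k) &&
  on_pos_side (nth Wone p k) (nth ord0 w k) (nth Wone p k).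
Definition neg_fold (w : seq node) (p : seq W) (k : nat) : bool :=
  (nth Wone p k.+1 == nth Wone p k) &&
  on_neg_side (nth Wone p k) (nth ord0 w k) (nth Wone p k).

Definition walk_end (p : seq W) : W := last Wone p.
Definition walk_wt (p : seq W) : hZd D := (walk_end p).1.
Definition walk_dir (p : seq W) : W0 D := (walk_end p).2.

Definition betav (w : seq node) (k : nat) : affwt :=
  Waff (Wword (rev (drop k.+1 w))) (acoroot (nth ord0 w k)).

End Weyl.

(* Main.v *)
(** On the generator of the polynomial representation [Y^l] acts by
    [q^<l, rho_c>].  For short coroots this comes from [T_0], by conjugation
    from [phi^vee]; the short coroots and the minuscule coweights, which are
    translation parts of elements of [Omega], generate the lattice [h_Z].

    By Matsumoto's theorem [T_v] depends only on [v], and for [l] deep in the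
    antidominant chamber [X^v = T_(X^l)^-1 T_(X^l v)]; hence
    [X^z T_i^(-1)] or [X^z T_i] is [X^(z s_i)], according to the sign of the
    crossing.

    Every vector of the polynomial representation is killed by a product of
    ideals of [K[Y]] attached to characters on which [1 - Y^(-b)] is nonzero.
    So these elements act invertibly, the localization acts, and the vectors
    [tau_w 1] are joint eigenvectors of the [Y^l].  The spectrum is simple and
    [tau_w 1 - T_w 1] only involves characters of words shorter than [w], so
    [tau_w 1] does not depend on the reduced word of [w].

    Finally [X^z tau_i] is [X^(z s_i)] plus [X^z] times a scalar on a joint
    eigenvector.  Expanding [X^z tau_(i_1) ... tau_(i_l) 1] from the left turns
    these two terms into the crossing and the fold of an alcove walk, and
    [T_v g = X^(v g)] for [v] in [W_0]. *)

Require Import Defs.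
From HB Require Import structures.
From mathcomp Require Import all_boot all_order all_fingroup all_algebra.
From mathcomp Require Import finmap complex mpoly.
From mathcomp Require Import boolp classical_sets functions cardinality fsbigop.
From mathcomp Require Import reals.
From mathcomp Require Import zify ring lra.
Import Defs.

Set Implicit Arguments.
Unset Strict Implicit.
Unset Printing Implicit Defensive.

Import Order.TTheory GRing.Theory Num.Theory.
Local Open Scope ring_scope.

(** * The pairing of the two lattices *)

Section RootDatumTheory.
Variable D : rootDatum.
Implicit Types (a b c : rootI D) (l : hZ D) (m : hZd D) (w u : W0 D).

(** The algebra, its localization and the module are all given by generators and relations, and
    [Tw], [thw], [Xelt], [tauv] and [loc_vac] each pick some value fitting a description. Much of
    the work is to show that such a value exists and that every admissible choice leads to the same
    result. For [tauv], two reduced words are compared only after application to the generator of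
    the module, where an eigenvector is pinned down by its character and its leading term [T_w 1].

    The vector [2 rho] does most of the work on signs. It is integral and regular: its pairing with
    a coroot decides positivity, its negative multiples give the deep antidominant translations, and
    the exponents of the parameters are compared through it, so that the same regularity keeps the
    denominators nonzero and separates the characters.

    The asymmetry between the two kinds of folds has a single source. The denominator of [tau_i]
    contributes [c / (1 - x)] to every fold; when the crossing is positive, [T_i] is first rewritten
    as [T_i^-1] minus [c], and the coefficient becomes [c / (1 - x) - c = c x / (1 - x)]. *)

Lemma lpairDl l l' m : lpair (l + l') m = lpair l m + lpair l' m.
Proof.
by rewrite /lpair /latpair (@map_mxD _ _ (intr : int -> rat)) linearD /= !mulmxDl mxE.
Qed.

Lemma lpairDr l m m' : lpair l (m + m') = lpair l m + lpair l m'.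
Proof. by rewrite /lpair /latpair (@map_mxD _ _ (intr : int -> rat)) mulmxDr mxE. Qed.

Lemma lpairNl l m : lpair (- l) m = - lpair l m.
Proof.
by rewrite /lpair /latpair (@map_mxN _ _ (intr : int -> rat)) linearN /= !mulNmx mxE.
Qed.

Lemma lpairNr l m : lpair l (- m) = - lpair l m.
Proof. by rewrite /lpair /latpair (@map_mxN _ _ (intr : int -> rat)) mulmxN mxE. Qed.

Definition lpairl m (l : hZ D) : rat := lpair l m.
Definition lpairr l (m : hZd D) : rat := lpair l m.

Fact lpairl_is_zmod_morphism m : zmod_morphism (lpairl m).
Proof. by move=> l l'; rewrite /lpairl lpairDl lpairNl. Qed.
Fact lpairr_is_zmod_morphism l : zmod_morphism (lpairr l).
Proof. by move=> m m'; rewrite /lpairr lpairDr lpairNr. Qed.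

HB.instance Definition _ m := GRing.isZmodMorphism.Build (hZ D) rat (lpairl m)
  (lpairl_is_zmod_morphism m).
HB.instance Definition _ l := GRing.isZmodMorphism.Build (hZd D) rat (lpairr l)
  (lpairr_is_zmod_morphism l).

Lemma lpairMzl l m k : lpair (l *~ k) m = lpair l m *~ k.
Proof. exact: (raddfMz (lpairl m)). Qed.
Lemma lpairMzr l m k : lpair l (m *~ k) = lpair l m *~ k.
Proof. exact: (raddfMz (lpairr l)). Qed.
Lemma lpair0l m : lpair (0 : hZ D) m = 0.
Proof. exact: (raddf0 (lpairl m)). Qed.
Lemma lpair0r l : lpair l (0 : hZd D) = 0.
Proof. exact: (raddf0 (lpairr l)). Qed.

Lemma lpair_inj_r m : (forall l, lpair l m = 0) -> m = 0.
Proof.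
move=> h; suff e : pairM D *m (map_mx intr m : 'cV[rat]_(dim D)) = 0.
  have e2 : map_mx intr m = 0 :> 'cV[rat]_(dim D).
    by rewrite -(mulKmx (pairM_unit D) (map_mx intr m)) e mulmx0.
  apply/colP => i; move/colP/(_ i): e2; rewrite !mxE => /eqP.
  by rewrite intr_eq0 => /eqP.
apply/colP => i; have := h (delta_mx i 0); rewrite /lpair /latpair.
rewrite (_ : map_mx intr (delta_mx i 0) = delta_mx i 0 :> 'cV[rat]_(dim D)); last first.
  by apply/colP=> j; rewrite !mxE; case: (_ && _).
rewrite trmx_delta -mulmxA -rowE [LHS]mxE => ->; by rewrite mxE.
Qed.

Lemma lpair_inj_l l : (forall m, lpair l m = 0) -> l = 0.
Proof.
move=> h; suff e : (map_mx intr l : 'cV[rat]_(dim D))^T *m pairM D = 0.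
  have e2 : (map_mx intr l)^T = 0 :> 'rV[rat]_(dim D).
    by rewrite -(mulmxK (pairM_unit D) (map_mx intr l)^T) e mul0mx.
  apply/colP => i; move/rowP/(_ i): e2; rewrite !mxE => /eqP.
  by rewrite intr_eq0 => /eqP.
apply/rowP => i; have := h (delta_mx i 0); rewrite /lpair /latpair.
rewrite (_ : map_mx intr (delta_mx i 0) = delta_mx i 0 :> 'cV[rat]_(dim D)); last first.
  by apply/colP=> j; rewrite !mxE; case: (_ && _).
rewrite -colE [LHS]mxE => ->; by rewrite mxE.
Qed.

Lemma lpair_denom l m : (denom D)%:R * lpair l m \is a Num.int.
Proof.
rewrite /lpair /latpair mxE mulr_sumr rpred_sum // => j _.
rewrite mxE mulr_suml mulr_sumr rpred_sum // => i _; rewrite !mxE.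
rewrite mulrA rpredM ?intr_int // mulrCA rpredM ?intr_int //.
exact: denom_int.
Qed.

Lemma zpair_rootE l a : (zpair l (root a))%:~R = lpair l (root a).
Proof. by rewrite /zpair /zlatpair floorK // root_int. Qed.
Lemma zpair_corootE a m : (zpair (coroot a) m)%:~R = lpair (coroot a) m.
Proof. by rewrite /zpair /zlatpair floorK // coroot_int. Qed.

Lemma zpair_rootD l l' a : zpair (l + l') (root a) = zpair l (root a) + zpair l' (root a).
Proof. by apply: (@intr_inj rat); rewrite rmorphD /= !zpair_rootE lpairDl. Qed.
Lemma zpair_rootN l a : zpair (- l) (root a) = - zpair l (root a).
Proof. by apply: (@intr_inj rat); rewrite rmorphN /= !zpair_rootE lpairNl. Qed.
Lemma zpair_rootMz l a k : zpair (l *~ k) (root a) = zpair l (root a) * k.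
Proof. by apply: (@intr_inj rat); rewrite rmorphM /= !zpair_rootE lpairMzl mulrzr. Qed.
Lemma zpair_corootD a m m' :
  zpair (coroot a) (m + m') = zpair (coroot a) m + zpair (coroot a) m'.
Proof. by apply: (@intr_inj rat); rewrite rmorphD /= !zpair_corootE lpairDr. Qed.
Lemma zpair_corootN a m : zpair (coroot a) (- m) = - zpair (coroot a) m.
Proof. by apply: (@intr_inj rat); rewrite rmorphN /= !zpair_corootE lpairNr. Qed.
Lemma zpair_corootMz a m k : zpair (coroot a) (m *~ k) = zpair (coroot a) m * k.
Proof. by apply: (@intr_inj rat); rewrite rmorphM /= !zpair_corootE lpairMzr mulrzr. Qed.
Lemma zpair_diag a : zpair (coroot a) (root a) = 2.
Proof. by apply: (@intr_inj rat); rewrite zpair_rootE; exact: root_coroot. Qed.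

Lemma wactM' w u m : wact (w * u)%g *m m = wact w *m (wact u *m m) :> hZd D.
Proof. by rewrite wactM mulmxA. Qed.
Lemma wactvM' w u l : wactv (w * u)%g *m l = wactv w *m (wactv u *m l) :> hZ D.
Proof. by rewrite wactvM mulmxA. Qed.

End RootDatumTheory.

(** * The finite Weyl group acting on roots and coroots *)

Section WeylRoots.
Variable D : rootDatum.
Implicit Types (a b c : rootI D) (l : hZ D) (m : hZd D) (w u : W0 D).

Lemma mulmx_inj n (A B : 'M[int]_n) : (forall x : 'cV_n, A *m x = B *m x) -> A = B.
Proof.
move=> h; apply/matrixP=> i j; have := h (delta_mx j 0); rewrite -!colE.
by move/colP/(_ i); rewrite !mxE.
Qed.

Lemma W0_ind (P : W0 D -> Prop) :
  P 1%g -> (forall a w, P w -> P (refl a * w)%g) -> forall w, P w.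
Proof.
move=> P1 PM w; have: w \in <<[set refl a | a : rootI D]>>%g by rewrite refl_gen inE.
case/gen_prodgP=> n [c hc ->]; elim: n c hc => [|n IH] c hc; first by rewrite big_ord0.
rewrite big_ord_recl; have /imsetP[a _ ->] := hc ord0.
by apply: PM; apply: IH.
Qed.

Lemma wact_reflK a m : wact (refl a) *m (wact (refl a) *m m) = m :> hZd D.
Proof.
rewrite !wact_refl -[zlatpair _ _ (m - _)]/(zpair (coroot a) (m - root a *~ _)).
rewrite zpair_corootD zpair_corootN zpair_corootMz zpair_diag.
rewrite -[zlatpair _ _ m]/(zpair (coroot a) m).
have -> : zpair (coroot a) m - 2 * zpair (coroot a) m = - zpair (coroot a) m by lia.
by rewrite mulrNz opprK subrK.
Qed.

Lemma wactv_reflK a l : wactv (refl a) *m (wactv (refl a) *m l) = l :> hZ D.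
Proof.
rewrite !wactv_refl -[zlatpair _ (l - _) _]/(zpair (l - coroot a *~ _) (root a)).
rewrite zpair_rootD zpair_rootN zpair_rootMz zpair_diag.
rewrite -[zlatpair _ l _]/(zpair l (root a)).
have -> : zpair l (root a) - 2 * zpair l (root a) = - zpair l (root a) by lia.
by rewrite mulrNz opprK subrK.
Qed.

(** Multiplicativity alone only makes this matrix idempotent; cancelling the involutive matrix of a
    reflection, here that of [phi D], forces it to be the identity. *)
Lemma wact1 : wact (1%g : W0 D) = 1%:M.
Proof.
apply: mulmx_inj => x; rewrite mul1mx -[in RHS](wact_reflK (phi D) x).
by rewrite -[wact 1%g *m x](wact_reflK (phi D)) -[wact (refl _) *m (wact 1%g *m x)]wactM' mulg1.
Qed.

Lemma wactv1 : wactv (1%g : W0 D) = 1%:M.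
Proof.
apply: mulmx_inj => x; rewrite mul1mx -[in RHS](wactv_reflK (phi D) x).
by rewrite -[wactv 1%g *m x](wactv_reflK (phi D))
  -[wactv (refl _) *m (wactv 1%g *m x)]wactvM' mulg1.
Qed.

Lemma wactK w m : wact w^-1%g *m (wact w *m m) = m :> hZd D.
Proof. by rewrite -wactM' mulVg wact1 mul1mx. Qed.
Lemma wactVK w m : wact w *m (wact w^-1%g *m m) = m :> hZd D.
Proof. by rewrite -wactM' mulgV wact1 mul1mx. Qed.
Lemma wactvVK w l : wactv w *m (wactv w^-1%g *m l) = l :> hZ D.
Proof. by rewrite -wactvM' mulgV wactv1 mul1mx. Qed.

Lemma lpair_inv w l m : lpair (wactv w *m l) (wact w *m m) = lpair l m.
Proof.
elim/W0_ind: w l m => [|a w IH] l m; first by rewrite wactv1 wact1 !mul1mx.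
rewrite wactM' wactvM' -(IH l m); move: (wactv w *m l : hZ D) (wact w *m m : hZd D) => {IH} {}l {}m.
rewrite wact_refl wactv_refl -[zlatpair _ l _]/(zpair l (root a)).
rewrite -[zlatpair _ _ m]/(zpair (coroot a) m).
rewrite lpairDl !lpairDr !lpairNl !lpairNr !lpairMzl !lpairMzr.
rewrite -(zpair_rootE l a) -(zpair_corootE a m) -zpair_rootE zpair_diag.
move: (zpair _ _) (zpair _ _) => i j.
rewrite -!mulrzA !addrA; move: (lpair l m) => x.
rewrite -[x in RHS]addr0 -!addrA; congr (_ + _).
rewrite -!rmorphN -!rmorphD /=; apply/eqP; rewrite intr_eq0; apply/eqP; lia.
Qed.

Lemma lpair_wactV w l m : lpair l (wact w *m m) = lpair (wactv w^-1%g *m l) m.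
Proof. by rewrite -[RHS](lpair_inv w) wactvVK. Qed.
Lemma lpair_wactvV w l m : lpair (wactv w *m l) m = lpair l (wact w^-1%g *m m).
Proof. by rewrite -[RHS](lpair_inv w) wactVK. Qed.

Lemma ract_subproof w a : exists c,
  (root c == wact w *m root a) && (coroot c == wactv w *m coroot a).
Proof.
elim/W0_ind: w => [|b w [c /andP[/eqP rc /eqP cc]]].
  by exists a; rewrite wact1 wactv1 !mul1mx !eqxx.
have [d [rd cd]] := root_stable b c; exists d.
by rewrite wactM wactvM -!mulmxA -rc -cc wact_refl wactv_refl rd cd !eqxx.
Qed.

(** [root_stable] moves a root and its coroot by the same reflection, so one index carries both
    actions of [w]. The function is sealed in an opaque sigma type, so that [ract] never unfolds to
    a choice. *)
Fact ract_key : {r : W0 D -> rootI D -> rootI D | forall w a,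
  root (r w a) = wact w *m root a /\ coroot (r w a) = wactv w *m coroot a}.
Proof.
exists (fun w a => xchoose (ract_subproof w a)) => w a.
by have /andP[/eqP ? /eqP] := xchooseP (ract_subproof w a).
Qed.

Definition ract : W0 D -> rootI D -> rootI D := sval ract_key.

Lemma root_ract w a : root (ract w a) = wact w *m root a.
Proof. exact: (svalP ract_key w a).1. Qed.
Lemma coroot_ract w a : coroot (ract w a) = wactv w *m coroot a.
Proof. exact: (svalP ract_key w a).2. Qed.

Lemma ractM w u a : ract (w * u)%g a = ract w (ract u a).
Proof. by apply: root_inj; rewrite !root_ract wactM mulmxA. Qed.
Lemma ract1 a : ract 1%g a = a.
Proof. by apply: root_inj; rewrite root_ract wact1 mul1mx. Qed.
Lemma ractK w : cancel (ract w) (ract w^-1%g).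
Proof. by move=> a; rewrite -ractM mulVg ract1. Qed.
Lemma ractVK w : cancel (ract w^-1%g) (ract w).
Proof. by move=> a; rewrite -ractM mulgV ract1. Qed.
Lemma ract_inj w : injective (ract w).
Proof. exact: can_inj (ractK w). Qed.

(** Indices of roots carry no negation; the opposite root is reached as [s_a a]. *)
Definition ropp a : rootI D := ract (refl a) a.

Lemma root_ropp a : root (ropp a) = - root a.
Proof.
rewrite root_ract wact_refl -[zlatpair _ _ _]/(zpair (coroot a) (root a)) zpair_diag.
by rewrite mulrz_nat mulr2n opprD addrA subrr sub0r.
Qed.
Lemma coroot_ropp a : coroot (ropp a) = - coroot a.
Proof.
rewrite coroot_ract wactv_refl -[zlatpair _ _ _]/(zpair (coroot a) (root a)) zpair_diag.
by rewrite mulrz_nat mulr2n opprD addrA subrr sub0r.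
Qed.
Lemma roppK : involutive ropp.
Proof. by move=> a; apply: root_inj; rewrite !root_ropp opprK. Qed.
Lemma ract_ropp w a : ract w (ropp a) = ropp (ract w a).
Proof. by apply: root_inj; rewrite root_ract !root_ropp root_ract mulmxN. Qed.

Lemma conj_refl w a : (w * refl a * w^-1)%g = refl (ract w a).
Proof.
apply: wact_inj; apply: mulmx_inj => x; rewrite !wactM' wact_refl.
rewrite mulmxBr [in LHS]wactVK wact_refl root_ract; congr (_ - _).
rewrite -[zlatpair _ _ _ in LHS]/(zpair (coroot a) (wact w^-1%g *m x)).
rewrite -[zlatpair _ _ _ in RHS]/(zpair (coroot (ract w a)) x).
have -> : zpair (coroot a) (wact w^-1%g *m x) = zpair (coroot (ract w a)) x.
  by apply: (@intr_inj rat); rewrite !zpair_corootE coroot_ract lpair_wactV invgK.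
exact: (raddfMz (mulmx (wact w))).
Qed.

Lemma refl_ropp a : refl (ropp a) = refl a.
Proof. by rewrite -conj_refl mulgK. Qed.

Lemma reflK a : (refl a * refl a = 1)%g.
Proof. by apply: wact_inj; apply: mulmx_inj => x; rewrite wactM' wact_reflK wact1 mul1mx. Qed.
Lemma reflV a : (refl a)^-1%g = refl a.
Proof. by apply/eqP; rewrite eq_invg_mul reflK. Qed.

Lemma root_neq0 a : root a != 0.
Proof.
apply/eqP => e; have := zpair_diag a; rewrite e => /(congr1 (fun x : int => x%:~R : rat)).
by rewrite zpair_corootE lpair0r.
Qed.

Lemma coroot_rrefl a b :
  coroot (ract (refl a) b) = coroot b - coroot a *~ zpair (coroot b) (root a).
Proof. by rewrite coroot_ract wactv_refl. Qed.
Lemma root_rrefl a b : root (ract (refl a) b) = root b - root a *~ zpair (coroot a) (root b).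
Proof. by rewrite root_ract wact_refl. Qed.

(* [2 (a, m) = (a, a) <a^vee, m>] transfers signs and expansions between roots
   and coroots. *)
Definition form (m m' : hZd D) : int :=
  \sum_g zpair (coroot g) m * zpair (coroot g) m'.

Lemma formC m m' : form m m' = form m' m.
Proof. by apply: eq_bigr => g _; rewrite mulrC. Qed.
Lemma formDr m m1 m2 : form m (m1 + m2) = form m m1 + form m m2.
Proof. by rewrite -big_split; apply: eq_bigr => g _; rewrite zpair_corootD mulrDr. Qed.
Lemma formNr m m' : form m (- m') = - form m m'.
Proof. by rewrite -sumrN; apply: eq_bigr => g _; rewrite zpair_corootN mulrN. Qed.
Lemma formMzr m m' k : form m (m' *~ k) = form m m' * k.
Proof. by rewrite mulr_suml; apply: eq_bigr => g _; rewrite zpair_corootMz mulrA. Qed.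

Lemma zpair_ract w a m : zpair (coroot (ract w a)) m = zpair (coroot a) (wact w^-1%g *m m).
Proof. by apply: (@intr_inj rat); rewrite !zpair_corootE coroot_ract lpair_wactvV. Qed.

Lemma form_inv w m m' : form (wact w *m m) (wact w *m m') = form m m'.
Proof.
rewrite /form (reindex_inj (ract_inj (w := w))).
by apply: eq_bigr => g _; rewrite !zpair_ract !wactK.
Qed.

Lemma form_gt0 a : 0 < form (root a) (root a).
Proof.
rewrite /form (bigD1 a) //= zpair_diag ltr_pwDl //.
by apply: sumr_ge0 => g _; rewrite -expr2 sqr_ge0.
Qed.

(** Invariance under the reflection in [a] gives [(a, m) = (-a, m - <a^vee, m> a)]. *)
Lemma formE a m : 2 * form (root a) m = form (root a) (root a) * zpair (coroot a) m.
Proof.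
have := form_inv (refl a) (root a) m.
rewrite -root_ract -/(ropp a) root_ropp wact_refl -[zlatpair _ _ m]/(zpair (coroot a) m).
rewrite formC formNr formC formDr formNr formMzr; move: (form _ m) (_ * _) => x y; lia.
Qed.

Lemma zpair_sign a b : (0 < zpair (coroot a) (root b)) = (0 < zpair (coroot b) (root a)).
Proof.
rewrite -(pmulr_rgt0 _ (form_gt0 a)) -[RHS](pmulr_rgt0 _ (form_gt0 b)).
by rewrite -!formE formC.
Qed.

Lemma zpair_eq0C a b : (zpair (coroot a) (root b) == 0) = (zpair (coroot b) (root a) == 0).
Proof.
have ga := form_gt0 a; have gb := form_gt0 b.
have := formE a (root b); have := formE b (root a); rewrite formC => -> e.
apply/eqP/eqP => h; move: e; rewrite h mulr0 => /eqP;
  rewrite ?[_ == 0]eq_sym ?[0 == _]eq_sym mulf_eq0 => /orP[/eqP|/eqP //] z; lia.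
Qed.

End WeylRoots.

(** * Positive roots, heights, highest root and highest coroot *)

Section Positivity.
Variable D : rootDatum.
Implicit Types (a b c : rootI D) (l : hZ D) (m : hZd D) (w u : W0 D).
Local Notation n := (Defs.rank D).

Lemma lpair_suml I (r : seq I) (P : pred I) (F : I -> hZ D) m :
  lpair (\sum_(i <- r | P i) F i) m = \sum_(i <- r | P i) lpair (F i) m.
Proof. exact: (raddf_sum (lpairl m)). Qed.
Lemma lpair_sumr I (r : seq I) (P : pred I) l (F : I -> hZd D) :
  lpair l (\sum_(i <- r | P i) F i) = \sum_(i <- r | P i) lpair l (F i).
Proof. exact: (raddf_sum (lpairr l)). Qed.

Lemma posrootP a : reflect (exists c : 'I_n -> nat, root a = \sum_i root (simple i) *+ c i)
  (posroot a).
Proof. exact: asboolP. Qed.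

Lemma simple_free_nat (c : 'I_n -> nat) :
  \sum_i root (simple i : rootI D) *+ c i = 0 -> forall i, c i = 0%N.
Proof.
move=> h i; have /simple_free/(_ i) : \sum_i root (simple i : rootI D) *~ (c i)%:Z = 0 by [].
by case.
Qed.

Lemma posroot_opp a : posroot (ropp a) = ~~ posroot a.
Proof.
have [c hc] := simple_base a.
have [/posrootP[c1 h1]|npa] := boolP (posroot a); last first.
  case: hc => hc; first by case/posrootP: npa; exists c.
  by apply/posrootP; exists c; rewrite root_ropp hc opprK.
apply/posrootP => -[c2]; rewrite root_ropp h1 => h2.
have /simple_free_nat h : \sum_i root (simple i : rootI D) *+ (c1 i + c2 i) = 0.
  by rewrite -[RHS](subrr (\sum_i root (simple i : rootI D) *+ c1 i)) h2 -big_split /=;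
    apply: eq_bigr => i _; rewrite mulrnDr.
have /eqP[] := root_neq0 a; rewrite h1 big1 // => i _.
by have := h i; case: (c1 i).
Qed.

Lemma posroot_simple i : posroot (simple i : rootI D).
Proof.
apply/posrootP; exists (fun j => (j == i) : nat).
rewrite (bigD1 i) //= eqxx mulr1n big1 ?addr0 // => j /negPf ->.
by rewrite mulr0n.
Qed.

(** Reflecting in [simple i] changes only the coefficient of [simple i]. If the image were negative,
    all other coefficients would vanish, so [a] would be a multiple of [simple i], and reducedness
    together with positivity leaves only [simple i] itself. *)
Lemma posroot_srefl i a : posroot a -> a != simple i -> posroot (ract (refl (simple i)) a).
Proof.
move=> /posrootP[c hc] ne; apply/negPn/negP; rewrite -posroot_opp => /posrootP[c'].
rewrite root_ropp root_rrefl; set k := zpair _ _ => h.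
have hs : forall j, (c j)%:Z + (c' j)%:Z - k * (j == i)%:Z = 0.
  apply: simple_free.
  under eq_bigr do rewrite mulrzBr mulrzDr.
  rewrite sumrB big_split /= -hc -[X in _ + X - _]h opprB addrCA subrr addr0.
  rewrite (bigD1 i) //= eqxx mulr1 big1 ?addr0 ?subrr // => j /negPf ->.
  by rewrite mulr0 mulr0z.
have e : root a = root (simple i) *~ (c i)%:Z.
  rewrite hc (bigD1 i) //= big1 ?addr0 // => j /negPf ji.
  by have := hs j; rewrite ji mulr0 subr0; case: (c j).
have := @root_reduced D (simple i) a (c i)%:Z 1; rewrite mulr1z -e => h'.
case: h' => //.
- by apply/eqP => z; have /eqP[] := root_neq0 a; rewrite e z.
- by move/root_inj => e'; rewrite e' eqxx in ne.
- rewrite -root_ropp => /root_inj e'.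
  have := posroot_opp (simple i); rewrite -e' posroot_simple.
  by have -> : posroot a by apply/posrootP; exists c.
Qed.

Lemma srefl_pos i a :
  posroot (ract (refl (simple i)) a) = posroot a (+) ((a == simple i) || (a == ropp (simple i))).
Proof.
have [->|n1] := eqVneq a (simple i).
  by rewrite -/(ropp _) posroot_opp posroot_simple.
have [->|n2] := eqVneq a (ropp (simple i)).
  by rewrite ract_ropp -/(ropp (simple i)) roppK posroot_opp !posroot_simple.
rewrite addbF; have [p|np] := boolP (posroot a); first exact: posroot_srefl.
apply/negbTE; rewrite -posroot_opp -ract_ropp posroot_srefl ?posroot_opp //.
by rewrite (can2_eq (@roppK D) (@roppK D)).
Qed.

Definition rho2 : hZd D := \sum_(a | posroot a) root a.

(** The reflection permutes the positive roots other than [simple i], so it moves [2 rho] by exactly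
    [-2] times that root. *)
Lemma zpair_rho2_simple i : zpair (coroot (simple i)) rho2 = 2.
Proof.
have h : wact (refl (simple i)) *m rho2 = rho2 - root (simple i) *~ 2 :> hZd D.
  rewrite {1}/rho2 mulmx_sumr (bigD1 (simple i)) ?posroot_simple //=.
  rewrite [rho2](bigD1 (simple i)) ?posroot_simple //=.
  rewrite -root_ract -/(ropp _) root_ropp mulrz_nat mulr2n opprD addrACA subrr add0r addrC.
  congr (_ + _); rewrite [RHS](reindex_inj (ract_inj (w := refl (simple i)))) /=.
  apply: eq_big => [a|a _]; last by rewrite -root_ract.
  rewrite srefl_pos [ract _ _ == _](can2_eq (ractK _) (ractVK _)) reflV -/(ropp _).
  have [->|n1] := eqVneq a (simple i).
    by rewrite posroot_simple.
  have [->|n2] := eqVneq a (ropp (simple i)); last by rewrite addbF.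
  by rewrite posroot_opp posroot_simple.
move: h; rewrite wact_refl -[zlatpair _ _ _]/(zpair (coroot (simple i)) rho2).
move/addrI/oppr_inj => h; have := congr1 (zpair (coroot (simple i))) h.
by rewrite !zpair_corootMz zpair_diag; lia.
Qed.

(** This is [a^vee = 2 a / (a, a)] cleared of denominators; it carries positivity from roots to
    coroots. The two sides are paired with an arbitrary weight, where [formE] turns each coroot into
    a value of the form. *)
Lemma coroot_expand a (c : 'I_n -> nat) : root a = \sum_i root (simple i) *+ c i ->
  coroot a *~ form (root a) (root a) =
  \sum_i coroot (simple i) *~ ((c i)%:Z * form (root (simple i)) (root (simple i))) :> hZ D.
Proof.
move=> hc; apply/eqP; rewrite -subr_eq0; apply/eqP/lpair_inj_l => m.
rewrite lpairDl lpairNl lpairMzl lpair_suml.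
apply/eqP; rewrite subr_eq0; apply/eqP.
transitivity ((2 * form (root a) m)%:~R : rat).
  by rewrite [X in X%:~R]formE -zpair_corootE -mulrzA mulrC.
rewrite [in form _ m]hc formC.
transitivity ((\sum_i (c i)%:Z * (2 * form (root (simple i)) m))%:~R : rat).
  congr (_%:~R).
  have -> : form m (\sum_i root (simple i) *+ c i) = \sum_i (c i)%:Z * form m (root (simple i)).
    elim/big_rec2: _ => [|i x y _ <-]; last by
      rewrite formDr -[_ *+ _]/(_ *~ (c i)%:Z) formMzr mulrC.
    by rewrite -[0 : hZd D](mulr0z 0) formMzr mulr0.
  by rewrite mulr_sumr; apply: eq_bigr => i _; rewrite formC mulrCA.
rewrite rmorph_sum /=; apply: eq_bigr => i _.
by rewrite formE /lpairl lpairMzl -zpair_corootE -mulrzA [in RHS]mulrC mulrA.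
Qed.

(** Twice the height of the coroot of [a]. Its sign decides whether [a] is positive, and it never
    vanishes. *)
Definition ht a : int := zpair (coroot a) rho2.

Lemma coroot_sum_rho2 (c : 'I_n -> int) :
  lpair (\sum_i coroot (simple i) *~ c i : hZ D) rho2 = (2 * \sum_i c i)%:~R.
Proof.
rewrite lpair_suml mulr_sumr rmorph_sum; apply: eq_bigr => i _ /=.
by rewrite /lpairl lpairMzl -zpair_corootE zpair_rho2_simple -mulrzA.
Qed.

Lemma coroot_pos_lin (R : realDomainType) (F : {additive hZ D -> R}) a : posroot a ->
  (forall i, 0 < F (coroot (simple i))) -> 0 < F (coroot a).
Proof.
move=> /posrootP[c hc] hF; have h := congr1 F (coroot_expand hc).
rewrite raddfMz [RHS]raddf_sum in h.
rewrite -(pmulrz_lgt0 _ (form_gt0 a)) h.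
have hp j : 0 <= F (coroot (simple j) *~ ((c j)%:Z * form (root (simple j)) (root (simple j)))).
  by rewrite raddfMz mulrz_ge0 ?(ltW (hF _)) // mulr_ge0 // ltW // form_gt0.
have [i ci] : exists i, c i != 0%N.
  apply/not_existsP => hn; have /eqP[] := root_neq0 a; rewrite hc big1 // => i _.
  by have := hn i; case: (c i) => // k [].
rewrite (bigD1 i) //= ltr_pwDl //; last exact: sumr_ge0.
by rewrite raddfMz pmulrz_lgt0 // mulr_gt0 ?form_gt0 // ltz_nat lt0n.
Qed.

Lemma ht_gt0 a : posroot a -> 0 < ht a.
Proof.
move=> pa; rewrite -(ltr0z rat) zpair_corootE.
apply: (coroot_pos_lin (F := lpairl rho2)) => // i.
by rewrite /= /lpairl -zpair_corootE zpair_rho2_simple.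
Qed.

Lemma ht_opp a : ht (ropp a) = - ht a.
Proof. by apply: (@intr_inj rat); rewrite rmorphN /= !zpair_corootE coroot_ropp lpairNl. Qed.

Lemma posrootE a : posroot a = (0 < ht a).
Proof.
apply/idP/idP; first exact: ht_gt0.
apply: contraTT; rewrite -posroot_opp => /ht_gt0; rewrite ht_opp; lia.
Qed.

Lemma ht_neq0 a : ht a != 0.
Proof.
have [/ht_gt0|] := boolP (posroot a); first lia.
by rewrite -posroot_opp => /ht_gt0; rewrite ht_opp; lia.
Qed.

Lemma dominant_pos (f : {additive hZd D -> rat}) a : posroot a ->
  (forall i, 0 <= f (root (simple i))) -> 0 <= f (root a).
Proof.
move=> /posrootP[c ->] h; rewrite raddf_sum sumr_ge0 // => i _.
by rewrite raddfMn mulrn_wge0.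
Qed.

Lemma posroot_phi : posroot (phi D).
Proof.
apply/negPn/negP; rewrite -posroot_opp => /posrootP[c]; rewrite root_ropp => h.
have [c' e] := phi_highest (ropp (phi D)).
have /simple_free_nat z : \sum_i root (simple i : rootI D) *+ (c i + (c i + c' i)) = 0.
  under eq_bigr do rewrite !mulrnDr; rewrite !big_split /= -h.
  by rewrite -[X in - _ + (X + _)]root_ropp -e addNr.
have /eqP[] := root_neq0 (phi D); apply: oppr_inj; rewrite oppr0 h big1 // => i _.
by have := z i; case: (c i).
Qed.

Lemma phi_dominant i : 0 <= zpair (coroot (simple i)) (root (phi D)).
Proof.
set k := zpair _ _; have [c e] := phi_highest (ract (refl (simple i)) (phi D)).
have /simple_free/(_ i) : \sum_j root (simple j : rootI D) *~ ((c j)%:Z - k * (j == i)%:Z) = 0.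
  under eq_bigr do rewrite mulrzBr; rewrite sumrB
    -[X in X - _](addKr (root (ract (refl (simple i)) (phi D)))).
  rewrite -[X in _ + X - _]e root_rrefl -/k opprB subrK.
  rewrite (bigD1 i) //= eqxx mulr1 big1 ?addr0 ?subrr // => j /negPf ->.
  by rewrite mulr0 mulr0z.
by rewrite eqxx mulr1 => /eqP; rewrite subr_eq0 => /eqP <-.
Qed.

Lemma phi_pair_ge0 a : posroot a -> 0 <= zpair (coroot (phi D)) (root a).
Proof.
move=> /posrootP[c hc].
suff h : 0 <= zpair (coroot a) (root (phi D)).
  move: h; rewrite !le_eqVlt ![0 == _]eq_sym zpair_eq0C => /orP[-> //|].
  by rewrite zpair_sign => ->; rewrite orbT.
have := congr1 (lpairl (root (phi D))) (coroot_expand hc).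
rewrite /lpairl lpair_suml lpairMzl -zpair_corootE -mulrzA => h.
rewrite -(pmulr_lge0 _ (form_gt0 a)) -(ler_int rat) h sumr_ge0 // => i _.
by rewrite lpairMzl -zpair_corootE mulrz_ge0 // ?ler0z ?phi_dominant // mulr_ge0 // ltW // form_gt0.
Qed.

(** With [k = <phi^vee, a>], the root [-s_phi a] is [k phi - a]. Since [phi] is highest,
    [phi - (k phi - a)] and [phi - a] are both sums of simple roots with natural coefficients. So is
    their sum [(2 - k) phi], and for [k >= 2] this forces all these coefficients to vanish, whence
    [a = phi]. *)
Lemma phi_pair a : posroot a -> a != phi D ->
  zpair (coroot (phi D)) (root a) = 0 \/ zpair (coroot (phi D)) (root a) = 1.
Proof.
move=> pa ne; have := phi_pair_ge0 pa; set k := zpair _ _ => k0.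
suff : k < 2 by lia.
rewrite ltNge; apply/negP => k2.
have [c e] := phi_highest (ropp (ract (refl (phi D)) a)).
have [c' e'] := phi_highest a.
have [f hf] : exists f : 'I_n -> nat, root (phi D) = \sum_i root (simple i) *+ f i.
  exact/posrootP/posroot_phi.
have z : forall i, (k - 2) * (f i)%:Z + ((c i)%:Z + (c' i)%:Z) = 0.
  apply: simple_free; under eq_bigr do rewrite !mulrzDr mulrC mulrzA.
  rewrite !big_split /= -mulrz_suml -hf.
  have -> : \sum_i root (simple i) *~ (c i)%:Z = root a - root (phi D) *~ (k - 1).
    rewrite -[LHS](addKr (root (ropp (ract (refl (phi D)) a)))) -[X in _ + X]e.
    by rewrite root_ropp opprK root_rrefl -/k mulrzBr mulr1z opprB addrA addrAC.
  have -> : \sum_i root (simple i) *~ (c' i)%:Z = root (phi D) - root a.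
    by rewrite [X in X - _]e' addrAC subrr add0r.
  rewrite [root a - _ + _](_ : _ = root (phi D) *~ 1 - root (phi D) *~ (k - 1)).
    rewrite -mulrzBr -mulrzDr.
    by have -> : k - 2 + (1 - (k - 1)) = 0 by lia.
  by rewrite addrC addrA subrK mulr1z.
case/eqP: ne; apply: root_inj; rewrite e' big1 ?addr0 // => i _.
have := z i; have : 0 <= (k - 2) * f i by rewrite mulr_ge0 //; lia.
by case: (c' i) => // m; lia.
Qed.

Lemma posroot_theta : posroot (theta D).
Proof.
have [c e] := theta_highest (ropp (theta D)).
have := congr1 (lpairl rho2) e; rewrite /lpairl lpairDl -!zpair_corootE -/(ht _) -/(ht _) ht_opp.
have -> : \sum_i coroot (simple i) *+ c i = \sum_i coroot (simple i) *~ (c i)%:Z by [].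
rewrite coroot_sum_rho2 -rmorphD /= => /intr_inj h; rewrite posrootE.
have := ht_neq0 (theta D); have : 0 <= \sum_i (c i)%:Z by apply: sumr_ge0.
by move: h; move: (ht _) (\sum_i _); lia.
Qed.

Lemma theta_dominant i : 0 <= zpair (coroot (theta D)) (root (simple i)).
Proof.
set k := zpair _ _; have [c e] := theta_highest (ract (refl (simple i)) (theta D)).
move: e; rewrite coroot_rrefl -/k -addrA -[X in X = _]addr0 => /addrI/esym/eqP.
rewrite addrC subr_eq0 => /eqP e; have := congr1 (lpairl rho2) e.
have -> : \sum_i coroot (simple i) *+ c i = \sum_i coroot (simple i) *~ (c i)%:Z by [].
rewrite /lpairl coroot_sum_rho2 lpairMzl -zpair_corootE zpair_rho2_simple -mulrzA.
move/intr_inj; have : 0 <= \sum_i (c i)%:Z by apply: sumr_ge0.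
by move: (\sum_i _); lia.
Qed.

Lemma theta_pair_ge0 a : posroot a -> 0 <= zpair (coroot a) (root (theta D)).
Proof.
move=> /posrootP[c hc].
suff h : 0 <= zpair (coroot (theta D)) (root a).
  move: h; rewrite !le_eqVlt ![0 == _]eq_sym zpair_eq0C => /orP[-> //|].
  by rewrite zpair_sign => ->; rewrite orbT.
rewrite -(ler_int rat) zpair_corootE hc lpair_sumr sumr_ge0 // => i _.
by rewrite -[_ *+ _]/(_ *~ (c i)%:Z) lpairMzr mulrz_ge0 // -zpair_corootE ler0z theta_dominant.
Qed.

(** The argument of [phi_pair] for coroots. Independence is given for the simple roots, so here the
    coefficients are compared through their sum, read off by pairing with [2 rho]. *)
Lemma theta_pair a : posroot a -> a != theta D ->
  zpair (coroot a) (root (theta D)) = 0 \/ zpair (coroot a) (root (theta D)) = 1.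
Proof.
move=> pa ne; have := theta_pair_ge0 pa; set k := zpair _ _ => k0.
suff : k < 2 by lia.
rewrite ltNge; apply/negP => k2.
have [c e] := theta_highest (ropp (ract (refl (theta D)) a)).
have [c' e'] := theta_highest a.
have := congr1 (lpairl rho2) e; rewrite /lpairl lpairDl coroot_ropp lpairNl coroot_rrefl -/k.
rewrite lpairDl lpairNl lpairMzl -!zpair_corootE -/(ht a) -/(ht (theta D)).
have -> : \sum_i coroot (simple i) *+ c i = \sum_i coroot (simple i) *~ (c i)%:Z by [].
rewrite coroot_sum_rho2 -mulrzA -!(rmorphN, rmorphD) /= => /intr_inj e1.
have := congr1 (lpairl rho2) e'; rewrite /lpairl lpairDl -!zpair_corootE -/(ht a) -/(ht (theta D)).
have -> : \sum_i coroot (simple i) *+ c' i = \sum_i coroot (simple i) *~ (c' i)%:Z by [].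
rewrite coroot_sum_rho2 -!rmorphD /= => /intr_inj e2.
have h0 : 0 < ht (theta D) by rewrite -posrootE posroot_theta.
have s0 : 0 <= \sum_i (c i)%:Z by apply: sumr_ge0.
have : \sum_i (c' i)%:Z == 0.
  have : 0 <= \sum_i (c' i)%:Z by apply: sumr_ge0.
  have : 0 <= (k - 2) * ht (theta D) by apply: mulr_ge0; [lia | exact: ltW].
  clearbody k; move: e1 e2 s0 k2 k0.
  have [S hS] : {S : int | S = \sum_i (c i)%:Z} by exists (\sum_i (c i)%:Z).
  have [S' hS'] : {S : int | S = \sum_i (c' i)%:Z} by exists (\sum_i (c' i)%:Z).
  by rewrite -hS -hS'; move: (ht (theta D)) (ht a) => t t'; nia.
rewrite psumr_eq0 // => /allP z; case/eqP: ne; apply: coroot_inj.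
rewrite e' big1 ?addr0 // => i _; have := z i (mem_index_enum i).
by case: (c' i).
Qed.

(** Simple reflections generate. As [<a^vee, a> = 2], the coroot of a positive root [a] pairs
    positively with some simple root; if [a] is not simple, reflecting in it gives a positive root
    of smaller [ht], whose reflection is conjugate to that of [a]. *)
Lemma W0_simple_ind (P : W0 D -> Prop) :
  P 1%g -> (forall i w, P w -> P (refl (simple i) * w)%g) -> forall w, P w.
Proof.
move=> P1 PM.
pose G := <<[set refl (simple i : rootI D) | i : 'I_n]>>%g.
have hs i : refl (simple i) \in G by apply/mem_gen/imsetP; exists i.
have hp k a : 0 < ht a -> ht a < k%:Z -> refl a \in G.
  elim: k a => [|k IH] a; first lia.
  move=> a0; rewrite -addn1 PoszD => hk.
  have [[i ->]|ns] := pselect (exists i, a = simple i); first exact: hs.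
  have := a0; rewrite -posrootE => pa; have /posrootP[c hc] := pa.
  have [i hi] : exists i, 0 < zpair (coroot a) (root (simple i)).
    apply/not_existsP => hn; have := zpair_diag a; rewrite {1}hc.
    move/(congr1 (intr : int -> rat)); rewrite zpair_corootE lpair_sumr => e.
    suff : (2 : rat) <= 0 by [].
    rewrite -[2]/((2 : int)%:~R) -e; apply: sumr_le0 => j _.
    rewrite -[_ *+ _]/(_ *~ (c j)%:Z) lpairMzr -zpair_corootE -mulrzA lerz0.
    by rewrite mulr_le0_ge0 // leNgt; apply/negP; exact: hn.
  have pb : posroot (ract (refl (simple i)) a).
    by apply: posroot_srefl => //; apply/eqP => e; apply: ns; exists i.
  suff hb : refl (ract (refl (simple i)) a) \in G.
    have -> : refl a = (refl (simple i) * refl (ract (refl (simple i)) a) * refl (simple i))%g.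
      by rewrite -conj_refl reflV !mulgA reflK mul1g -mulgA reflK mulg1.
    by rewrite !groupM.
  apply: IH; first by rewrite -posrootE.
  have -> : ht (ract (refl (simple i)) a) = ht a - 2 * zpair (coroot a) (root (simple i)).
    apply: (@intr_inj rat); rewrite rmorphB /= !zpair_corootE coroot_rrefl lpairDl lpairNl lpairMzl.
    by rewrite -(zpair_corootE (simple i)) zpair_rho2_simple -mulrzA.
  by move: hi hk; lia.
have hG w : w \in G.
  suff : [set: W0 D] \subset G by move/fintype.subsetP; apply; rewrite inE.
  rewrite -refl_gen gen_subG; apply/fintype.subsetP => _ /imsetP[a _ ->].
  have [pa|na] := boolP (posroot a).
    by apply: (hp (`|ht a|%N.+1)); move: pa; rewrite posrootE; lia.
  rewrite -refl_ropp; apply: (hp (`|ht (ropp a)|%N.+1)); move: na;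
    rewrite -posroot_opp posrootE; lia.
move=> w; have /gen_prodgP [k [f hf ->]] := hG w.
elim: k f hf => [|k IH] f hf; first by rewrite big_ord0.
rewrite big_ord_recl; have /imsetP[i _ ->] := hf ord0.
by apply: PM; apply: IH.
Qed.

End Positivity.

Arguments roppK {D}.

(** * Affine coroots, their signs and the simple affine reflections *)

Section AffineWeyl.
Variable D : rootDatum.
Implicit Types (a b c : rootI D) (l : hZ D) (m : hZd D) (w : W0 D) (u v : W D).
Implicit Types (h : rootI D * int).
Local Notation n := (Defs.rank D).
Local Notation node := 'I_n.+1.

Lemma zpair_ropp a m : zpair (coroot (ropp a)) m = - zpair (coroot a) m.
Proof. by apply: (@intr_inj rat); rewrite rmorphN /= !zpair_corootE coroot_ropp lpairNl. Qed.
Lemma zpair_coroot0 a : zpair (coroot a) (0 : hZd D) = 0.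
Proof. by apply: (@intr_inj rat); rewrite zpair_corootE lpair0r. Qed.
Lemma zpair_act w a m : zpair (coroot (ract w a)) (wact w *m m) = zpair (coroot a) m.
Proof. by rewrite zpair_ract wactK. Qed.

Lemma WmulA : associative (@Wmul D).
Proof.
move=> u v v'; congr (_, _); last exact: mulgA.
by rewrite /= mulmxDr wactM mulmxA addrA.
Qed.
Lemma Wmul1v v : Wmul (Wone D) v = v.
Proof. by case: v => m w; rewrite /Wmul /= wact1 mul1mx add0r mul1g. Qed.
Lemma Wmulv1 v : Wmul v (Wone D) = v.
Proof. by case: v => m w; rewrite /Wmul /= mulmx0 addr0 mulg1. Qed.

Definition Winv v : W D := (- (wact v.2^-1%g *m v.1) : hZd D, v.2^-1%g).

Lemma WmulV v : Wmul v (Winv v) = Wone D.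
Proof.
by case: v => m w; congr (_, _); rewrite /= ?mulgV // mulmxN [wact w *m _]wactVK subrr.
Qed.
Lemma WmulVv v : Wmul (Winv v) v = Wone D.
Proof. by case: v => m w; congr (_, _); rewrite /= ?mulVg // addNr. Qed.
Lemma WmulK u v : Wmul (Wmul u v) (Winv v) = u.
Proof. by rewrite -WmulA WmulV Wmulv1. Qed.
Lemma WmulVK u v : Wmul (Wmul u (Winv v)) v = u.
Proof. by rewrite -WmulA WmulVv Wmulv1. Qed.
Lemma WmulKl u v : Wmul (Winv u) (Wmul u v) = v.
Proof. by rewrite WmulA WmulVv Wmul1v. Qed.
Lemma WmulVKl u v : Wmul u (Wmul (Winv u) v) = v.
Proof. by rewrite WmulA WmulV Wmul1v. Qed.
Lemma Winv_uniq u v : Wmul u v = Wone D -> v = Winv u.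
Proof. by move=> e; rewrite -(WmulKl u v) e Wmulv1. Qed.
Lemma WinvM u v : Winv (Wmul u v) = Wmul (Winv v) (Winv u).
Proof. by apply/esym/Winv_uniq; rewrite -WmulA WmulVKl WmulV. Qed.
Lemma Winv1 : Winv (Wone D) = Wone D.
Proof. by apply/esym/Winv_uniq/Wmul1v. Qed.
Lemma Wmul_inj u : injective (Wmul u).
Proof. exact: can_inj (WmulKl u). Qed.
Lemma Wmul_injr v : injective (fun u => Wmul u v).
Proof. by move=> u u' /(congr1 (fun x => Wmul x (Winv v))); rewrite /= !WmulK. Qed.

(** [(a, j)] stands for the affine coroot [a^vee + j d]. *)
Definition aact v h : rootI D * int :=
  (ract v.2 h.1, h.2 - zpair (coroot (ract v.2 h.1)) v.1).
Definition aopp h : rootI D * int := (ropp h.1, - h.2).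
(** The sign that the affine coroot takes on the fundamental alcove, as [hev_gt0] confirms. *)
Definition apos h : bool := if posroot h.1 then 0 <= h.2 else 0 < h.2.
Definition asimple (i : node) : rootI D * int :=
  if unlift ord0 i is Some j then (simple j, 0) else (ropp (theta D), 1).
(** The reflection in the hyperplane [<x, a^vee> = -j], whence the sign of the translation part. *)
Definition arefl h : W D := (- (root h.1 *~ h.2), refl h.1).

Lemma aactM u v h : aact (Wmul u v) h = aact u (aact v h).
Proof.
case: h => a j; rewrite /aact /= ractM; congr (_, _).
by rewrite zpair_corootD zpair_act; lia.
Qed.
Lemma aact1 h : aact (Wone D) h = h.
Proof.
by case: h => a j; rewrite /aact /= ract1 zpair_coroot0 subr0.
Qed.
Lemma aactK v : cancel (aact v) (aact (Winv v)).
Proof. by move=> h; rewrite -aactM WmulVv aact1. Qed.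
Lemma aactVK v : cancel (aact (Winv v)) (aact v).
Proof. by move=> h; rewrite -aactM WmulV aact1. Qed.
Lemma aact_opp v h : aact v (aopp h) = aopp (aact v h).
Proof.
rewrite /aact /aopp /= ract_ropp; congr (_, _).
by rewrite zpair_ropp; lia.
Qed.
Lemma aoppK : involutive aopp.
Proof. by case=> a j; rewrite /aopp /= roppK opprK. Qed.
Lemma apos_opp h : apos (aopp h) = ~~ apos h.
Proof. by case: h => a j; rewrite /apos /= posroot_opp; case: (posroot a) => /=; lia. Qed.

Lemma acorootE i : acoroot i = affcoroot (asimple i).
Proof.
rewrite /acoroot /asimple /affcoroot; case: unliftP => [j|] _ //=.
by rewrite coroot_ropp.
Qed.
Lemma affcoroot_act v h : affcoroot (aact v h) = Waff v (affcoroot h).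
Proof.
by rewrite /affcoroot /Waff /aact /= rmorphB /= zpair_corootE coroot_ract.
Qed.
Lemma affcoroot_opp h : affcoroot (aopp h) = - affcoroot h.
Proof. by rewrite /affcoroot /aopp /= coroot_ropp rmorphN. Qed.

Lemma sWE i : sW i = arefl (asimple i) :> W D.
Proof.
rewrite /sW /asimple /arefl; case: unliftP => [j|] _ /=; first by rewrite mulr0z oppr0.
by rewrite root_ropp mulr1z opprK refl_ropp.
Qed.

Lemma arefl_conj v h : Wmul v (arefl h) = Wmul (arefl (aact v h)) v.
Proof.
case: v h => m w [a j]; rewrite /Wmul /arefl /aact /=; congr (_, _); last first.
  by rewrite -conj_refl mulgKV.
rewrite mulmxN wact_refl -[zlatpair _ _ _]/(zpair (coroot (ract w a)) m).
rewrite [wact w *m _](raddfMz (mulmx (wact w))) /= -root_ract mulrzBr opprB.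
by rewrite [RHS]addrC addrA subrK.
Qed.
Lemma arefl_self h : aact (arefl h) h = aopp h.
Proof.
case: h => a j; rewrite /aact /arefl /aopp /= -/(ropp a); congr (_, _).
by rewrite zpair_ropp zpair_corootN zpair_corootMz zpair_diag; lia.
Qed.
Lemma areflK h : Wmul (arefl h) (arefl h) = Wone D.
Proof.
by rewrite /Wmul /arefl /=; congr (_, _); rewrite ?reflK // mulmxN
  [wact _ *m _](raddfMz (mulmx (wact _))) /= -root_ract -/(ropp _) root_ropp mulNrz opprK addNr.
Qed.
Lemma sWK i : Wmul (sW i) (sW i) = Wone D.
Proof. by rewrite sWE areflK. Qed.
Lemma Winv_sW i : Winv (sW i) = sW i :> W D.
Proof. exact/esym/Winv_uniq/sWK. Qed.
Lemma sW_simple i : aact (sW i) (asimple i) = aopp (asimple i).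
Proof. by rewrite sWE arefl_self. Qed.

Lemma apos_simple i : apos (asimple i).
Proof.
rewrite /apos /asimple; case: unliftP => [j|] _ /=; first by rewrite posroot_simple.
by rewrite posroot_opp posroot_theta.
Qed.

(** By [theta_pair], a positive root other than [theta] is either fixed by [s_theta], with its level
    unchanged, or made negative while its level rises by one. Both moves preserve the sign. *)
Lemma aflip_theta h : posroot h.1 ->
  apos (aact (sW ord0) h) = apos h (+) (h == aopp (asimple ord0)).
Proof.
case: h => a j; rewrite /= /sW unlift_none /aact /= => pa.
rewrite /aopp /asimple unlift_none /= roppK xpair_eqE.
have [->|ne] /= := eqVneq a (theta D).
  rewrite -/(ropp (theta D)) /apos /= posroot_opp posroot_theta /=.
  rewrite zpair_ropp zpair_diag.
  by case: eqP => e /=; rewrite ?addbT ?addbF; lia.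
rewrite addbF /apos /= pa.
have e :
    zpair (coroot (ract (refl (theta D)) a)) (root (theta D)) = - zpair (coroot a) (root (theta D)).
  by rewrite zpair_ract reflV -root_ract -/(ropp _) root_ropp zpair_corootN.
rewrite e; have [z|z] := theta_pair pa ne.
  rewrite z; have -> : ract (refl (theta D)) a = a; last by rewrite pa; lia.
  by apply: coroot_inj; rewrite coroot_rrefl z mulr0z subr0.
have -> : posroot (ract (refl (theta D)) a) = false; last by rewrite z; lia.
by apply/negP => /theta_pair_ge0; rewrite e z.
Qed.

(** The counting of hyperplanes, the exchange property and the structure of [Omegav] all rest on
    this fact. For [i = 0], negative roots are reduced to positive ones by passing to the opposite
    affine coroot. *)
Lemma aflip i h :
  apos (aact (sW i) h) = apos h (+) ((h == asimple i) || (h == aopp (asimple i))).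
Proof.
case: (unliftP ord0 i) => [j|] ->.
  case: h => a k; rewrite /asimple /sW !liftK /aact /aopp /= /apos /=.
  rewrite zpair_coroot0 srefl_pos !xpair_eqE oppr0 -andb_orl subr0.
  by case: (_ || _); case: (posroot a); rewrite /= ?addbF //; lia.
have [p|np] := boolP (posroot h.1).
  rewrite aflip_theta //; congr (_ (+) _); case: (h =P asimple ord0) => [e|//].
  by move: p; rewrite e /asimple unlift_none /= posroot_opp posroot_theta.
have := @aflip_theta (aopp h); rewrite posroot_opp np aact_opp !apos_opp => /(_ isT).
rewrite (can_eq aoppK) addNb => /(can_inj negbK) ->; congr (_ (+) _).
case: (h == asimple ord0) => //=; apply/esym/negbTE/eqP => e.
by move: np; rewrite e /asimple unlift_none /= roppK posroot_theta.
Qed.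

End AffineWeyl.

(** * Alcoves, separating hyperplanes and the length *)

Section Alcoves.
Variables (Rr : realType) (D : rootDatum).
Implicit Types (a b c : rootI D) (l : hZ D) (m : hZd D) (w : W0 D) (u v : W D).
Implicit Types (h : rootI D * int) (x : hRd Rr D) (y : hR Rr D).
Local Notation n := (Defs.rank D).
Local Notation node := 'I_n.+1.

Lemma rpairDl (y y' : hR Rr D) x : rpair (y + y') x = rpair y x + rpair y' x.
Proof. by rewrite /rpair linearD /= !mulmxDl mxE. Qed.
Lemma rpairDr y (x x' : hRd Rr D) : rpair y (x + x') = rpair y x + rpair y x'.
Proof. by rewrite /rpair mulmxDr mxE. Qed.
Lemma rpairZr y k x : rpair y (k *: x) = k * rpair y x.
Proof. by rewrite /rpair -scalemxAr mxE. Qed.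
Lemma rpairNl y x : rpair (- y) x = - rpair y x.
Proof. by rewrite /rpair linearN /= !mulNmx mxE. Qed.
Lemma rpairNr y x : rpair y (- x) = - rpair y x.
Proof. by rewrite /rpair mulmxN mxE. Qed.

Lemma map_intr_ratr p q (A : 'M[int]_(p, q)) :
  map_mx intr A = map_mx ratr (map_mx intr A) :> 'M[Rr]_(p, q).
Proof. by apply/matrixP => i j; rewrite !mxE ratr_int. Qed.

Lemma rpair_of l m : rpair (of_hZ Rr l) (of_hZd Rr m) = ratr (lpair l m).
Proof.
by rewrite /rpair /of_hZ /of_hZd !map_intr_ratr map_trmx -!map_mxM mxE.
Qed.

Lemma wact_pairM w :
  (map_mx intr (wactv w))^T *m pairM D *m map_mx intr (wact w) = pairM D.
Proof.
have ed p (i : 'I_p) : map_mx intr (delta_mx i 0 : 'cV[int]_p) = delta_mx i 0 :> 'cV[rat]_p.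
  by apply/matrixP=> k k'; rewrite !mxE; case: (_ && _).
apply/matrixP => i j.
have hM (M : 'M[rat]_(Defs.dim D)) :
    ((delta_mx i 0 : 'cV_(Defs.dim D))^T *m M *m (delta_mx j 0 : 'cV_(Defs.dim D))) 0 0 = M i j.
  by rewrite trmx_delta -rowE -colE !mxE.
rewrite -[LHS]hM -[RHS]hM.
have := lpair_inv w (delta_mx i 0 : hZ D) (delta_mx j 0 : hZd D).
by rewrite /lpair /latpair !map_mxM !ed trmx_mul !mulmxA.
Qed.

Lemma rpair_inv w y x :
  rpair (map_mx intr (wactv w) *m y : hR Rr D) (map_mx intr (wact w) *m x : hRd Rr D) = rpair y x.
Proof.
rewrite /rpair trmx_mul !mulmxA -[X in (X *m x) 0 0]mulmxA -[X in (X *m x) 0 0]mulmxA.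
have -> : (map_mx intr (wactv w))^T *m (map_mx ratr (pairM D) *m map_mx intr (wact w)) =
   map_mx ratr (pairM D) :> 'M[Rr]_(Defs.dim D).
  by rewrite mulmxA !map_intr_ratr map_trmx -!map_mxM wact_pairM.
by [].
Qed.

Lemma of_hZ_wactv w l : of_hZ Rr (wactv w *m l : hZ D) = map_mx intr (wactv w) *m of_hZ Rr l.
Proof. by rewrite /of_hZ map_mxM. Qed.
Lemma of_hZd_wact w m : of_hZd Rr (wact w *m m : hZd D) = map_mx intr (wact w) *m of_hZd Rr m.
Proof. by rewrite /of_hZd map_mxM. Qed.
Lemma of_hZD l l' : of_hZ Rr (l + l') = of_hZ Rr l + of_hZ Rr l'.
Proof. exact: map_mxD. Qed.
Lemma of_hZN l : of_hZ Rr (- l) = - of_hZ Rr l.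
Proof. exact: map_mxN. Qed.
Lemma of_hZdD m m' : of_hZd Rr (m + m') = of_hZd Rr m + of_hZd Rr m'.
Proof. exact: map_mxD. Qed.

Definition rpairl x (l : hZ D) : Rr := rpair (of_hZ Rr l) x.
Fact rpairl_is_zmod_morphism x : zmod_morphism (rpairl x).
Proof. by move=> l l'; rewrite /rpairl of_hZD of_hZN rpairDl rpairNl. Qed.
HB.instance Definition _ x := GRing.isZmodMorphism.Build (hZ D) Rr (rpairl x)
  (rpairl_is_zmod_morphism x).

Definition hev x h : Rr := rpair (of_hZ Rr (coroot h.1)) x + h.2%:~R.

Lemma hev_act v x h : hev (Wreal v x) (aact v h) = hev x h.
Proof.
rewrite /hev /Wreal /aact /= rpairDr coroot_ract of_hZ_wactv rpair_inv -of_hZ_wactv -coroot_ract.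
rewrite rpair_of rmorphB /= -zpair_corootE ratr_int -addrA; congr (_ + _).
by rewrite addrC subrK.
Qed.

Lemma hev_opp x h : hev x (aopp h) = - hev x h.
Proof. by rewrite /hev /aopp /= coroot_ropp of_hZN rpairNl opprD rmorphN. Qed.

Lemma fund_alcoveP x : fund_alcove x <-> forall i, 0 < hev x (asimple i).
Proof.
rewrite /hev /asimple; split=> [[h1 h2] i|h].
  case: unliftP => [j|] _ /=; first by rewrite addr0.
  by rewrite coroot_ropp of_hZN rpairNl addrC subr_gt0.
split=> [i|]; first by have := h (lift ord0 i); rewrite liftK /= addr0.
by have := h ord0; rewrite unlift_none /= coroot_ropp of_hZN rpairNl addrC subr_gt0.
Qed.

Lemma fund_alcove_bounds x a : fund_alcove x -> posroot a ->
  0 < rpair (of_hZ Rr (coroot a)) x < 1.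
Proof.
move=> [h1 h2] pa.
rewrite (coroot_pos_lin (F := rpairl x)) //=; apply: le_lt_trans h2.
have [c ->] := theta_highest a; rewrite of_hZD rpairDl lerDl -/(rpairl x _) raddf_sum.
by apply: sumr_ge0 => i _; rewrite raddfMn mulrn_wge0 // ltW // h1.
Qed.

(** On the alcove a positive coroot takes values strictly between 0 and 1, so the integral level
    decides the sign. *)
Lemma hev_gt0 x h : fund_alcove x -> (0 < hev x h) = apos h.
Proof.
move=> hx; wlog p : h / posroot h.1 => [hw|].
  have [/hw //|np] := boolP (posroot h.1).
  have := hw (aopp h); rewrite posroot_opp => /(_ np).
  rewrite hev_opp apos_opp oppr_gt0 => e; apply: negb_inj; rewrite -e -leNgt.
  have : hev x h != 0.
    have := fund_alcove_bounds hx (a := ropp h.1); rewrite posroot_opp => /(_ np).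
    rewrite coroot_ropp of_hZN rpairNl /hev => /andP[q1 q2]; apply/eqP => z.
    have : 0 < (h.2%:~R : Rr) < 1 by lra.
    by rewrite ltr0z (ltrz1 Rr); lia.
  by rewrite le_eqVlt => /negPf ->.
have /andP[q1 q2] := fund_alcove_bounds hx p.
rewrite /apos p /hev; apply/idP/idP => q.
  have : -1 < (h.2%:~R : Rr) by lra.
  by rewrite -(intrN Rr 1) ltr_int; lia.
have : 0 <= (h.2%:~R : Rr) by rewrite ler0z.
lra.
Qed.

Lemma hev_lt0 x h : fund_alcove x -> (hev x h < 0) = ~~ apos h.
Proof. by move=> hx; rewrite -apos_opp -(hev_gt0 _ hx) hev_opp oppr_gt0. Qed.

Lemma fund_alcove_nonempty : exists x, fund_alcove x.
Proof.
have t0 : 0 < ht (theta D) by rewrite -posrootE posroot_theta.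
(* The point is [2 rho / (ht theta + 1)]: simple coroots take the value [2 k] on it, and [theta^vee]
   takes [ht theta / (ht theta + 1)], just below 1. *)
pose k : Rr := ((ht (theta D) + 1)%:~R)^-1.
have k0 : 0 < k by rewrite invr_gt0 ltr0z; lia.
exists (k *: of_hZd Rr (rho2 D)); split=> [i|]; rewrite rpairZr rpair_of -zpair_corootE ratr_int.
  by rewrite zpair_rho2_simple mulr_gt0.
by rewrite -/(ht _) /k mulrC ltr_pdivrMr ?ltr0z ?mul1r ?ltr_int; lia.
Qed.

Lemma alcove_pos v h : (@alcove Rr D v `<=` pos_side h)%classic <-> apos (aact (Winv v) h).
Proof.
split=> [hs|p].
  have [x hx] := fund_alcove_nonempty.
  have : pos_side h (Wreal v x) by apply: hs; exists x.
  rewrite /pos_side /= -subr_gt0 opprK -/(hev _ h).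
  by rewrite -[h in hev _ h](aactVK v) hev_act hev_gt0.
move=> _ [x hx <-]; rewrite /pos_side /= -subr_gt0 opprK -/(hev _ h).
by rewrite -[h in hev _ h](aactVK v) hev_act hev_gt0.
Qed.

Lemma alcove_neg v h : (@alcove Rr D v `<=` neg_side h)%classic <-> ~~ apos (aact (Winv v) h).
Proof.
split=> [hs|p].
  have [x hx] := fund_alcove_nonempty.
  have : neg_side h (Wreal v x) by apply: hs; exists x.
  rewrite /neg_side /= -subr_lt0 opprK -/(hev _ h).
  by rewrite -[h in hev _ h](aactVK v) hev_act hev_lt0.
move=> _ [x hx <-]; rewrite /neg_side /= -subr_lt0 opprK -/(hev _ h).
by rewrite -[h in hev _ h](aactVK v) hev_act hev_lt0.
Qed.

Lemma separatesE u v h : separates h (@alcove Rr D u) (@alcove Rr D v) <->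
  posroot h.1 /\ apos (aact (Winv u) h) != apos (aact (Winv v) h).
Proof.
rewrite /separates !alcove_pos !alcove_neg; split=> -[p q]; split=> //.
  by case: q; move: (apos (aact (Winv u) h)) (apos (aact (Winv v) h)) => [] [] [].
by move: q; move: (apos (aact (Winv u) h)) (apos (aact (Winv v) h)) => [] [] //= _; [left|right].
Qed.

Lemma alcove1 : @alcove Rr D (Wone D) = fund_alcove (Rr := Rr) (D := D).
Proof.
have e x : Wreal (Wone D) x = x.
  rewrite /Wreal /= wact1 map_mx1 mul1mx /of_hZd.
  by rewrite (_ : map_mx _ _ = 0) ?addr0 //; apply/matrixP => i j; rewrite !mxE.
by apply/seteqP; split=> [_ [x hx <-]|x hx]; [rewrite e | exists x; rewrite ?e].
Qed.

Definition sepset v : set (hyp D) :=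
  [set h | posroot h.1 /\ apos h != apos (aact (Winv v) h)]%classic.

Lemma lengthWE v : lengthW Rr v = #|` fset_set (sepset v)|%fset.
Proof.
congr (#|` fset_set _|%fset); apply/seteqP; split=> h /=.
  by rewrite -alcove1 => /separatesE; rewrite Winv1 aact1.
by move=> e; rewrite -alcove1; apply/separatesE; rewrite Winv1 aact1.
Qed.

Lemma sepset_finite v : finite_set (sepset v).
Proof.
(* A separating hyperplane of level [j] satisfies [|j| <= |<a^vee, v.1>|], so [N] bounds all levels
   at once. *)
pose N := (\sum_a `|zpair (coroot a) v.1|)%N.
pose f (p : rootI D * 'I_(2 * N + 1)) : hyp D := (p.1, p.2%:Z - N%:Z).
apply: (@sub_finite_set _ _ (range f)); last exact/finite_image/finite_finset.
move=> [a j] /= [pa]; rewrite /apos /aact /= pa.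
have -> :
    zpair (coroot (ract v.2^-1%g a)) (- (wact v.2^-1%g *m v.1) : hZd D) = - zpair (coroot a) v.1.
  by rewrite zpair_corootN zpair_act.
have hN : (`|zpair (coroot a) v.1| <= N)%N by rewrite /N (bigD1 a) //= leq_addr.
move=> hs; have hj : (absz (j + N%:Z)%R < 2 * N + 1)%N.
  by move: hs hN; case: ifP => _; lia.
exists (a, Ordinal hj) => //; rewrite /f /=; congr (_, _).
by move: hs hN; case: ifP => _; lia.
Qed.

(** By [aflip] the separating sets of [v] and [v s_i] differ in one hyperplane only, that of
    [v alpha_i]; [h0] is its representative with a positive root. The predecessor never truncates,
    by [lengthW_gt0]. *)
Lemma lengthW_step v i : lengthW Rr (Wmul v (sW i)) =
  if apos (aact v (asimple i)) then (lengthW Rr v).+1 else (lengthW Rr v).-1.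
Proof.
pose h0 := if posroot (aact v (asimple i)).1 then aact v (asimple i)
           else aopp (aact v (asimple i)).
have p0 : posroot h0.1.
  by rewrite /h0; case: ifP => // /negbT np; rewrite posroot_opp.
have e0 h : posroot h.1 ->
    (aact (Winv v) h == asimple i) || (aact (Winv v) h == aopp (asimple i)) = (h == h0).
  move=> ph; rewrite !(can2_eq (aactVK v) (aactK v)) aact_opp /h0; case: ifP => q.
    case: (h =P aopp _) => [e|_]; last by rewrite orbF.
    by move: ph; rewrite e /= posroot_opp q.
  by case: (h =P aact _ _) => [e|//]; move: ph; rewrite e q.
have m0 : (sepset v h0) <-> ~~ apos (aact v (asimple i)).
  rewrite /sepset /= /h0; case: ifP => q; rewrite ?aact_opp aactK ?apos_opp apos_simple.
    by split=> [[_]|]; rewrite ?q; case: apos.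
  by split=> [[_]|]; rewrite ?posroot_opp ?q; case: apos.
have hs h : sepset (Wmul v (sW i)) h <->
    posroot h.1 /\ (apos h != apos (aact (Winv v) h) (+) (h == h0)).
  rewrite /sepset /= WinvM Winv_sW aactM aflip.
  by split=> -[p q]; split=> //; [rewrite -e0 | rewrite e0].
rewrite !lengthWE; case: ifP => q.
  have -> : sepset (Wmul v (sW i)) = (h0 |` sepset v)%classic.
    apply/seteqP; split=> h.
      move=> /hs[p]; case: (h =P h0) => [->|_]; first by left.
      by rewrite addbF; right.
    case=> [->|hv]; apply/hs; split=> //.
    - rewrite eqxx addbT; apply/negP => /negP e; have : sepset v h0.
        by split=> //; move: e; move: (apos h0) (apos (aact (Winv v) h0)) => [] [].
      by move/m0; rewrite q.
    - by case: hv.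
    - case: (h =P h0) => [e|_]; last by rewrite addbF; case: hv.
      by move: hv; rewrite e => /m0; rewrite q.
  rewrite fset_setU1 ?cardfsU1; last exact: sepset_finite.
  rewrite in_fset_set; last exact: sepset_finite.
  by rewrite (_ : h0 \in _ = false) //; apply/negP => /set_mem/m0; rewrite q.
have -> : sepset (Wmul v (sW i)) = (sepset v `\ h0)%classic.
  have hv0 : sepset v h0 by apply/m0; rewrite q.
  apply/seteqP; split=> h.
    move=> /hs[p]; case: (h =P h0) => [->|ne]; last by rewrite addbF; split=> //.
    by rewrite addbT; case: hv0 => _; move: (apos h0) (apos (aact (Winv v) h0)) => [] [].
  by move=> [[p p'] /= ne]; apply/hs; split=> //; case: (h =P h0) => // _; rewrite addbF.
rewrite fset_setD1; last exact: sepset_finite.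
rewrite [in RHS](cardfsD1 h0) in_fset_set; last exact: sepset_finite.
by rewrite mem_set //; apply/m0; rewrite q.
Qed.

Lemma lengthW_gt0 v i : ~~ apos (aact v (asimple i)) -> (0 < lengthW Rr v)%N.
Proof.
move=> np; have := lengthW_step (Wmul v (sW i)) i.
rewrite aactM sW_simple aact_opp apos_opp np -WmulA sWK Wmulv1 => ->.
by [].
Qed.

Lemma lengthW0P v : lengthW Rr v = 0%N <-> forall h, apos (aact v h) = apos h.
Proof.
rewrite lengthWE; split=> [e h|h].
  have hn h' : posroot h'.1 -> apos (aact (Winv v) h') = apos h'.
    move=> p; apply/eqP; rewrite eq_sym; apply/negPn/negP => ne.
    have : h' \in fset_set (sepset v) by rewrite in_fset_set ?mem_set //; exact: sepset_finite.
    by move/cardfs0_eq: e => ->.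
  have [p|p] := boolP (posroot (aact v h).1); first by rewrite -(hn _ p) aactK.
  have := hn (aopp (aact v h)); rewrite posroot_opp => /(_ p).
  by rewrite aact_opp aactK !apos_opp => /negb_inj.
suff -> : sepset v = set0 by rewrite fset_set0.
rewrite -subset0 => h' [_]; rewrite -(h (aact (Winv v) h')) aactVK eqxx.
by [].
Qed.

(** If [v] keeps the simple affine coroots positive, then [v^-1] maps a point of the alcove into the
    alcove, and the sign of an affine coroot may be read at either point. *)
Lemma lengthW0 v : (forall i, apos (aact v (asimple i))) -> lengthW Rr v = 0%N.
Proof.
move=> hv; apply/lengthW0P => h; have [x hx] := fund_alcove_nonempty.
have hx' : fund_alcove (Wreal (Winv v) x).
  apply/fund_alcoveP => i; rewrite -[asimple i](aactK v) hev_act.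
  by rewrite hev_gt0 // hv.
by rewrite -(hev_gt0 _ hx) -(hev_gt0 _ hx') -[in RHS](aactK v h) hev_act.
Qed.

Lemma lengthW1 : lengthW Rr (Wone D) = 0%N.
Proof. by apply/lengthW0 => i; rewrite aact1 apos_simple. Qed.

Lemma lengthW_step_le v i : (lengthW Rr (Wmul v (sW i)) <= (lengthW Rr v).+1)%N.
Proof. by rewrite lengthW_step; case: ifP; lia. Qed.

End Alcoves.

(** * Reduced words, Matsumoto's theorem and elements of length zero *)

Section Words.
Variables (Rr : realType) (D : rootDatum).
Implicit Types (u v g : W D) (h : rootI D * int).
Local Notation n := (Defs.rank D).
Local Notation node := 'I_n.+1.
Implicit Types (i j : node) (l : seq node).
Local Notation L := (lengthW Rr).
Local Notation word := (@Wword D).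

Lemma Wword_cat l l' : word (l ++ l') = Wmul (word l) (word l').
Proof. by elim: l => [|i l IH] /=; rewrite ?Wmul1v // IH WmulA. Qed.
Lemma Wword_rcons l i : word (rcons l i) = Wmul (word l) (sW i).
Proof. by rewrite -cats1 Wword_cat /= Wmulv1. Qed.
Lemma Wword_rev l : word (rev l) = Winv (word l).
Proof. by elim: l => [|i l IH] /=; rewrite ?Winv1 // rev_cons Wword_rcons IH WinvM Winv_sW. Qed.

Lemma length_word_le g l : (L (Wmul g (word l)) <= L g + size l)%N.
Proof.
elim/last_ind: l => [|l i IH]; first by rewrite Wmulv1 addn0.
rewrite Wword_rcons WmulA size_rcons addnS.
by apply: leq_trans (lengthW_step_le _ _ _) _; rewrite ltnS.
Qed.

(** Apply the letters of [l] to [alpha_j] from the right. The letter at which the sign changes has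
    the current affine coroot as its simple one, so [s_j], conjugated to that place, cancels it. *)
Lemma exchange l j : ~~ apos (aact (word l) (asimple j)) ->
  exists l1 k l2, l = l1 ++ k :: l2 /\ word (l1 ++ l2) = Wmul (word l) (sW j).
Proof.
elim: l => [|i l IH] /=; first by rewrite aact1 apos_simple.
have [p|/IH[l1 [k [l2 [-> e]]]] _] := boolP (apos (aact (word l) (asimple j))); last first.
  by exists (i :: l1), k, l2; rewrite /= e WmulA.
rewrite aactM aflip p /=; case: (aact _ _ =P asimple i) => [e _|_].
  exists [::], i, l; split => //=.
  by rewrite -WmulA [sW j]sWE arefl_conj e -sWE WmulA sWK Wmul1v.
case: eqP => // e; move: p; rewrite e apos_opp.
by rewrite apos_simple.
Qed.

Definition isred l := L (word l) = size l.

Lemma reduce l : exists l', word l' = word l /\ isred l'.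
Proof.
elim/last_ind: l => [|l i [l' [e r]]]; first by exists [::]; rewrite /isred lengthW1.
have [p|/exchange[l1 [k [l2 [el ew]]]]] := boolP (apos (aact (word l') (asimple i))).
  by exists (rcons l' i); rewrite /isred !Wword_rcons -e lengthW_step p size_rcons r.
exists (l1 ++ l2); split; first by rewrite ew Wword_rcons e.
rewrite /isred ew lengthW_step; case: ifP => p; last first.
  by rewrite r el !size_cat addnS.
have := length_word_le (Wone D) (l1 ++ l2).
rewrite ew Wmul1v lengthW_step p r el lengthW1 !size_cat /=; lia.
Qed.

Lemma length_word0 l : L (word l) = 0%N -> word l = Wone D.
Proof. by have [l' [<- ->]] := reduce l; case: l'. Qed.

Lemma isred_cat l l' : isred (l ++ l') -> isred l.
Proof.
rewrite /isred Wword_cat size_cat => e; have := length_word_le (word l) l'.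
have := length_word_le (Wone D) l; rewrite Wmul1v lengthW1 e; lia.
Qed.

Lemma isred_rcons l i : isred (rcons l i) -> isred l /\ apos (aact (word l) (asimple i)).
Proof.
move=> r; have r' : isred l by move: r; rewrite -cats1; exact: isred_cat.
split=> //; move: r; rewrite /isred Wword_rcons lengthW_step size_rcons r'.
by case: ifP => //; lia.
Qed.

Lemma isred_cons i l : isred (i :: l) -> isred l.
Proof.
have [l' [e r]] := reduce l; rewrite /isred /= -e r => hr.
have := length_word_le (Wone D) (i :: l'); rewrite Wmul1v lengthW1 /= hr.
by have := length_word_le (Wone D) l; rewrite Wmul1v lengthW1 -e r; lia.
Qed.

Lemma isred_size l l' : word l = word l' -> isred l -> size l' = size l -> isred l'.
Proof. by rewrite /isred => <- -> ->. Qed.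

Lemma not_apos_last l j b : word l = word (rcons b j) -> isred (rcons b j) ->
  ~~ apos (aact (word l) (asimple j)).
Proof.
move=> -> /isred_rcons[_ p]; rewrite Wword_rcons aactM sW_simple aact_opp apos_opp.
by rewrite p.
Qed.

Definition alt (m : nat) i j : seq node := [seq if odd k then j else i | k <- iota 0 m].
Arguments alt : simpl never.

Lemma altS m i j : alt m.+1 i j = i :: alt m j i.
Proof.
rewrite /alt /= -[1%N]addn0 iotaDl -map_comp; congr (_ :: _); apply: eq_map => k /=.
by case: (odd k).
Qed.
Lemma alt_rcons m i j : alt m.+1 i j = rcons (alt m i j) (if odd m then j else i).
Proof. by rewrite /alt -[m.+1]/(1 + m)%N addnC iotaD map_cat cats1 add0n. Qed.
Lemma size_alt m i j : size (alt m i j) = m.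
Proof. by rewrite size_map size_iota. Qed.

Lemma Wword_cons i l : word (i :: l) = Wmul (sW i) (word l). Proof. by []. Qed.
Lemma WpowS u k : Wpow u k.+1 = Wmul u (Wpow u k). Proof. by []. Qed.

Lemma Wpow_conj u v k : Wmul u (Wmul (Wpow (Wmul v u) k) v) = Wpow (Wmul u v) k.+1.
Proof.
elim: k => [|k IH]; first by rewrite /Wpow /= Wmul1v Wmulv1.
by rewrite [in RHS]WpowS -IH WpowS -!WmulA.
Qed.

Lemma Wpow_alt k i j :
  Wmul (word (alt k i j)) (Winv (word (alt k j i))) = Wpow (Wmul (sW i) (sW j)) k.
Proof.
elim: k i j => [|k IH] i j; first by rewrite Winv1 Wmulv1.
by rewrite !altS !Wword_cons WinvM Winv_sW -Wpow_conj -IH !WmulA.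
Qed.

(** An equality at a smaller [k] would turn [alt k.+1 i j] into a word beginning with [i] twice,
    contradicting that this prefix is reduced. *)
Lemma alt_eq_order m i j : (0 < m)%N -> isred (alt m i j) ->
  word (alt m i j) = word (alt m j i) -> is_order (Wmul (sW i) (sW j)) m.
Proof.
move=> m0 r e; split=> //; first by rewrite -Wpow_alt e WmulV.
move=> k /andP[k0 km] ek.
have {}ek : word (alt k i j) = word (alt k j i).
  move: ek; rewrite -Wpow_alt => /(congr1 (fun x => Wmul x (word (alt k j i)))).
  by rewrite WmulVK Wmul1v.
have rk : isred (alt k.+1 i j).
  apply: (@isred_cat _ (map (fun k => if odd k then j else i) (iota k.+1 (m - k.+1)))).
  by rewrite /alt -map_cat -{2}[k.+1]add0n -iotaD subnKC.
case: k k0 km ek rk => // k _ km ek.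
rewrite /isred size_alt altS Wword_cons -ek altS Wword_cons WmulA sWK Wmul1v => e2.
by have := length_word_le (Wone D) (alt k j i); rewrite Wmul1v e2 lengthW1 size_alt; lia.
Qed.

Section Matsumoto.
Variables (M : Type) (A : seq node -> M) (op : M -> M -> M).
Hypothesis A_cat : forall l l', A (l ++ l') = op (A l) (A l').
Hypothesis A_braid : forall i j m, is_order (Wmul (sW i) (sW j)) m ->
  A (alt m i j) = A (alt m j i).

(** Induction on the length: words sharing their first or last letter reduce to shorter ones.
    Exchanges lead either to such a pair or to two alternating words for the same element, whose
    length is then the order of [s_i s_j] by [alt_eq_order]. *)
Lemma matsumoto l l' : isred l -> isred l' -> word l = word l' -> A l = A l'.
Proof.
have [m hm] := ubnP (size l); elim: m => // m IHm in l l' hm *.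
have first i a b : (size a < m)%N -> isred (i :: a) -> isred (i :: b) ->
    word (i :: a) = word (i :: b) -> A (i :: a) = A (i :: b).
  move=> sa /isred_cons ra /isred_cons rb /= /Wmul_inj e.
  by rewrite -cat1s A_cat (IHm a b) // -A_cat.
have last i a b : (size a < m)%N -> isred (rcons a i) -> isred (rcons b i) ->
    word (rcons a i) = word (rcons b i) -> A (rcons a i) = A (rcons b i).
  move=> sa /isred_rcons[ra _] /isred_rcons[rb _]; rewrite !Wword_rcons => /Wmul_injr e.
  by rewrite -!cats1 !A_cat (IHm a b).
(* [c k i j] is the alternating word of length [k] in [i] and [j] whose last letter is [i]. *)
pose c k i j := alt k (if odd k then i else j) (if odd k then j else i).
have cS k i j : c k.+1 i j = rcons (c k j i) i.
  by rewrite /c /= alt_rcons; case: (odd k).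
have sc k i j : size (c k i j) = k by rewrite /c size_alt.
have cb k i j y a : (0 < k)%N -> c k i j = y :: a -> rcons a j = c k j i.
  case: k => // k _; rewrite /c altS alt_rcons => -[_ <-] /=.
  by case: (odd k).
(* Exchanging the last letter [j] into a word ending in an alternating block
   either keeps the first letter or lengthens the block. *)
have Q a k i j b : (0 < k)%N -> (size (a ++ c k i j) <= m)%N -> isred (a ++ c k i j) ->
    isred (rcons b j) -> word (a ++ c k i j) = word (rcons b j) ->
    A (a ++ c k i j) = A (rcons b j).
  elim: a => [|x a IHa] in k i j b *.
    rewrite cat0s sc => k0 km r rb e.
    have [l1 [y [l2 [el ew]]]] := exchange (not_apos_last e rb).
    have el2 : word (rcons (l1 ++ l2) j) = word (c k i j).
      by rewrite Wword_rcons ew -WmulA sWK Wmulv1.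
    have sl2 : size (rcons (l1 ++ l2) j) = size (c k i j).
      by rewrite size_rcons el !size_cat addnS.
    have r2 : isred (rcons (l1 ++ l2) j) by apply: isred_size sl2.
    have sl : (size (l1 ++ l2) < m)%N by move: sl2; rewrite size_rcons sc => ->.
    rewrite -(last j (l1 ++ l2) b) ?el2 //.
    case: l1 el ew el2 sl2 r2 sl => [|z l1] /= el ew el2 sl2 r2 sl; last first.
      rewrite el; apply: first; [| by rewrite -el | exact: r2 | by rewrite -el; exact: esym el2].
      by move: sl; rewrite !size_cat /= addnS.
    have ej : rcons l2 j = c k j i by apply: (cb _ _ _ y).
    rewrite ej in el2 *; move: r el2; rewrite /c.
    by case: (odd k) => r /esym er; apply: A_braid; exact: alt_eq_order.
  move=> k0 sm r rb e.
  have [l1 [y [l2 [el ew]]]] := exchange (not_apos_last e rb).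
  have el2 : word (rcons (l1 ++ l2) j) = word ((x :: a) ++ c k i j).
    by rewrite Wword_rcons ew -WmulA sWK Wmulv1.
  have sl2 : size (rcons (l1 ++ l2) j) = size ((x :: a) ++ c k i j).
    by rewrite size_rcons el !size_cat addnS.
  have r2 : isred (rcons (l1 ++ l2) j) by apply: isred_size sl2.
  have sl : (size (l1 ++ l2) < m)%N by move: sl2 sm; rewrite size_rcons => ->.
  rewrite -(last j (l1 ++ l2) b) ?el2 //.
  case: l1 el ew el2 sl2 r2 sl => [|z l1] /= el ew el2 sl2 r2 sl; last first.
    rewrite el; apply: first; [| by rewrite -el | exact: r2 | by rewrite -el; exact: esym el2].
    by move: sl; rewrite !size_cat /= addnS.
  case: el => _ el; rewrite -el rcons_cat -cS.
  have hb : exists b', x :: a ++ c k i j = rcons b' i.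
    by exists (x :: a ++ c k.-1 j i); rewrite -[X in c X i j](prednK k0) cS rcons_cons rcons_cat.
  have [b' eb] := hb; rewrite eb; apply/esym/IHa => //.
  - by move: sm; rewrite /= !size_cat !sc addnS.
  - by rewrite cS -rcons_cat el.
  - by rewrite -eb.
  - by rewrite cS -rcons_cat el -eb.
case: (lastP l) hm => [|a i] hm r r' e.
  by have := r'; rewrite /isred -e /= lengthW1; case: (l').
case: (lastP l') r' e => [|b j] r' e.
  by have := r; rewrite /isred e /= lengthW1 size_rcons.
rewrite -cats1; have -> : [:: i] = c 1%N i j by [].
apply: Q => //; rewrite ?cats1 //.
Qed.

End Matsumoto.

Lemma Omega_aact g h : L g = 0%N -> apos (aact g h) = apos h.
Proof. by move/lengthW0P. Qed.

(** The conjugate of [s_i] by [g] is the reflection in [hh = g alpha_i], and it changes the sign of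
    [hh] and its opposite only. It does not have length zero, so some simple [alpha_j] changes sign;
    as [hh] is positive, [hh = alpha_j]. *)
Lemma Omega_conj g i : L g = 0%N -> exists j, Wmul g (sW i) = Wmul (sW j) g.
Proof.
move=> g0; have gp := Omega_aact _ g0; set hh := aact g (asimple i).
have e : Wmul g (sW i) = Wmul (arefl hh) g by rewrite [in LHS]sWE arefl_conj.
have sp h : apos (aact (arefl hh) h) = apos h (+) ((h == hh) || (h == aopp hh)).
  have -> : arefl hh = Wmul (Wmul g (sW i)) (Winv g) by rewrite e WmulK.
  rewrite !aactM gp aflip !(can2_eq (aactVK g) (aactK g)) aact_opp -/hh.
  by rewrite -[apos (aact (Winv g) h)]gp aactVK.
have [j np] : exists j, ~~ apos (aact (arefl hh) (asimple j)).
  apply/not_existsP => hn; have /lengthW0P/(_ hh) : L (arefl hh) = 0%N.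
    by apply: lengthW0 => j; apply/negPn/negP => /hn.
  by rewrite sp eqxx addbT; case: apos.
exists j; rewrite e sWE; congr (Wmul (arefl _) _).
move: np; rewrite sp apos_simple negb_add; case/orP => /eqP // ej.
by have := apos_simple j; rewrite ej apos_opp gp apos_simple.
Qed.

Lemma OmegaV g : L g = 0%N -> L (Winv g) = 0%N.
Proof. by move=> g0; apply/lengthW0P => h; rewrite -(Omega_aact _ g0) aactVK. Qed.
Lemma OmegaM g g' : L g = 0%N -> L g' = 0%N -> L (Wmul g g') = 0%N.
Proof. by move=> g0 g0'; apply/lengthW0P => h; rewrite aactM !Omega_aact. Qed.

Lemma Omega_factor v : exists g l, [/\ L g = 0%N, Wmul g (word l) = v & L v = size l].
Proof.
have [m] := ubnP (L v); elim: m v => // m IH v hm.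
have [[i np]|hn] := pselect (exists i, ~~ apos (aact v (asimple i))); last first.
  have v0 : L v = 0%N by apply: lengthW0 => i; apply/negPn/negP => np; apply: hn; exists i.
  by exists v, [::]; rewrite Wmulv1 v0.
have v0 := @lengthW_gt0 Rr _ _ _ np.
have e := lengthW_step Rr v i; rewrite (negPf np) in e.
have [|g [l [g0 el sl]]] := IH (Wmul v (sW i)); first by move: hm; rewrite e; lia.
exists g, (rcons l i); split=> //; first by rewrite Wword_rcons WmulA el -WmulA sWK Wmulv1.
by rewrite size_rcons -sl e prednK.
Qed.

Lemma Omega_uniq g g' l l' : L g = 0%N -> L g' = 0%N ->
  Wmul g (word l) = Wmul g' (word l') -> g = g' /\ word l = word l'.
Proof.
move=> g0 g0' e.
have e' : Wmul (Winv g') g = word (l' ++ rev l).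
  by rewrite Wword_cat Wword_rev -(WmulKl g' (word l')) -e WmulA WmulK.
have /length_word0 : L (word (l' ++ rev l)) = 0%N by rewrite -e' OmegaM ?OmegaV.
rewrite -e' => /(congr1 (Wmul g')); rewrite WmulVKl Wmulv1 => eg; split=> //.
by move: e; rewrite eg => /Wmul_inj.
Qed.

Lemma length_Omega g v : L g = 0%N -> L (Wmul g v) = L v.
Proof.
move=> g0; have [g' [l [g0' <- _]]] := Omega_factor v.
elim/last_ind: l => [|l i IH]; first by rewrite !Wmulv1 g0' OmegaM.
by rewrite Wword_rcons !WmulA !lengthW_step -!WmulA IH WmulA !aactM (Omega_aact _ g0) -!aactM.
Qed.

End Words.

(** * Computing in a presented algebra *)

Section PresentedAlgebraTheory.
Variables (K : fieldType) (G : Type) (rel : expr K G -> expr K G -> Prop).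
Implicit Types x y : presAlg rel.

Lemma pclass_add e e' : pclass rel (EAdd e e') = pclass rel e + pclass rel e'.
Proof. exact/esym/pclassD. Qed.
Lemma pclass_mul e e' : pclass rel (EMul e e') = pclass rel e * pclass rel e'.
Proof. exact/esym/pclassM. Qed.
Lemma pclass_cst c : pclass rel (ECst c) = c *: (1 : presAlg rel).
Proof.
by rewrite [RHS](pclassZ _ c (ECst 1)); apply/pclassP; rewrite -{1}[c]mulr1; apply: pc_cstM.
Qed.
Lemma pclass_rel e e' : rel e e' -> pclass rel e = pclass rel e'.
Proof. by move=> h; apply/pclassP/pc_rel. Qed.

Lemma presAlg_scaleAr (a : K) x y : a *: (x * y) = x * (a *: y).
Proof.
have e (z : presAlg rel) : a *: z = z * (a *: (1 : presAlg rel)).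
  rewrite -pclass_cst -[z]pclassK -pclass_mul [LHS]pclassZ; exact/pclassP/pc_cstC.
by rewrite e -mulrA -e.
Qed.

Lemma rinvE (A : pzRingType) (x y : A) : y * x = 1 -> x * y = 1 -> rinv x = y.
Proof.
move=> h1 h2; rewrite /rinv; case: xgetP => [z _ [h3 h4]|/(_ y)[]//].
by rewrite -[z]mulr1 -h2 mulrA h3 mul1r.
Qed.

Lemma presAlg_ind (P : presAlg rel -> Prop) :
  (forall g, P (pgen rel g)) -> (forall c, P (c *: (1 : presAlg rel))) ->
  (forall x y, P x -> P y -> P (x + y)) -> (forall x y, P x -> P y -> P (x * y)) ->
  forall x, P x.
Proof.
move=> hg hc hD hM x; rewrite -[x]pclassK;
  elim: (generic_quotient.repr x) => [g|c|e IH e' IH'|e IH e' IH'].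
- exact: hg.
- by rewrite pclass_cst.
- by rewrite pclass_add; apply: hD.
- by rewrite pclass_mul; apply: hM.
Qed.

End PresentedAlgebraTheory.

(** * The defining relations of the double affine Hecke algebra *)

Section DahaTheory.
Variables (Rr : realType) (D : rootDatum).
Implicit Types (u v : W D) (l : hZ D) (b : affwt D).
Local Notation n := (Defs.rank D).
Local Notation node := 'I_n.+1.
Local Notation K := (parK Rr D).
Local Notation H := (daha Rr D).
Local Notation L := (lengthW Rr).
Implicit Types (i j : node) (x y : H).

Definition Yg l : H := pgen (@daha_rel Rr D) (GY Rr l).

Lemma Yg0 : Yg 0 = 1.
Proof. by rewrite /Yg /pgen (pclass_rel (dr_Y0 Rr D)). Qed.
Lemma YgD l l' : Yg (l + l') = Yg l * Yg l'.
Proof. by rewrite /Yg /pgen (pclass_rel (dr_YD Rr l l')) pclass_mul. Qed.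
Lemma YgC l l' : Yg l * Yg l' = Yg l' * Yg l.
Proof. by rewrite -!YgD addrC. Qed.
Lemma YgN l : Yg l * Yg (- l) = 1.
Proof. by rewrite -YgD subrr Yg0. Qed.

Lemma mpolyX_neq0 (p : nat) (R : nzRingType) (m : 'X_{1..p}) : 'X_[m] != 0 :> {mpoly R[p]}.
Proof.
apply/eqP => /(congr1 (mcoeff m)); rewrite mcoeffX eqxx mcoeff0 => /eqP.
by rewrite oner_eq0.
Qed.

Lemma qe_neq0 : qe Rr D != 0.
Proof. by rewrite /qe tofrac_eq0 mpolyX_neq0. Qed.
Lemma th_neq0 a : th Rr a != 0 :> parK Rr D.
Proof. by rewrite /th tofrac_eq0 mpolyX_neq0. Qed.
Lemma thn_neq0 i : thn Rr i != 0 :> K.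
Proof. exact: th_neq0. Qed.

(** Affine weights [l + k d] with [k] in [(1/e) Z], the only ones for which
    [qpow] is exact. *)
Definition dint b : bool := (denom D)%:R * b.2 \is a Num.int.

Lemma affMz b k : b *~ k = (b.1 *~ k : hZ D, b.2 *~ k).
Proof.
rewrite [LHS]surjective_pairing; congr (_, _).
  exact: (raddfMz (fst : (hZ D * rat)%type -> hZ D)).
exact: (raddfMz (snd : (hZ D * rat)%type -> rat)).
Qed.

Lemma dintD b b' : dint b -> dint b' -> dint (b + b').
Proof. by rewrite /dint /= mulrDr; apply: rpredD. Qed.
Lemma dintN b : dint b -> dint (- b).
Proof. by rewrite /dint /= mulrN rpredN. Qed.
Lemma dint_hZ l : dint (l, 0).
Proof. by rewrite /dint /= mulr0. Qed.
Lemma dint_Waff v b : dint b -> dint (Waff v b).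
Proof. by rewrite /dint /= mulrBr => h; rewrite rpredB // lpair_denom. Qed.
Lemma dint_affcoroot (h : rootI D * int) : dint (affcoroot h).
Proof. by rewrite /dint /= rpredM ?intr_int ?natr_int. Qed.

(** [qpow] passes through a floor, which is additive as soon as one of the two exponents is
    exact. *)
Lemma qpowD (p q : rat) : (denom D)%:R * p \is a Num.int ->
  qpow Rr D (p + q) = qpow Rr D p * qpow Rr D q.
Proof. by move=> hp; rewrite /qpow mulrDr floorDzr // expfzDr ?qe_neq0. Qed.
Lemma qpow0 : qpow Rr D 0 = 1.
Proof. by rewrite /qpow mulr0 floor0. Qed.
Lemma YeltE b : Yelt Rr b = qpow Rr D (- b.2) *: Yg b.1.
Proof. by []. Qed.
Lemma YeltD b b' : dint b -> Yelt Rr (b + b') = Yelt Rr b * Yelt Rr b'.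
Proof.
move=> hb; rewrite !YeltE /= YgD opprD qpowD -?[_ * - _]/(_ * - _); last first.
  by have := dintN hb; rewrite /dint /=.
by rewrite -presAlg_scaleAl -presAlg_scaleAr scalerA.
Qed.
Lemma Yelt_hZ l : Yelt Rr (l, 0) = Yg l.
Proof. by rewrite YeltE /= oppr0 qpow0 scale1r. Qed.
Lemma YeltC b b' : Yelt Rr b * Yelt Rr b' = Yelt Rr b' * Yelt Rr b.
Proof.
by rewrite !YeltE -!presAlg_scaleAl -!presAlg_scaleAr YgC !scalerA mulrC.
Qed.

Lemma Tv_quad i : Tv Rr i * Tv Rr i = (thn Rr i - (thn Rr i)^-1) *: Tv Rr i + 1.
Proof.
rewrite /Tv /pgen -pclass_mul (pclass_rel (dr_quad Rr i)) pclass_add pclass_mul.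
by rewrite !pclass_cst scale1r -presAlg_scaleAl mul1r.
Qed.

Definition Tinv i : H := Tv Rr i - (thn Rr i - (thn Rr i)^-1) *: (1 : H).

Lemma TvV i : Tv Rr i * Tinv i = 1.
Proof. by rewrite /Tinv mulrBr Tv_quad -presAlg_scaleAr mulr1 addrC addKr. Qed.
Lemma TvVl i : Tinv i * Tv Rr i = 1.
Proof. by rewrite /Tinv mulrBl Tv_quad -presAlg_scaleAl mul1r addrC addKr. Qed.
Lemma rinv_Tv i : rinv (Tv Rr i) = Tinv i.
Proof. exact: rinvE (TvVl i) (TvV i). Qed.

Lemma Ov1 (g : Omegav Rr D) : val g = Wone D -> Ov g = 1.
Proof. by move=> h; rewrite /Ov /pgen (pclass_rel (dr_O1 h)). Qed.
Lemma OvM (g h k : Omegav Rr D) : val k = Wmul (val g) (val h) -> Ov k = Ov g * Ov h.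
Proof. by move=> e; rewrite /Ov /pgen (pclass_rel (dr_OM e)) pclass_mul. Qed.

Lemma Tv_braid i j m : is_order (Wmul (sW i) (sW j)) m ->
  \prod_(k <- alt m i j) Tv Rr k = \prod_(k <- alt m j i) Tv Rr k.
Proof.
have e i' j' : \prod_(k <- alt m i' j') Tv Rr k = pclass (@daha_rel Rr D) (ealt Rr i' j' m).
  rewrite /alt /ealt; elim: (iota 0 m) => [|k s IH] /=; first by rewrite big_nil.
  by rewrite big_cons IH pclass_mul.
by move=> h; rewrite !e (pclass_rel (dr_braid Rr h)).
Qed.

Lemma Ov_Y (g : Omegav Rr D) l : Ov g * Yg l = Yelt Rr (Waff (val g) (l, 0)) * Ov g.
Proof.
rewrite /Ov /Yg /pgen -pclass_mul (pclass_rel (dr_OY g l)) !pclass_mul pclass_cst.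
by rewrite -presAlg_scaleAl mul1r.
Qed.

Lemma Ov_T (g g' : Omegav Rr D) i j : Wmul (val g) (val g') = Wone D ->
  Wmul (Wmul (val g) (sW i)) (val g') = sW j -> Ov g * Tv Rr i * Ov g' = Tv Rr j.
Proof.
by move=> h1 h2; rewrite -[RHS](pclass_rel (dr_OT h1 h2)) !pclass_mul.
Qed.

Lemma Waff_sW i l : Waff (sW i) (l, 0) = (l, 0) - acoroot i *~ aroot_pair l i.
Proof.
rewrite affMz /Waff /sW /acoroot /aroot_pair; case: unliftP => [j|] _ /=.
  by rewrite lpair0r wactv_refl; congr (_, _); rewrite /= mul0rz subrr.
rewrite wactv_refl; congr (_, _).
  by rewrite /= mulrNz mulNrz !opprK.
rewrite -[zlatpair _ _ _]/(zpair l (root (theta D))) /=.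
rewrite lpairDl lpairNl lpairMzl -!zpair_corootE zpair_diag -zpair_rootE -mulrzA.
rewrite !sub0r -rmorphB /=; set z := zpair _ _.
by have -> : - z = z - 2 * z by lia.
Qed.

(** The divided difference [G] is known from here on only by these properties. The product with the
    denominator, a telescoping geometric sum, yields the intertwining property of [tau_i];
    commutation with [Y] controls the characters in [killed_T]; the case of pairing one propagates
    eigenvalues on the generator. *)
Lemma Tv_Y i l : exists G : H,
  [/\ Tv Rr i * Yg l = Yelt Rr (Waff (sW i) (l, 0)) * Tv Rr i + (thn Rr i - (thn Rr i)^-1) *: G,
      (1 - Yelt Rr (- acoroot i)) * G = Yg l - Yelt Rr (Waff (sW i) (l, 0)),
      forall l', G * Yg l' = Yg l' * G & aroot_pair l i = 1 -> G = Yg l].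
Proof.
have di : dint (acoroot i) by rewrite acorootE dint_affcoroot.
have eYE b : pclass (@daha_rel Rr D) (eY Rr b) = Yelt Rr b.
  by rewrite /eY pclass_mul pclass_cst -presAlg_scaleAl mul1r.
have esumE s : pclass (@daha_rel Rr D) (esum s) = \sum_(e <- s) pclass _ e.
  elim: s => [|e s IH] /=; first by rewrite big_nil pclass_cst scale0r.
  by rewrite big_cons pclass_add IH.
exists (pclass _ (ediff Rr i l)); split.
- rewrite /Tv /Yg /pgen -pclass_mul (pclass_rel (dr_TY Rr i l)) pclass_add !pclass_mul.
  by rewrite !pclass_cst -!presAlg_scaleAl !mul1r.
- have sumP (p : nat) : (1 - Yelt Rr (- acoroot i)) *
      (\sum_(k <- iota 0 p) Yelt Rr ((l, 0) - acoroot i *+ k)) =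
      Yg l - Yelt Rr ((l, 0) - acoroot i *+ p).
    elim: p => [|p IH]; first by rewrite big_nil mulr0 mulr0n subr0 Yelt_hZ subrr.
    rewrite -[p.+1]/(1 + p)%N addnC iotaD big_cat mulrDr IH big_seq1 add0n addn1.
    rewrite mulrBl mul1r -YeltD ?dintN // addrA subrK; congr (_ - Yelt Rr _).
    by rewrite mulrS opprD addrCA.
  have sumN (p : nat) : (1 - Yelt Rr (- acoroot i)) *
      (\sum_(k <- iota 1 p) Yelt Rr ((l, 0) + acoroot i *+ k)) =
      Yelt Rr ((l, 0) + acoroot i *+ p) - Yg l.
    elim: p => [|p IH]; first by rewrite big_nil mulr0 mulr0n addr0 Yelt_hZ subrr.
    rewrite -[p.+1]/(1 + p)%N addnC iotaD big_cat mulrDr IH big_seq1 add1n addn1.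
    rewrite mulrBl mul1r -YeltD ?dintN // [LHS]addrC addrA; congr (_ - _).
    by rewrite mulrS [- _ + _]addrCA addKr subrK.
  rewrite Waff_sW /ediff; case: (aroot_pair l i) => p; rewrite ?pclass_mul esumE big_map.
    by under eq_bigr do rewrite eYE; rewrite sumP.
  rewrite pclass_cst scaleN1r mulN1r mulrN; under eq_bigr do rewrite eYE.
  by rewrite sumN opprB NegzE mulrNz opprK.
- have cY b l' : Yelt Rr b * Yg l' = Yg l' * Yelt Rr b by rewrite -Yelt_hZ YeltC.
  have cS (r : seq nat) (F : nat -> affwt D) l' :
      (\sum_(k <- r) Yelt Rr (F k)) * Yg l' = Yg l' * (\sum_(k <- r) Yelt Rr (F k)).
    by rewrite mulr_suml mulr_sumr; apply: eq_bigr => k _; rewrite cY.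
  move=> l'; rewrite /ediff; case: (aroot_pair l i) => p; rewrite ?pclass_mul esumE big_map.
    by under eq_bigr do rewrite eYE; rewrite cS.
  rewrite pclass_cst scaleN1r mulN1r mulrN mulNr; under eq_bigr do rewrite eYE.
  by rewrite cS.
- move=> e; rewrite /ediff e /= pclass_add eYE mulr0n subr0 Yelt_hZ.
  by rewrite pclass_cst scale0r addr0.
Qed.

End DahaTheory.

(** * The elements [T_v], [X^v] and [t_w^(1/2)] *)

Section TWords.
Variables (Rr : realType) (D : rootDatum).
Implicit Types (u v : W D) (h : rootI D * int) (g : Omegav Rr D) (w : W0 D).
Local Notation n := (Defs.rank D).
Local Notation node := 'I_n.+1.
Local Notation K := (parK Rr D).
Local Notation H := (daha Rr D).
Local Notation L := (lengthW Rr).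
Local Notation word := (@Wword D).
Implicit Types (i j : node) (l : seq node) (x y : H).

Definition Tprod l : H := \prod_(k <- l) Tv Rr k.

Lemma Tprod_cat l l' : Tprod (l ++ l') = Tprod l * Tprod l'.
Proof. exact: big_cat. Qed.
Lemma Tprod_rcons l i : Tprod (rcons l i) = Tprod l * Tv Rr i.
Proof. by rewrite -cats1 Tprod_cat /Tprod big_seq1. Qed.

Lemma Tprod_red l l' : isred Rr l -> isred Rr l' -> word l = word l' -> Tprod l = Tprod l'.
Proof. apply: matsumoto => [? ?|i j m]; [exact: Tprod_cat | exact: Tv_braid]. Qed.

Lemma Omegav0 g : L (val g) = 0%N.
Proof. exact/eqP/(valP g). Qed.

Definition mkOmega v (v0 : L v = 0%N) : Omegav Rr D :=
  exist _ v (introT eqP v0).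

Lemma reducedE g l : reduced g l <-> isred Rr l.
Proof. by rewrite /reduced /isred length_Omega // Omegav0. Qed.

Lemma Omegav_factor v : exists g l, isred Rr l /\ Wmul (val g) (word l) = v.
Proof.
have [g [l [g0 <- e]]] := Omega_factor Rr v.
exists (mkOmega g0), l; split; last exact: erefl.
by rewrite /isred -[LHS](length_Omega (word l) g0).
Qed.

Lemma Omegav_uniq g g' l l' :
  Wmul (val g) (word l) = Wmul (val g') (word l') -> g = g' /\ word l = word l'.
Proof. by case/(Omega_uniq (Omegav0 g) (Omegav0 g')) => /val_inj -> ->. Qed.

Lemma Ov_inv g : exists g' : Omegav Rr D,
  [/\ val g' = Winv (val g), Ov g' * Ov g = 1 & Ov g * Ov g' = 1].
Proof.
pose g' := mkOmega (OmegaV (Omegav0 g)); exists g'; split=> //.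
  by rewrite -(@OvM _ _ g' g (mkOmega (lengthW1 Rr D))) ?Ov1 //= WmulVv.
by rewrite -(@OvM _ _ g g' (mkOmega (lengthW1 Rr D))) ?Ov1 //= WmulV.
Qed.

Definition TW v : H := xget 0 [set x | exists g l,
  [/\ isred Rr l, Wmul (val g) (word l) = v & x = Ov g * Tprod l]]%classic.

Lemma TWE g l : isred Rr l -> TW (Wmul (val g) (word l)) = Ov g * Tprod l.
Proof.
move=> r; rewrite /TW; case: xgetP => [x _ [g' [l' [r' /Omegav_uniq[<- e] ->]]]|].
  by congr (_ * _); apply: Tprod_red.
by move/(_ (Ov g * Tprod l)); case; exists g, l.
Qed.

Lemma TW_up v i : apos (aact v (asimple i)) -> TW (Wmul v (sW i)) = TW v * Tv Rr i.
Proof.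
have [g [l [r <-]]] := Omegav_factor v.
rewrite aactM (Omega_aact _ (Omegav0 g)) => p; rewrite -WmulA -Wword_rcons !TWE //.
  by rewrite Tprod_rcons mulrA.
by rewrite /isred Wword_rcons lengthW_step p size_rcons r.
Qed.

Lemma TW_down v i : ~~ apos (aact v (asimple i)) -> TW (Wmul v (sW i)) = TW v * Tinv Rr i.
Proof.
move=> p; have := @TW_up (Wmul v (sW i)) i.
rewrite aactM sW_simple aact_opp apos_opp p => /(_ isT).
rewrite -WmulA sWK Wmulv1 => ->.
by rewrite -mulrA TvV mulr1.
Qed.

Lemma Tprod_Ov l g : exists l', [/\ size l' = size l, Wmul (word l) (val g) = Wmul (val g) (word l')
   & Tprod l * Ov g = Ov g * Tprod l'].
Proof.
have [g' [eg' h1 h2]] := Ov_inv g.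
elim: l => [|i l [l' [sl el tl]]].
  by exists [::]; rewrite Wmul1v Wmulv1 /Tprod !big_nil mul1r mulr1.
have [j ej] := Omega_conj i (OmegaV (Omegav0 g)).
have ej' : Wmul (sW i) (val g) = Wmul (val g) (sW j).
  by rewrite -[sW i](WmulVKl (val g)) ej -WmulA WmulVK.
exists (j :: l'); split; first by rewrite /= sl.
  by rewrite /= -WmulA el !WmulA ej'.
have T : Ov g' * Tv Rr i * Ov g = Tv Rr j.
  by apply: Ov_T; rewrite eg' ?WmulVv // ej WmulVK.
by rewrite /Tprod !big_cons -/(Tprod l) -/(Tprod l') -mulrA tl -T !mulrA h2 mul1r.
Qed.

(** Moving [g] to the left of [T_l] relabels the letters. The new word is again reduced, because [g]
    sends the simple affine coroot of each new letter to that of the old one. *)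
Lemma TW_Omega v g : TW (Wmul v (val g)) = TW v * Ov g.
Proof.
have [g' [l [r <-]]] := Omegav_factor v.
have [l' [sl el tl]] := Tprod_Ov l g.
have r' : isred Rr l'.
  rewrite /isred sl -r -[LHS](length_Omega _ (Omegav0 g)) -el.
  elim/last_ind: {r sl el tl} l => [|l i IH]; first by rewrite Wmul1v Omegav0 lengthW1.
  have [j ej] := Omega_conj i (OmegaV (Omegav0 g)).
  have ej' : Wmul (sW i) (val g) = Wmul (val g) (sW j).
    by rewrite -[sW i](WmulVKl (val g)) ej -WmulA WmulVK.
  rewrite Wword_rcons -WmulA ej' WmulA !lengthW_step IH aactM.
  suff -> : aact (val g) (asimple j) = asimple i by [].
  have e1 : arefl (aact (val g) (asimple j)) = sW i :> W D.
    by apply: (@Wmul_injr _ (val g)); rewrite -arefl_conj -sWE ej'.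
  have := aflip i (aact (val g) (asimple j)); rewrite -e1 arefl_self apos_opp.
  rewrite (Omega_aact _ (Omegav0 g)) apos_simple /=; case: eqP => //= _.
  case: eqP => // e2; have := apos_simple j.
  by rewrite -(Omega_aact _ (Omegav0 g)) e2 apos_opp apos_simple.
pose g2 := mkOmega (OmegaM (Omegav0 g') (Omegav0 g)).
rewrite -WmulA el WmulA -[Wmul (val g') (val g)]/(val g2) !TWE //.
by rewrite (@OvM _ _ g' g g2) // -mulrA -tl mulrA.
Qed.

Lemma Tprod_unit l : exists y, y * Tprod l = 1 /\ Tprod l * y = 1.
Proof.
elim: l => [|i l [y [h1 h2]]]; first by exists 1; rewrite /Tprod big_nil mulr1.
exists (y * Tinv Rr i); rewrite /Tprod big_cons -/(Tprod l); split.
  by rewrite mulrA -[y * _ * _]mulrA TvVl mulr1.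
by rewrite mulrA -[_ * _ * y]mulrA h2 mulr1 TvV.
Qed.

Lemma TW_unit v : exists y, y * TW v = 1 /\ TW v * y = 1.
Proof.
have [g [l [r <-]]] := Omegav_factor v.
have [y [h1 h2]] := Tprod_unit l; have [g' [_ h3 h4]] := Ov_inv g.
exists (y * Ov g'); rewrite TWE //; split.
  by rewrite mulrA -[y * _ * _]mulrA h3 mulr1.
by rewrite mulrA -[_ * _ * y]mulrA h2 mulr1 h4.
Qed.

(** Translation by [-2 N rho]. It adds [N] times [ht] to the level of an affine coroot, so for large
    [N] the sign becomes that of the finite root. *)
Definition antidom (N : nat) : W D := (- (rho2 D *+ N), 1%g).

(** [x] is the element [X^v].  Far in the antidominant direction
    the periodic orientation agrees with the length, so that
    [X^v = T_(lambda)^-1 T_(lambda v)] for deep antidominant [lambda]. *)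
Definition isX v x : Prop :=
  exists N0, forall N, (N0 <= N)%N -> TW (Wmul (antidom N) v) = TW (antidom N) * x.

(** This says that [v A] lies on the positive side of the wall between [v A] and [v s_i A]. The step
    to [v s_i] is then a negative crossing and contributes [T_i]. *)
Definition up v i : bool := posroot (aact v (asimple i)).1.

Lemma isX_uniq v x y : isX v x -> isX v y -> x = y.
Proof.
move=> [N1 h1] [N2 h2]; have := h1 _ (leq_maxl N1 N2); rewrite h2 ?leq_maxr //.
have [z [hz _]] := TW_unit (antidom (maxn N1 N2)).
by move/(congr1 (fun x => z * x)); rewrite !mulrA hz !mul1r.
Qed.

Lemma isX1 : isX (Wone D) 1.
Proof. by exists 0%N => N _; rewrite Wmulv1 mulr1. Qed.

Lemma isX_Omega v x g : isX v x -> isX (Wmul v (val g)) (x * Ov g).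
Proof. by case=> N0 h; exists N0 => N /h e; rewrite WmulA TW_Omega e mulrA. Qed.

Lemma aact_antidom N h : aact (antidom N) h = (h.1, h.2 + N%:Z * ht h.1).
Proof.
rewrite /aact /= ract1 zpair_corootN -[_ *+ N]/(_ *~ N%:Z) zpair_corootMz opprK.
by rewrite mulrC.
Qed.

Lemma isX_step v x i : isX v x ->
  isX (Wmul v (sW i)) (x * if up v i then Tv Rr i else Tinv Rr i).
Proof.
case=> N0 hN; have [h eh] : exists h, aact v (asimple i) = h by eexists.
(* Since [ht] is a nonzero integer, any [N] larger than the absolute level [|h.2|] makes [N] times
   [ht] decide the sign. *)
exists (maxn N0 (absz h.2).+1) => N; rewrite geq_max => /andP[/hN e hj].
rewrite WmulA /up eh; have ha : aact (Wmul (antidom N) v) (asimple i) = (h.1, h.2 + N%:Z * ht h.1).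
  by rewrite aactM aact_antidom eh.
have := ht_neq0 h.1; case: ifP; rewrite posrootE => hp h0.
  rewrite TW_up ?e ?mulrA // ha /apos /= posrootE hp.
  have : N%:Z <= N%:Z * ht h.1 by rewrite ler_peMr //; lia.
  by move: hj; lia.
rewrite TW_down ?e ?mulrA // ha /apos /= posrootE hp.
have : N%:Z <= N%:Z * - ht h.1 by rewrite ler_peMr //; lia.
by rewrite mulrN; move: hj; lia.
Qed.

Lemma separates_step h z i :
  separates h (@alcove Rr D z) (@alcove Rr D (Wmul z (sW i))) <->
  h = if up z i then aact z (asimple i) else aopp (aact z (asimple i)).
Proof.
rewrite separatesE WinvM Winv_sW aactM aflip !(can2_eq (aactVK z) (aactK z)) aact_opp /up.
move: (aact z (asimple i)) => k; split=> [[p]|->].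
  case: (h =P k) => [<-|_ /=]; first by rewrite p.
  case: (h =P aopp _) => [e _|_]; last by rewrite addbF eqxx.
  by move: p; rewrite e /= posroot_opp => /negPf ->.
case: ifP => p; rewrite ?posroot_opp ?p eqxx ?orbT addbT; split=> //.
  by case: (apos _).
by case: (apos _).
Qed.

Lemma on_pos_sideE z i v : on_pos_side Rr z i v =
  apos (aact (Winv v) (if up z i then aact z (asimple i) else aopp (aact z (asimple i)))).
Proof.
apply/asboolP/idP => [[h [/separates_step -> /alcove_pos]] //|p].
exists (if up z i then aact z (asimple i) else aopp (aact z (asimple i))).
by split; [apply/separates_step | apply/alcove_pos].
Qed.
Lemma on_neg_sideE z i v : on_neg_side Rr z i v =
  ~~ apos (aact (Winv v) (if up z i then aact z (asimple i) else aopp (aact z (asimple i)))).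
Proof.
apply/asboolP/idP => [[h [/separates_step -> /alcove_neg]] //|p].
exists (if up z i then aact z (asimple i) else aopp (aact z (asimple i))).
by split; [apply/separates_step | apply/alcove_neg].
Qed.

Lemma on_pos_side_self z i : on_pos_side Rr z i z = up z i.
Proof. by rewrite on_pos_sideE; case: up; rewrite ?aact_opp aactK ?apos_opp apos_simple. Qed.
Lemma on_neg_side_self z i : on_neg_side Rr z i z = ~~ up z i.
Proof. by rewrite on_neg_sideE; case: up; rewrite ?aact_opp aactK ?apos_opp apos_simple. Qed.
Lemma on_pos_side_step z i : on_pos_side Rr z i (Wmul z (sW i)) = ~~ up z i.
Proof.
rewrite on_pos_sideE WinvM Winv_sW; case: up; rewrite ?aact_opp aactM aactK sW_simple.
  by rewrite apos_opp apos_simple.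
by rewrite aoppK apos_simple.
Qed.

Lemma isX_Xword z l x : isX z x -> isX (Wmul z (word l)) (x * Xword Rr z l).
Proof.
elim: l z x => [|i l IH] z x hx /=; first by rewrite Wmulv1 mulr1.
rewrite on_pos_side_step rinv_Tv WmulA mulrA; apply: IH.
by have := isX_step i hx; case: up.
Qed.

Lemma isX_Xelt v : isX v (Xelt Rr v).
Proof.
have hX g l : isX (Wmul (val g) (word l)) (Ov g * Xword Rr (val g) l).
  by apply: isX_Xword; have := isX_Omega g isX1; rewrite Wmul1v mul1r.
rewrite /Xelt; case: xgetP => [x _ [g [l [_ <- ->]]]|]; first exact: hX.
have [g [l [r e]]] := Omegav_factor v.
by move/(_ (Ov g * Xword Rr (val g) l)); case; exists g, l; split=> //; apply/reducedE.
Qed.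

Definition W0lift (l : seq 'I_n) : seq node := map (lift ord0) l.

Lemma Wword_W0lift (l : seq 'I_n) : word (W0lift l) = (0, W0word l).
Proof.
elim: l => [|i l IH] //=; rewrite IH /sW liftK /Wmul /=.
by rewrite mulmx0 addr0.
Qed.

Lemma W0word_rcons (l : seq 'I_n) (k : 'I_n) :
  W0word (rcons l k) = (W0word l * refl (simple k : rootI D))%g.
Proof. by elim: l => [|j l IH] /=; rewrite ?mulg1 ?mul1g // IH mulgA. Qed.

Lemma aact_W0_simple m w (k : 'I_n) : (aact (m, w) (asimple (lift ord0 k))).1 = ract w (simple k).
Proof. by rewrite /asimple liftK. Qed.

Lemma apos_W0 w (k : 'I_n) :
  apos (aact (0, w) (asimple (lift ord0 k))) = posroot (ract w (simple k)).
Proof. by rewrite /asimple liftK /apos /aact /= zpair_coroot0 subr0; case: ifP. Qed.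

Lemma W0reduced_isred w (l : seq 'I_n) : W0reduced Rr w l -> isred Rr (W0lift l).
Proof. by case=> e s; rewrite /isred Wword_W0lift e s size_map. Qed.

Lemma W0_length0 w : L ((0, w) : W D) = 0%N -> w = 1%g.
Proof.
have [l ->] : exists l : seq 'I_n, w = W0word l.
  elim/W0_simple_ind: w => [|i w [l ->]]; first by exists [::].
  by exists (i :: l).
by rewrite -Wword_W0lift => /length_word0; rewrite Wword_W0lift => -[].
Qed.

Lemma W0reduced_ex w : exists l : seq 'I_n, W0reduced Rr w l.
Proof.
have [m] := ubnP (L ((0, w) : W D)); elim: m w => // m IH w hm.
have [/W0_length0->|w0] := eqVneq (L ((0, w) : W D)) 0%N.
  by exists [::]; split=> //; exact: lengthW1.
have [i np] : exists i, ~~ apos (aact (0, w) (asimple i)).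
  apply/not_existsP => hn; case/eqP: w0; apply: lengthW0 => i; apply/negPn/negP; exact: hn.
have := lengthW_step Rr (0, w) i; rewrite (negPf np).
case: (unliftP ord0 i) np => [k|] ->; last first.
  by rewrite /asimple unlift_none /apos /aact /= zpair_coroot0 subr0; case: ifP.
rewrite {1}/Wmul /sW liftK /= mulmx0 addr0 => np e.
have [|l [el sl]] := IH (w * refl (simple k))%g; first by rewrite e -ltnS prednK ?lt0n.
exists (rcons l k); split.
  by rewrite W0word_rcons el -mulgA reflK mulg1.
by rewrite size_rcons -sl e prednK // lt0n.
Qed.

Lemma isX_W0word m (l : seq 'I_n) x : isred Rr (W0lift l) -> isX (m, 1%g) x ->
  isX (m, W0word l) (x * Tprod (W0lift l)).
Proof.
move=> r hx; have e (u : W0 D) : ((m, u) : W D) = Wmul (m, 1%g) (0, u).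
  by rewrite /Wmul /= mulmx0 addr0 mul1g.
elim/last_ind: l r => [|l k IH]; first by rewrite /Tprod big_nil mulr1.
rewrite {1}/W0lift map_rcons => /isred_rcons[/IH hl].
rewrite -/(W0lift l) Wword_W0lift apos_W0 => p.
have := isX_step (lift ord0 k) hl; rewrite /up aact_W0_simple p.
rewrite -mulrA -Tprod_rcons -[rcons _ _]map_rcons; congr (isX _ _).
rewrite e [RHS]e -WmulA; congr Wmul.
by rewrite -!Wword_W0lift -Wword_rcons /W0lift map_rcons.
Qed.

Lemma Tw_ex w : exists l : seq 'I_n, W0reduced Rr w l /\ Tw Rr w = Tprod (W0lift l).
Proof.
rewrite /Tw; case: xgetP => [x _ [l r ->]|]; first by exists l; rewrite /Tprod /W0lift big_map.
have [l r] := W0reduced_ex w.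
by move/(_ (\prod_(i <- l) Tv Rr (lift ord0 i))); case; exists l.
Qed.

Lemma isX_Tw m w x : isX (m, 1%g) x -> isX (m, w) (x * Tw Rr w).
Proof.
have [l [r ->]] := Tw_ex w => /(isX_W0word (W0reduced_isred r)).
by case: r => ->.
Qed.

Lemma Xelt_split m w x : isX (m, w) x -> x = Xelt Rr (m, 1%g) * Tw Rr w.
Proof. by move/isX_uniq; apply; apply/isX_Tw/isX_Xelt. Qed.

Lemma orbit_index_ract w a : orbit_index (ract w a) = orbit_index a.
Proof.
apply: enum_val_inj; rewrite !enum_rankK_in ?orbit_of_in //.
apply/setP => b; rewrite !inE /same_orbit; apply/existsP/existsP => -[u /eqP hu].
  by exists (u * w)%g; rewrite wactM -mulmxA -root_ract hu.
by exists (u * w^-1)%g; rewrite root_ract wactM -mulmxA [wact w^-1%g *m _]wactK hu.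
Qed.

Lemma th_ract w a : th Rr (ract w a) = th Rr a :> K.
Proof. by rewrite /th orbit_index_ract. Qed.

(** The product over the inversions of [w]: a form of [t_w^(1/2)] in which no reduced word
    occurs. *)
Definition thN w : K := \prod_(a | posroot a && ~~ posroot (ract w a)) th Rr a.

Lemma th_word (l : seq 'I_n) : isred Rr (W0lift l) ->
  \prod_(k <- l) th Rr (simple k) = thN (W0word l).
Proof.
elim/last_ind: l => [|l k IH].
  by move=> _; rewrite big_nil /thN big1 // => a /andP[p]; rewrite ract1 p.
rewrite {1}/W0lift map_rcons => /isred_rcons[/IH hl].
rewrite -/(W0lift l) Wword_W0lift apos_W0 -cats1 big_cat big_seq1 hl => p.
rewrite cats1 W0word_rcons.
(* Appending [s_k] creates the inversion [alpha_k], and [s_k] matches the other inversions with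
   those of the shorter word. *)
rewrite /thN [RHS](bigD1 (simple k)) /=; last first.
  by rewrite posroot_simple ractM -/(ropp _) ract_ropp posroot_opp p.
rewrite mulrC; congr (_ * _).
rewrite (reindex_inj (ract_inj (w := refl (simple k)))); apply: eq_big => [a|a _].
  rewrite ractM srefl_pos; have [->|n1] /= := eqVneq a (simple k).
    by rewrite posroot_simple andbF.
  have [->|n2] /= := eqVneq a (ropp (simple k)).
    by rewrite posroot_opp posroot_simple /= ract_ropp -/(ropp (simple k)) roppK p.
  by rewrite addbF andbT.
by rewrite th_ract.
Qed.

Lemma thwE w : thw Rr w = thN w.
Proof.
rewrite /thw; case: xgetP => [x _ [l r ->]|].
  by case: (r) => e _; rewrite (th_word (W0reduced_isred r)) e.
have [l r] := W0reduced_ex w.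
by move/(_ (\prod_(i <- l) th Rr (simple i))); case; exists l.
Qed.

End TWords.

(** * The eigenvalues of [Y] on the generator of the polynomial representation *)

Section PolRep.
Variables (Rr : realType) (D : rootDatum).
Implicit Types (u v : W D) (l : hZ D) (a b c : rootI D) (w : W0 D).
Local Notation n := (Defs.rank D).
Local Notation node := 'I_n.+1.
Local Notation K := (parK Rr D).
Local Notation H := (daha Rr D).
Local Notation V := (polrep Rr D).
Local Notation vac := (vac Rr D).
Implicit Types (i j : node) (x y : H) (m : V).

Lemma actE x y : act x (cclass _ y) = cclass _ (x * y) :> V.
Proof. exact: cactE. Qed.
Lemma actM x y m : act (x * y) m = act x (act y m).
Proof. by have [z ->] := cclass_ex m; rewrite !actE mulrA. Qed.
Lemma act1 m : act 1 m = m.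
Proof. by have [z ->] := cclass_ex m; rewrite actE mul1r. Qed.
Lemma actDl x y m : act (x + y) m = act x m + act y m.
Proof. by have [z ->] := cclass_ex m; rewrite !actE mulrDl cclassD. Qed.
Lemma polrep_scaleE (k : K) m : k *: m = act (k *: (1 : H)) m.
Proof. by []. Qed.
Lemma actZl (k : K) x m : act (k *: x) m = k *: act x m.
Proof. by rewrite polrep_scaleE -actM -presAlg_scaleAl mul1r. Qed.

Lemma actZr x (k : K) m : act x (k *: m) = k *: act x m.
Proof. by rewrite !polrep_scaleE -!actM -presAlg_scaleAl mul1r -presAlg_scaleAr mulr1. Qed.
Lemma actDr x m m' : act x (m + m') = act x m + act x m'.
Proof.
have [z ->] := cclass_ex m'; have [z' ->] := cclass_ex m.
by rewrite -cclassD !actE mulrDr cclassD.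
Qed.
Lemma act0r x : act x (0 : V) = 0.
Proof. by rewrite -[in LHS](scale0r (0 : V)) actZr; exact: scale0r. Qed.
Lemma actNr x m : act x (- m) = - act x m.
Proof. by rewrite -scaleN1r actZr scaleN1r. Qed.
Lemma actBr x m m' : act x (m - m') = act x m - act x m'.
Proof. by rewrite actDr actNr. Qed.
Lemma actNl x m : act (- x) m = - act x m.
Proof. by rewrite -scaleN1r actZl scaleN1r. Qed.
Lemma actBl x y m : act (x - y) m = act x m - act y m.
Proof. by rewrite actDl actNl. Qed.

Lemma polrep_ind m : exists x, m = act x vac.
Proof. by have [x ->] := cclass_ex m; exists x; rewrite actE mulr1. Qed.

Lemma act_sub_char x k : sub_char x k -> act x vac = k *: vac.
Proof.
move=> h; rewrite polrep_scaleE !actE !mulr1; apply/cclassP; rewrite -[_ - _]mul1r.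
by apply: li_mul; exists x, k.
Qed.

Lemma Tw_vac w : act (Tw Rr w) vac = thN Rr w *: vac.
Proof.
have [l [r ->]] := Tw_ex Rr w; have := th_word (W0reduced_isred r); case: (r) => -> _ <-.
elim: l {r} => [|k l IH]; first by rewrite /Tprod !big_nil act1 scale1r.
rewrite /Tprod /= !big_cons -/(Tprod Rr (W0lift l)) actM IH actZr.
by rewrite (act_sub_char (sc_T Rr k)) scalerA mulrC.
Qed.

Lemma thN_neq0 w : thN Rr w != 0 :> K.
Proof. by apply/prodf_neq0 => a _; apply: th_neq0. Qed.

Lemma rinv_Tw w : rinv (Tw Rr w) * Tw Rr w = 1.
Proof.
have [l [_ ->]] := Tw_ex Rr w; have [y [h1 h2]] := Tprod_unit Rr (W0lift l).
by rewrite (rinvE h1 h2).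
Qed.

Lemma rinv_Tw_vac w : act (rinv (Tw Rr w)) vac = (thN Rr w)^-1 *: vac.
Proof.
have := congr1 (act (rinv (Tw Rr w))) (Tw_vac w); rewrite -actM rinv_Tw act1 actZr => e.
by rewrite {2}e scalerA mulVf ?scale1r // thN_neq0.
Qed.

Lemma qrhoD l l' : qrho Rr (l + l') = qrho Rr l * qrho Rr l'.
Proof.
rewrite /qrho -big_split; apply: eq_bigr => a _ /=.
by rewrite zpair_rootD expfzDr ?th_neq0.
Qed.
Lemma qrho0 : qrho Rr (0 : hZ D) = 1.
Proof.
rewrite /qrho big1 // => a _; rewrite -[X in _ ^ X](_ : 0 = _) ?expr0z //.
by apply: (@intr_inj rat); rewrite zpair_rootE lpair0l.
Qed.
Lemma qrho_neq0 l : qrho Rr l != 0 :> K.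
Proof. by apply/prodf_neq0 => a _; rewrite expfz_neq0 ?th_neq0. Qed.
Lemma qrhoN l : qrho Rr (- l) = (qrho Rr l)^-1.
Proof.
apply: (mulfI (qrho_neq0 l)); rewrite -qrhoD subrr qrho0.
exact/esym/mulfV/qrho_neq0.
Qed.

(** The exponent of the orbit variable [tvar o] in [q^<l, rho_c>]. *)
Definition orbit_pair l (o : 'I_#|orbits D|) : int :=
  \sum_(a | posroot a && (orbit_index a == o)) zpair l (root a).

Definition tvar (o : 'I_#|orbits D|) : K := tofrac 'X_(lift ord0 o).

Lemma qrhoE l : qrho Rr l = \prod_o tvar o ^ orbit_pair l o.
Proof.
rewrite /qrho (partition_big (@orbit_index D) xpredT) //=; apply: eq_bigr => o _.
rewrite /orbit_pair; elim/big_rec2: _ => [|a k p /andP[_ /eqP <-] ->]; first by rewrite expr0z.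
by rewrite expfzDr ?th_neq0.
Qed.

Lemma zpair_wact w a (m : hZd D) :
  zpair (coroot a) (wact w *m m) = zpair (coroot (ract w^-1%g a)) m.
Proof. by rewrite zpair_ract invgK. Qed.

(** The reflection [s_k] permutes the positive roots of an orbit other than [alpha_k] and negates
    their pairings with its coroot, so these cancel in the sum. *)
Lemma orbit_pair_simple (k : 'I_n) o :
  orbit_pair (coroot (simple k)) o = 2 * (orbit_index (simple k : rootI D) == o)%:Z.
Proof.
rewrite /orbit_pair.
pose P a := (posroot a && (orbit_index a == o)) && (a != simple k).
have e0 : \sum_(a | P a) zpair (coroot (simple k)) (root a) = 0.
  suff : \sum_(a | P a) zpair (coroot (simple k)) (root a) =
         - \sum_(a | P a) zpair (coroot (simple k)) (root a) by lia.
  rewrite [LHS](reindex_inj (ract_inj (w := refl (simple k)))) -sumrN.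
  apply: eq_big => [a|a _]; last first.
    by rewrite root_ract zpair_wact reflV -/(ropp _) zpair_ropp.
  rewrite /P orbit_index_ract srefl_pos [ract _ _ == _](can2_eq (ractK _) (ractVK _)) reflV
    -/(ropp _).
  case: (orbit_index a == o); rewrite ?andbF // !andbT.
  have [->|n1] /= := eqVneq a (simple k); first by rewrite posroot_simple.
  have [->|n2] /= := eqVneq a (ropp (simple k)); first by rewrite posroot_opp posroot_simple.
  by rewrite addbF.
case: eqP => [e|ne].
  rewrite (bigD1 (simple k)) /= ?posroot_simple ?e ?eqxx //.
  by rewrite -[X in _ + X]/(\sum_(a | P a) _) e0 zpair_diag addr0 mulr1.
rewrite mulr0 -[RHS]e0; apply: eq_bigl => a; rewrite /P.
by case: (a =P simple k) => [->|_]; rewrite ?andbT // (introF eqP ne) !andbF.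
Qed.

Lemma qrho_simple (k : 'I_n) : qrho Rr (coroot (simple k)) = th Rr (simple k) ^+ 2 :> K.
Proof.
rewrite qrhoE (bigD1 (orbit_index (simple k : rootI D))) //= big1 ?mulr1.
  by rewrite orbit_pair_simple eqxx mulr1 -exprnP.
by move=> o /negPf ne; rewrite orbit_pair_simple eq_sym ne mulr0 expr0z.
Qed.

Definition Yspec l : Prop := act (Yg Rr l) vac = qrho Rr l *: vac.

Lemma YspecD l l' : Yspec l -> Yspec l' -> Yspec (l + l').
Proof. by rewrite /Yspec => h h'; rewrite YgD actM h' actZr h scalerA qrhoD mulrC. Qed.

Lemma YspecN l : Yspec l -> Yspec (- l).
Proof.
rewrite /Yspec => h; have := congr1 (act (Yg Rr (- l))) h.
rewrite -actM YgC YgN act1 actZr => e; rewrite qrhoN {2}e scalerA.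
by rewrite (mulVf (qrho_neq0 l)) scale1r.
Qed.

Lemma YspecMz l k : Yspec l -> Yspec (l *~ k).
Proof.
move=> h; case: k => k.
  elim: k => [|k IH]; last by rewrite -[_ *~ _]/(l *+ k.+1) mulrS; exact: YspecD.
  by rewrite mulr0z /Yspec Yg0 act1 qrho0 scale1r.
rewrite NegzE mulrNz; apply: YspecN; elim: k => [|k IH]; first exact: h.
by rewrite -[_ *~ _]/(l *+ k.+2) mulrS; exact: YspecD.
Qed.

(** For pairing one the cross relation reads [T_k Y^l = Y^(l - alpha_k^vee) T_k + (t - t^-1) Y^l],
    where [t] is the value of [T_k] on the generator. Applied there, it multiplies the eigenvalue by
    [t^-2]. *)
Lemma Yspec_refl1 l (k : 'I_n) : zpair l (root (simple k)) = 1 -> Yspec l ->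
  Yspec (l - coroot (simple k)).
Proof.
rewrite /Yspec => e h; have [G [h1 _ _ hG]] := Tv_Y Rr (lift ord0 k) l.
have ap : aroot_pair l (lift ord0 k) = 1 by rewrite /aroot_pair liftK.
rewrite (hG ap) Waff_sW ap mulr1z /acoroot liftK in h1.
have {}h1 : Tv Rr (lift ord0 k) * Yg Rr l = Yg Rr (l - coroot (simple k)) * Tv Rr (lift ord0 k) +
   (th Rr (simple k) - (th Rr (simple k))^-1) *: Yg Rr l.
  by rewrite h1 -[(l, 0) - _]/(l - coroot (simple k), 0 - 0 : rat)
    subr0 Yelt_hZ /thn /node_root liftK.
have h2 := congr1 (fun x => act x vac) h1;
  rewrite actDl !actM h actZr (act_sub_char (sc_T Rr k)) actZr in h2.
rewrite actZl h !scalerA in h2.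
set y := act _ vac in h2 *; set t := th Rr (simple k) in h2 *; set q := qrho Rr l in h2 *.
have t0 : t != 0 by exact: th_neq0.
have h3 : t *: y = (t^-1 * q) *: vac.
  have -> : t^-1 * q = q * t - (t - t^-1) * q by ring.
  rewrite scalerBl h2.
  exact/esym/addrK.
have -> : qrho Rr (l - coroot (simple k)) = t^-1 * (t^-1 * q).
  rewrite qrhoD qrhoN qrho_simple -/t -/q expr2 invfM mulrC.
  exact/esym/mulrA.
rewrite -scalerA -h3 scalerA (mulVf t0) scale1r.
by [].
Qed.

Lemma phi_pair_le1 a : a != phi D -> a != ropp (phi D) ->
  (absz (zpair (coroot (phi D)) (root a)) <= 1)%N.
Proof.
move=> n1 n2; have [p|p] := boolP (posroot a); first by have [->|->] := phi_pair p n1.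
have : zpair (coroot (phi D)) (root (ropp a)) = 0 \/ zpair (coroot (phi D)) (root (ropp a)) = 1.
  by apply: phi_pair; rewrite ?posroot_opp // (can2_eq (@roppK D) (@roppK D)).
by rewrite root_ropp zpair_corootN; lia.
Qed.

Lemma srefl_phi_pos a : posroot a ->
  posroot (ract (refl (phi D)) a) = (zpair (coroot (phi D)) (root a) == 0).
Proof.
move=> p; have [->|ne] := eqVneq a (phi D).
  by rewrite -/(ropp _) posroot_opp posroot_phi zpair_diag.
have e : zpair (coroot (phi D)) (root (ract (refl (phi D)) a)) = - zpair (coroot (phi D)) (root a).
  by rewrite root_ract zpair_wact reflV -/(ropp _) zpair_ropp.
have [z|z] := phi_pair p ne; rewrite z.
  have -> : ract (refl (phi D)) a = a; last by rewrite p.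
  by apply: root_inj; rewrite root_rrefl z mulr0z subr0.
by rewrite oner_eq0; apply/negP => /phi_pair_ge0; rewrite e z.
Qed.

(** By [phi_pair], the inversions of [s_phi] are the positive roots not orthogonal to [phi^vee].
    They all pair to one with it, except [phi], whose pairing two is supplied by the value
    [t_phi^(1/2)] of [T_0]. *)
Lemma Yspec_phi : Yspec (coroot (phi D)).
Proof.
rewrite /Yspec; have := act_sub_char (sc_T0 Rr D).
rewrite actM rinv_Tw_vac actZr Yelt_hZ => h.
have n0 := thN_neq0 (refl (phi D)).
have -> : qrho Rr (coroot (phi D)) = thN Rr (refl (phi D)) * th Rr (phi D) :> K.
  rewrite /qrho /thN (bigD1 (phi D)) ?posroot_phi //= [in RHS](bigD1 (phi D)) /=; last first.
    by rewrite posroot_phi srefl_phi_pos ?posroot_phi ?zpair_diag.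
  rewrite zpair_diag -exprnP expr2 [in RHS]mulrAC; congr (_ * _).
  rewrite big_mkcond [in RHS]big_mkcond; apply: eq_bigr => a _.
  have [->|ne] /= := eqVneq a (phi D); first by rewrite !andbF.
  rewrite !andbT; have [p|//] := boolP (posroot a); rewrite (srefl_phi_pos p).
  by have [->|->] := phi_pair p ne; [rewrite expr0z | rewrite expr1z].
rewrite -scalerA -h scalerA mulfV // scale1r.
by [].
Qed.

(** A root other than [phi] and its opposite pairs with [phi^vee] to 0, 1 or -1, so [Yspec_refl1]
    handles every simple reflection; the pairing -1 is treated on the opposite coroot. *)
Lemma Yspec_phi_orbit w : Yspec (coroot (ract w (phi D))).
Proof.
elim/W0_simple_ind: w => [|k w IH]; first by rewrite ract1; exact: Yspec_phi.
rewrite ractM coroot_rrefl; set b := ract w (phi D) in IH *.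
have e :
    zpair (coroot b) (root (simple k)) = zpair (coroot (phi D)) (root (ract w^-1%g (simple k))).
  by rewrite root_ract zpair_wact invgK.
have [e1|n1] := eqVneq (ract w^-1%g (simple k)) (phi D).
  have eb : simple k = b by rewrite /b -e1 ractVK.
  rewrite -eb zpair_diag.
  have -> : coroot (simple k) - coroot (simple k) *~ 2 = - coroot (simple k) :> hZ D.
    by rewrite mulrz_nat mulr2n opprD addrA subrr sub0r.
  by apply: YspecN; rewrite eb.
have [e1|n2] := eqVneq (ract w^-1%g (simple k)) (ropp (phi D)).
  have eb : simple k = ropp b by rewrite /b -ract_ropp -e1 ractVK.
  rewrite eb coroot_ropp root_ropp zpair_corootN zpair_diag.
  have -> : coroot b - (- coroot b) *~ (- 2) = - coroot b :> hZ D.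
    by rewrite mulrNz mulNrz opprK mulrz_nat mulr2n opprD addrA subrr sub0r.
  exact: YspecN.
have := phi_pair_le1 n1 n2; rewrite -e; set p := zpair _ _ => hp.
have : p = 0 \/ p = 1 \/ p = -1 by lia.
case=> [->|[hp1|hp1]]; first by rewrite mulr0z subr0.
  by rewrite hp1 mulr1z; apply: Yspec_refl1.
rewrite hp1 mulrN1z opprK -[_ + _]opprK opprD; apply: YspecN; apply: Yspec_refl1.
  by rewrite zpair_rootN -/p hp1.
exact: YspecN.
Qed.

(** If [c] is in the orbit of [phi] and [p = <c^vee, b>] is 1 or -1, then [b^vee] is [p] times
    [c^vee - s_b c^vee], a difference of two coroots already treated. Irreducibility ensures that
    every root is in this orbit or not orthogonal to it. *)
Lemma Yspec_coroot a : Yspec (coroot a).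
Proof.
have near b : (exists w, b = ract w (phi D)) \/
    (exists w, zpair (coroot (ract w (phi D))) (root b) != 0) -> Yspec (coroot b).
  case=> [[w ->]|[w hw]]; first exact: Yspec_phi_orbit.
  have [e1|n1] := eqVneq (ract w^-1%g b) (phi D).
    by rewrite -(ractVK w b) e1; exact: Yspec_phi_orbit.
  have [e1|n2] := eqVneq (ract w^-1%g b) (ropp (phi D)).
    by rewrite -(ractVK w b) e1 ract_ropp coroot_ropp; apply/YspecN/Yspec_phi_orbit.
  have := phi_pair_le1 n1 n2.
  rewrite root_ract zpair_wact invgK; move: hw; set p := zpair _ _ => p0 hp.
  have e : p * p = 1.
    by move: p0 hp; clearbody p; case: p => [[|[]]|[]].
  have -> : coroot b =
      (coroot (ract w (phi D)) - coroot (ract (refl b * w)%g (phi D))) *~ p :> hZ D.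
    by rewrite ractM coroot_rrefl -/p opprB addrC subrK -mulrzA e mulr1z.
  by apply/YspecMz/YspecD; [|apply: YspecN]; exact: Yspec_phi_orbit.
pose P b := (exists w, b = ract w (phi D)) \/
  (exists w, zpair (coroot (ract w (phi D))) (root b) != 0).
apply: near; rewrite -/(P a).
apply: contrapT => na; pose A := [set b | `[< P b >]].
have mA b : (b \in A) <-> P b by rewrite inE; split=> /asboolP.
have [||c [d [cA dA hcd]]] := @root_irreducible D A.
- by exists (phi D); apply/mA; left; exists 1%g; rewrite ract1.
- by exists a; apply/negP => /mA.
have {}hcd : zpair (coroot c) (root d) != 0.
  by apply: contraNneq hcd => e; rewrite -[latpair _ _ _]/(lpair (coroot c) (root d))
    -zpair_corootE e.
have nd : ~ P d by move/mA; apply/negP.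
case/mA: cA => -[w hw]; first by apply: nd; right; exists w; rewrite -hw.
have [e|ne] := eqVneq (zpair (coroot (ract w (phi D))) (root d)) 0;
  last by apply: nd; right; exists w.
(* For [x] in the orbit of [phi] one has [<s_c x^vee, d> = <x^vee, d> - <x^vee, c> <c^vee, d>]. The
   first term vanishes here and the product does not. *)
apply: nd; right; exists (refl c * w)%g.
rewrite ractM coroot_rrefl zpair_rootD zpair_rootN zpair_rootMz e sub0r oppr_eq0.
by rewrite mulf_neq0.
Qed.

Definition formv l l' : int := \sum_g zpair l (root g) * zpair l' (root g).

Lemma zpair_rrefl l a b : zpair l (root (ract (refl a) b)) =
  zpair l (root b) - zpair l (root a) * zpair (coroot a) (root b).
Proof.
apply: (@intr_inj rat); rewrite rmorphB rmorphM /= !zpair_rootE root_rrefl lpairDr lpairNr lpairMzr.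
by rewrite -(zpair_corootE a) mulrzr.
Qed.

Lemma formvE a l : 2 * formv (coroot a) l = formv (coroot a) (coroot a) * zpair l (root a).
Proof.
have e : formv (coroot a) l = - formv (coroot a) l + formv (coroot a) (coroot a) * zpair l (root a).
  rewrite {1}/formv (reindex_inj (ract_inj (w := refl a))) /formv -sumrN mulr_suml -big_split /=.
  by apply: eq_bigr => g _; rewrite !zpair_rrefl zpair_diag; ring.
by move: e; move: (formv _ _) (_ * _) => p q; lia.
Qed.

Lemma formv_gt0 a : 0 < formv (coroot a) (coroot a).
Proof.
rewrite /formv (bigD1 a) //= zpair_diag ltr_pwDl //.
by apply: sumr_ge0 => g _; rewrite -expr2 sqr_ge0.
Qed.

Lemma formvB l l' : formv (l - l') (l - l') = formv l l - 2 * formv l' l + formv l' l'.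
Proof.
rewrite /formv mulr_sumr -sumrB -big_split /=; apply: eq_bigr => g _.
rewrite zpair_rootD zpair_rootN; move: (zpair l _) (zpair l' _) => p q; ring.
Qed.

Lemma zpair_refl_l l a b :
  zpair (l - coroot a *~ zpair l (root a)) (root b) = zpair l (root (ract (refl a) b)).
Proof.
by rewrite zpair_rootD zpair_rootN zpair_rootMz zpair_rrefl mulrC.
Qed.

(** Coweights orthogonal to every root count as minuscule here, and so do all Weyl conjugates of
    minuscule ones. *)
Definition minuscule l := forall a, (absz (zpair l (root a)) <= 1)%N.

Lemma zpair_pos l a : posroot a -> (forall k, 0 <= zpair l (root (simple k))) ->
  0 <= zpair l (root a).
Proof.
move=> p h; rewrite -(ler_int rat) zpair_rootE.
by apply: (dominant_pos (f := lpairr l)) p _ => k; rewrite /= /lpairr -zpair_rootE ler0z.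
Qed.

Lemma minuscule_refl l a : minuscule l -> minuscule (l - coroot a *~ zpair l (root a)).
Proof. by move=> h b; rewrite zpair_refl_l. Qed.

Lemma zpair_root_ropp l a : zpair l (root (ropp a)) = - zpair l (root a).
Proof. by apply: (@intr_inj rat); rewrite rmorphN /= !zpair_rootE root_ropp lpairNr. Qed.

(** The decreasing measure of the two inductions that move a minuscule coweight between chambers. *)
Lemma card_srefl_lt (q : pred (rootI D)) k : q (simple k) -> ~~ q (ropp (simple k)) ->
  (#|[set a | posroot a && q (ract (refl (simple k)) a)]| < #|[set a | posroot a && q a]|)%N.
Proof.
move=> q1 q2; rewrite -(card_imset _ (ract_inj (w := refl (simple k)))); apply: proper_card.
apply/properP; split; last first.
  exists (simple k); first by rewrite inE posroot_simple.
  apply/imsetP => -[b]; rewrite inE => /andP[pb _] e.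
  have eb : ropp (simple k) = b by rewrite /ropp {2}e -ractM reflK ract1.
  by have := posroot_opp (simple k); rewrite eb pb posroot_simple.
apply/fintype.subsetP => _ /imsetP[b + ->]; rewrite !inE => /andP[pb qb]; rewrite qb andbT.
by apply: posroot_srefl => //; apply: contraTneq qb => ->.
Qed.

(** Simple reflections sort [l] into the antidominant chamber; their product [w] has as inversions
    the positive roots that pair to one with [l]. *)
Lemma minuscule_inv l : minuscule l -> exists w, forall a, posroot a ->
  posroot (ract w a) = ~~ (0 < zpair l (root a)).
Proof.
have [p] := ubnP #|[set a | posroot a && (0 < zpair l (root a))]|.
elim: p l => // p IH l hp hm.
have [[k hk]|hn] := pselect (exists k, 0 < zpair l (root (simple k))); last first.
  exists 1%g => a pa; rewrite ract1 pa; apply/esym/negP => h.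
  have : 0 <= zpair (- l) (root a).
    apply: zpair_pos => // k; rewrite zpair_rootN oppr_ge0 leNgt; apply/negP => h'.
    by apply: hn; exists k.
  by rewrite zpair_rootN; lia.
have hk1 : zpair l (root (simple k)) = 1 by have := hm (simple k); lia.
have [||w hw] := IH (l - coroot (simple k) *~ zpair l (root (simple k))); last first.
- exists (w * refl (simple k))%g => a pa; rewrite ractM.
  have [->|ne] := eqVneq a (simple k).
    rewrite -/(ropp _) ract_ropp posroot_opp hw ?posroot_simple // zpair_refl_l -/(ropp _).
    by rewrite zpair_root_ropp hk1.
  by rewrite hw ?posroot_srefl // zpair_refl_l -ractM reflK ract1.
- exact: minuscule_refl.
- rewrite -ltnS; apply: leq_trans hp; rewrite ltnS.
  rewrite (eq_card (B := [set a | posroot a && (0 < zpair l (root (ract (refl (simple k)) a)))])).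
    by apply: card_srefl_lt (fun a => 0 < zpair l (root a)) _ hk _; rewrite zpair_root_ropp hk1.
  by move=> a; rewrite !inE zpair_refl_l.
Qed.

Lemma root_pos_lin (R : realDomainType) (F : {additive hZd D -> R}) a : posroot a ->
  (forall k, 0 < F (root (simple k))) -> 0 < F (root a).
Proof.
move=> /posrootP[c hc] hF; rewrite hc raddf_sum.
have [k ck] : exists k, c k != 0%N.
  apply/not_existsP => hn; have /eqP[] := root_neq0 a; rewrite hc big1 // => k _.
  by have := hn k; case: (c k) => // q [].
rewrite (bigD1 k) //= ltr_pwDl //; first by rewrite raddfMn pmulrn_lgt0 // lt0n.
by apply: sumr_ge0 => j _; rewrite raddfMn mulrn_wge0 // ltW.
Qed.

Definition rpairr (y : hR Rr D) (m : hZd D) : Rr := rpair y (of_hZd Rr m).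
Fact rpairr_is_zmod_morphism (y : hR Rr D) : zmod_morphism (rpairr y).
Proof.
move=> m m'; rewrite /rpairr of_hZdD rpairDr; congr (_ + _).
by rewrite -rpairNr; congr rpair; exact: map_mxN.
Qed.
HB.instance Definition _ (y : hR Rr D) := GRing.isZmodMorphism.Build (hZd D) Rr (rpairr y)
  (rpairr_is_zmod_morphism y).

(** [Y^l v^-1] preserves the dual alcove: the new pairing with a positive [b] is the old one with
    [v b], plus one exactly when [v b] is negative. Since it acts by 1, [Y^l] acts by [t_v^(1/2)],
    and this is [q^<l, rho_c>] because [l] pairs to one with the inversions of [v] and to zero with
    the other positive roots. *)
Lemma minuscule_Omega l : minuscule l -> (forall k, 0 <= zpair l (root (simple k))) -> Yspec l.
Proof.
move=> hm hd; have [v hv] := minuscule_inv hm.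
have hp a : posroot a -> 0 <= zpair l (root a) by move=> p; apply: zpair_pos.
have h01 a : posroot a -> zpair l (root a) = (~~ posroot (ract v a))%:Z.
  by move=> p; have := hp _ p; have := hm a; rewrite (hv _ p) negbK; case: ltrP; lia.
have rp (y : hR Rr D) b : rpair (Wvreal (l, v^-1%g) y) (of_hZd Rr (root b)) =
    rpair y (of_hZd Rr (root (ract v b))) + (zpair l (root b))%:~R.
  rewrite /Wvreal /= rpairDl rpair_of -zpair_rootE ratr_int; congr (_ + _).
  by rewrite root_ract of_hZd_wact -[RHS](rpair_inv v^-1%g) -!of_hZd_wact wactK.
have rn (y : hR Rr D) b : rpair y (of_hZd Rr (root (ropp b))) = - rpair y (of_hZd Rr (root b)).
  by rewrite root_ropp -rpairNr; congr rpair; exact: map_mxN.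
have bd (y : hR Rr D) b : fund_alcove_dual y -> posroot b ->
    0 < rpair y (of_hZd Rr (root b)) < 1.
  move=> [y1 y2] p; rewrite (root_pos_lin (F := rpairr y)) //=; apply: le_lt_trans y2.
  have [c ->] := phi_highest b; rewrite of_hZdD rpairDr lerDl -/(rpairr y _) raddf_sum.
  by apply: sumr_ge0 => i _; rewrite raddfMn mulrn_wge0 // ltW // y1.
have fa (y : hR Rr D) : (forall b, posroot b -> 0 < rpair y (of_hZd Rr (root b)) < 1) ->
  fund_alcove_dual y.
  move=> h; split=> [k|]; first by have /andP[] := h _ (posroot_simple k).
  by have /andP[] := h _ (posroot_phi D).
have hO : in_Omega Rr (l, v^-1%g).
  rewrite /in_Omega; apply/seteqP; split=> [_ [y hy <-]|y hy].
    apply: fa => b p; rewrite rp (h01 _ p); have [q|q] := boolP (posroot (ract v b)).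
      by rewrite addr0; exact: bd.
    have := bd y (ropp (ract v b)) hy; rewrite posroot_opp rn => /(_ q) /andP[q1 q2].
    rewrite -[(~~ false)%:~R]/(1 : Rr); apply/andP; split; lra.
  pose x : hR Rr D := map_mx intr (wactv v) *m (y - of_hZ Rr l).
  have ex : Wvreal (l, v^-1%g) x = y.
    rewrite /Wvreal /x /= mulmxA -map_mxM -wactvM mulVg wactv1 map_mx1 mul1mx.
    exact: subrK.
  exists x => //; apply: fa => b p.
  have -> : rpair x (of_hZd Rr (root b)) =
      rpair y (of_hZd Rr (root (ract v^-1%g b))) - (zpair l (root (ract v^-1%g b)))%:~R.
    have := rp x (ract v^-1%g b); rewrite ex ractVK => ->.
    by rewrite addrK.
  have [q|q] := boolP (posroot (ract v^-1%g b)).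
    by rewrite (h01 _ q) ractVK p subr0; exact: bd.
  have q' : posroot (ropp (ract v^-1%g b)) by rewrite posroot_opp.
  have := h01 _ q'; rewrite ract_ropp ractVK posroot_opp p zpair_root_ropp => /eqP.
  rewrite eqr_oppLR => /eqP ->; have := bd y _ hy q'; rewrite rn => /andP[q1 q2].
  rewrite -[(- _)%:~R]/(-1 : Rr); apply/andP; split; lra.
have := act_sub_char (sc_O hO); rewrite invgK Yelt_hZ actM rinv_Tw_vac actZr scale1r => h.
rewrite /Yspec; have n0 := thN_neq0 v.
have -> : qrho Rr l = thN Rr v :> K.
  rewrite /qrho /thN big_mkcond [RHS]big_mkcond; apply: eq_bigr => a _.
  have [p|//] := boolP (posroot a); rewrite (h01 _ p) /=.
  case: (posroot (ract v a)) => /=; first exact: expr0z.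
  exact: expr1z.
by rewrite -[X in _ = _ *: X]h scalerA (mulfV n0) scale1r.
Qed.

Lemma Yspec_minuscule l : minuscule l -> Yspec l.
Proof.
have [p] := ubnP #|[set a | posroot a && (zpair l (root a) < 0)]|.
elim: p l => // p IH l hp hm.
have [[k hk]|hn] := pselect (exists k, zpair l (root (simple k)) < 0); last first.
  by apply: minuscule_Omega => // k; rewrite leNgt; apply/negP => h; apply: hn; exists k.
have hk1 : zpair l (root (simple k)) = -1 by have := hm (simple k); lia.
have -> : l = (l + coroot (simple k)) - coroot (simple k) :> hZ D by rewrite addrK.
have e : l - coroot (simple k) *~ zpair l (root (simple k)) = l + coroot (simple k) :> hZ D.
  by rewrite hk1 mulrN1z opprK.
apply: Yspec_refl1; first by rewrite zpair_rootD zpair_diag hk1.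
rewrite -e; apply: IH; last exact: minuscule_refl.
rewrite -ltnS; apply: leq_trans hp; rewrite ltnS.
rewrite (eq_card (B := [set a | posroot a && (zpair l (root (ract (refl (simple k)) a)) < 0)])).
  apply: card_srefl_lt (fun a => zpair l (root a) < 0) _ hk _.
  by rewrite zpair_root_ropp hk1.
by move=> a; rewrite !inE zpair_refl_l.
Qed.

(** Descent on the norm of [l]: if [<l, a> >= 2], subtracting [a^vee] lowers the norm by
    [(a^vee, a^vee) (<l, a> - 1)]. When no such root is left, [l] is minuscule. *)
Theorem Yg_vac l : act (Yg Rr l) vac = qrho Rr l *: vac.
Proof.
rewrite -/(Yspec l); have [p] := ubnP (absz (formv l l)).
elim: p l => // p IH l hp.
have [[a ha]|hn] := pselect (exists a, 2 <= zpair l (root a)); last first.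
  apply: Yspec_minuscule => a; have h1 : ~ (2 <= zpair l (root a)) by move=> h; apply: hn; exists a.
  have h2 : ~ (2 <= zpair l (root (ropp a))) by move=> h; apply: hn; exists (ropp a).
  by move: h1 h2; rewrite zpair_root_ropp; lia.
have -> : l = (l - coroot a) + coroot a :> hZ D by rewrite subrK.
apply: YspecD; last exact: Yspec_coroot.
apply: IH; rewrite formvB formvE.
have l0 : 0 <= formv (l - coroot a) (l - coroot a).
  by apply: sumr_ge0 => g _; rewrite -expr2 sqr_ge0.
move: l0 hp; rewrite formvB formvE; have := formv_gt0 a.
move: (formv _ _) (formv l l) (zpair _ _) ha => q r z; nia.
Qed.

End PolRep.

(** * Independence of Laurent monomials *)

Section Monomials.
Variables (R : idomainType) (N : nat).

Definition zpos (z : int) : nat := if z is Posz k then k else 0%N.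
Definition zneg (z : int) : nat := if z is Negz k then k.+1 else 0%N.

(** Splitting each exponent into its positive and negative parts turns the hypothesis into an
    equality of two monomials in the polynomial ring. *)
Lemma laurent_monomial_eq1 (f : 'I_N -> int) :
  \prod_i (tofrac 'X_i : {fraction {mpoly R[N]}}) ^ f i = 1 -> forall i, f i = 0.
Proof.
have X0 i : (tofrac 'X_i : {fraction {mpoly R[N]}}) != 0 by rewrite tofrac_eq0 mpolyX_neq0.
have e i : (tofrac 'X_i : {fraction {mpoly R[N]}}) ^ f i =
    tofrac ('X_i ^+ zpos (f i)) / tofrac ('X_i ^+ zneg (f i)).
  case: (f i) => k /=; first by rewrite expr0 tofrac1 divr1 tofracXn.
  by rewrite expr0 tofrac1 div1r tofracXn NegzE -exprnN.
under eq_bigr do rewrite e.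
rewrite prodf_div -!rmorph_prod /=.
set p := \prod_i _; set q := \prod_i _ => h i.
have q0 : (tofrac q : {fraction {mpoly R[N]}}) != 0.
  by rewrite /q rmorph_prod; apply/prodf_neq0 => k _ /=; rewrite tofracXn expf_neq0.
have {h} : p = q.
  apply/eqP; rewrite -(tofrac_eq (R := {mpoly R[N]})); apply/eqP.
  by move/(congr1 (fun x => x * tofrac q)): h; rewrite mul1r mulfVK.
have -> : p = 'X_[[multinom zpos (f i) | i < N]].
  by rewrite mpolyXE_id; apply: eq_bigr => k _; rewrite mnmE.
have -> : q = 'X_[[multinom zneg (f i) | i < N]].
  by rewrite mpolyXE_id; apply: eq_bigr => k _; rewrite mnmE.
set m := [multinom _ | _ < _]; move/(congr1 (mcoeff m)).
rewrite !mcoeffX eqxx; case: eqP => [em _|_ /eqP]; last by rewrite oner_eq0.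
have := congr1 (fun m : 'X_{1..N} => m i) em; rewrite !mnmE /=.
by case: (f i) => -[|k].
Qed.

End Monomials.

(** The linear computation of [den_surj], where [y] stands for [Y m] and [x] for the value of the
    character. *)
Lemma lin_solve (F : fieldType) (E : lmodType F) (c x k : F) (m y : E) :
  c * x = 1 - k -> (m - c *: y) + c *: (y - x *: m) = k *: m.
Proof.
by move=> e; rewrite scalerBr scalerA e scalerBl scale1r addrA subrK opprB addrC subrK.
Qed.

Lemma addr_shuffle (E : zmodType) (a b c p q : E) :
  a - b + c - (p + q) = a - p + (c - q - b).
Proof.
rewrite opprD !addrA [a - b + c]addrAC [a + c - b - p]addrAC [a + c - p - b - q]addrAC.
by rewrite [a + c - p]addrAC.
Qed.

(** * Characters of the [Y] operators and invertibility of the denominators *)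

Section Spectrum.
Variables (Rr : realType) (D : rootDatum).
Implicit Types (u v : W D) (l : hZ D) (a : rootI D) (w : W0 D) (b : affwt D).
Implicit Types (g : Omegav Rr D) (h : rootI D * int) (us vs : seq (W D)).
Local Notation n := (Defs.rank D).
Local Notation node := 'I_n.+1.
Local Notation K := (parK Rr D).
Local Notation H := (daha Rr D).
Local Notation V := (polrep Rr D).
Local Notation vac := (Defs.vac Rr D).
Implicit Types (i j : node) (x y : H) (m : V).

(** The eigenvalue of [Y^b] on the generator of the polynomial representation. *)
Definition qv b : K := qpow Rr D (- b.2) * qrho Rr b.1.

Lemma qvD b b' : dint b -> qv (b + b') = qv b * qv b'.
Proof.
move=> hb; rewrite /qv /= opprD qpowD; last by have := dintN hb; rewrite /dint.
rewrite qrhoD; exact: mulrACA.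
Qed.
Lemma qv_hZ l : qv (l, 0) = qrho Rr l.
Proof. rewrite /qv /= oppr0 qpow0; exact: mul1r. Qed.
Lemma qv_opp b : qv (- b) = qrho_opp Rr b.
Proof. by rewrite /qv /qrho_opp /= opprK. Qed.

Lemma orbit_pair_sum l : (\sum_o orbit_pair l o)%:~R = lpair l (rho2 D) :> rat.
Proof.
rewrite /orbit_pair -(partition_big (@orbit_index D) xpredT) //= /rho2 lpair_sumr rmorph_sum.
by apply: eq_bigr => a _; rewrite /= zpair_rootE.
Qed.

(** Independence of the parameters kills every orbit exponent. Only their sum, the pairing with
    [2 rho], is recorded. *)
Lemma qv_eq1 b : dint b -> qv b = 1 -> b.2 = 0 /\ lpair b.1 (rho2 D) = 0.
Proof.
move=> hb; rewrite /qv qrhoE /qpow.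
pose f (i : 'I_#|orbits D|.+1) : int :=
  if unlift ord0 i is Some o then orbit_pair b.1 o else Num.floor ((denom D)%:R * - b.2).
move=> e; have z : forall r, f r = 0.
  apply: (@laurent_monomial_eq1 Rr[i] _ f); rewrite big_ord_recl /f unlift_none.
  rewrite -[RHS]e; congr (_ * _).
  by apply: eq_bigr => o _; rewrite liftK.
split; last first.
  rewrite -orbit_pair_sum big1 // => o _.
  by have := z (lift ord0 o); rewrite /f liftK.
have := z ord0; rewrite /f unlift_none => h.
have : ((denom D)%:R * - b.2 : rat) = 0.
  by rewrite -[LHS]floorK ?h //; have := dintN hb; rewrite /dint.
move/eqP; rewrite mulf_eq0 pnatr_eq0 oppr_eq0 => /orP[/eqP d0|/eqP //].
by have := denom_gt0 D; rewrite d0.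
Qed.

Lemma qv_affcoroot_neq1 h : qv (affcoroot h) != 1.
Proof.
apply/eqP => /(qv_eq1 (dint_affcoroot h))[_ /=]; rewrite -zpair_corootE.
by move/eqP; rewrite intr_eq0 -/(ht _) (negPf (ht_neq0 _)).
Qed.

Lemma WaffM u v b : Waff (Wmul u v) b = Waff u (Waff v b).
Proof.
rewrite /Waff /= !wactvM'; congr (_, _).
by rewrite lpairDr lpair_inv opprD addrA addrAC.
Qed.
Lemma Waff_d v l k : Waff v (l, k) = Waff v (l, 0) + (0, k).
Proof. by rewrite /Waff /=; congr (_, _); rewrite ?addr0 //= sub0r addrC. Qed.
Lemma Waff1 b : Waff (Wone D) b = b.
Proof. by case: b => l k; rewrite /Waff /= wactv1 mul1mx lpair0r subr0. Qed.
Lemma WaffK v b : Waff v (Waff (Winv v) b) = b.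
Proof. by rewrite -WaffM WmulV Waff1. Qed.

Definition chi v l : K := qv (Waff (Winv v) (l, 0)).

Lemma qv_Waff v b : dint b -> qv (Waff v b) = qpow Rr D (- b.2) * qv (Waff v (b.1, 0)).
Proof.
case: b => l k hb; rewrite Waff_d qvD; last exact/dint_Waff/dint_hZ.
by rewrite {2}/qv /= qrho0 mulr1 mulrC.
Qed.

Lemma chi_mul v u l : chi (Wmul v u) l =
  qpow Rr D (- (Waff (Winv v) (l, 0)).2) * chi u (Waff (Winv v) (l, 0)).1.
Proof. by rewrite /chi WinvM WaffM qv_Waff //; exact/dint_Waff/dint_hZ. Qed.

(** The power of [q] recovers the translation part, and the exponents of the [t] variables recover
    the image of [2 rho] under the finite part. An element fixing [2 rho] preserves positivity of
    roots, so it has length zero and is trivial. *)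
Lemma chi_inj u v : (forall l, chi u l = chi v l) -> u = v.
Proof.
move=> e.
have hd l : dint (Waff (Winv u) (l, 0)) by exact/dint_Waff/dint_hZ.
have hd' l : dint (Waff (Winv v) (l, 0)) by exact/dint_Waff/dint_hZ.
have key l : (Waff (Winv u) (l, 0)).2 = (Waff (Winv v) (l, 0)).2 /\
    lpair (Waff (Winv u) (l, 0)).1 (rho2 D) = lpair (Waff (Winv v) (l, 0)).1 (rho2 D).
  have := @qv_eq1 (Waff (Winv u) (l, 0) - Waff (Winv v) (l, 0)) (dintD (hd l) (dintN (hd' l))).
  rewrite qvD // -[qv (Waff (Winv u) _)]/(chi u l) e /chi -qvD // subrr.
  rewrite {1}/qv /= oppr0 qpow0 qrho0 => /(_ (mulr1 _))[].
  by rewrite lpairDl lpairNl => /eqP + /eqP; rewrite !subr_eq0 => /eqP -> /eqP.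
have e1 : u.1 = v.1.
  apply/eqP; rewrite -subr_eq0; apply/eqP/lpair_inj_r => l; rewrite lpairDr lpairNr.
  have [+ _] := key l; rewrite /Waff /= !lpairNr !sub0r !opprK !lpair_inv => ->.
  exact: subrr.
have e2 : wact u.2 *m rho2 D = wact v.2 *m rho2 D :> hZd D.
  apply/eqP; rewrite -subr_eq0; apply/eqP/lpair_inj_r => l; rewrite lpairDr lpairNr.
  have [_] := key l; rewrite /Waff /= !lpair_wactV => ->.
  exact: subrr.
have e3 : (v.2^-1 * u.2 = 1)%g.
  apply: (@W0_length0 Rr D); apply/lengthW0P => -[a k].
  rewrite /apos /aact /= zpair_coroot0 subr0 !posrootE /ht zpair_ract invMg invgK wactM'.
  by rewrite -e2 wactK.
case: u v e1 e3 {e hd hd' key e2} => [m1 w1] [m2 w2] /= -> h.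
by congr (_, _); rewrite -[w1](mulKVg w2) h mulg1.
Qed.

Definition eigen v m : Prop := forall l, act (Yg Rr l) m = chi v l *: m.

Lemma eigen_vac : eigen (Wone D) vac.
Proof. by move=> l; rewrite Yg_vac /chi Winv1 Waff1 qv_hZ. Qed.

Lemma eigen_Yelt v m b : eigen v m -> dint b -> act (Yelt Rr b) m = qv (Waff (Winv v) b) *: m.
Proof. by move=> hm hb; rewrite YeltE actZl hm scalerA -qv_Waff. Qed.

(** [m] is annihilated by the product of the ideals of [K[Y]] of the characters
    [chi u], [u] in [us]. *)
Fixpoint killed us m : Prop :=
  if us is u :: us' then forall l, killed us' (act (Yg Rr l) m - chi u l *: m) else m = 0.

Lemma killed0 us : killed us 0.
Proof. by elim: us => [|u us IH] //= l; rewrite act0r scaler0 subr0. Qed.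

Lemma killedD us m m' : killed us m -> killed us m' -> killed us (m + m').
Proof.
elim: us m m' => [|u us IH] m m' /=; first by move=> -> ->; rewrite addr0.
by move=> h h' l; rewrite actDr scalerDr opprD addrACA; apply: IH.
Qed.

Lemma killed_comm us G m : (forall l, G * Yg Rr l = Yg Rr l * G) -> killed us m ->
  killed us (act G m).
Proof.
move=> hG; elim: us m => [|u us IH] m /=; first by move=> ->; rewrite act0r.
move=> h l; have -> : act (Yg Rr l) (act G m) - chi u l *: act G m =
    act G (act (Yg Rr l) m - chi u l *: m).
  by rewrite actBr actZr -!actM hG.
exact: IH.
Qed.

Lemma killedZ us (k : K) m : killed us m -> killed us (k *: m).
Proof.
rewrite polrep_scaleE; apply: killed_comm => l.
by rewrite -presAlg_scaleAl mul1r -presAlg_scaleAr mulr1.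
Qed.

Lemma killedN us m : killed us m -> killed us (- m).
Proof. by move=> h; rewrite -scaleN1r; exact: killedZ. Qed.
Lemma killedB us m m' : killed us m -> killed us m' -> killed us (m - m').
Proof. by move=> h h'; apply/killedD/killedN. Qed.

Lemma killed_Yg us l m : killed us m -> killed us (act (Yg Rr l) m).
Proof. by apply: killed_comm => l'; exact: YgC. Qed.

Lemma killed_catl vs us m : killed us m -> killed (vs ++ us) m.
Proof.
elim: vs m => [|v vs IH] m //= h l; apply: IH.
by apply: killedB; [exact: killed_Yg | exact: killedZ].
Qed.
Lemma killed_catr vs us m : killed us m -> killed (us ++ vs) m.
Proof.
elim: us m => [|u us IH] m /=; first by move=> ->; exact: killed0.
by move=> h l; exact: IH.
Qed.

Lemma eigen_killed v m : eigen v m -> killed [:: v] m.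
Proof. by move=> h l /=; rewrite h subrr. Qed.

Lemma killed_eigen0 us v m : killed us m -> eigen v m -> v \notin us -> m = 0.
Proof.
elim: us m => [|u us IH] m //= hk he; rewrite inE negb_or => /andP[ne hn].
have [l hl] : exists l, chi v l != chi u l.
  apply/not_existsP => h; case/eqP: ne; apply: chi_inj => l.
  by apply/eqP/negPn/negP; exact: h.
have e : act (Yg Rr l) m - chi u l *: m = (chi v l - chi u l) *: m by rewrite he scalerBl.
have : (chi v l - chi u l) *: m = 0.
  rewrite -e; apply: IH; [exact: hk | move=> l' | exact: hn].
  by rewrite e actZr he !scalerA mulrC.
move/eqP; rewrite scaler_eq0 subr_eq0 (negPf hl) => /eqP //.
Qed.

(** The vector [m'] collects the divided differences produced when [Y^l] passes [T_i]. They arise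
    from [m] through elements commuting with [Y], so the characters in [vs] still kill them. *)
Lemma killed_T us vs i m m' : killed us m -> killed vs m -> killed vs m' ->
  killed ([seq Wmul (sW i) u | u <- us] ++ vs) (act (Tv Rr i) m + m').
Proof.
elim: us m m' => [|u us IH] m m' /=.
  by move=> -> _ h; rewrite act0r add0r.
move=> hu hv hv' l; have [G [h1 _ hG _]] := Tv_Y Rr i (Waff (sW i) (l, 0)).1.
set l' := (Waff (sW i) (l, 0)).1 in h1; set k := (Waff (sW i) (l, 0)).2.
have dl : dint (Waff (sW i) (l, 0)) by exact/dint_Waff/dint_hZ.
have hl : Waff (sW i) (l, 0) = (l', k) by exact: surjective_pairing.
have hl2 : Waff (sW i) (l', 0) = (l, 0) - (0, k).
  apply/eqP; rewrite eq_sym subr_eq -Waff_d -hl -{1}(Winv_sW i).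
  by rewrite -WaffM WmulVv Waff1.
have dk : dint ((0, k) : affwt D).
  by move: dl; rewrite hl.
(* [Y^l T_i = q^-k T_i Y^l' - q^-k (t - t^-1) G] where [s_i l = l' + k d]. *)
have h2 : Yg Rr l * Tv Rr i = qpow Rr D (- k) *: (Tv Rr i * Yg Rr l') -
    (qpow Rr D (- k) * (thn Rr i - (thn Rr i)^-1)) *: G.
  have e1 : Yelt Rr ((l, 0) - (0, k)) = qpow Rr D k *: Yg Rr l.
    by rewrite YeltE /= subr0 sub0r opprK.
  have e2 : qpow Rr D (- k) * qpow Rr D k = 1.
    by rewrite -qpowD ?addNr ?qpow0 //; have := dintN dk; rewrite /dint.
  by rewrite h1 hl2 e1 -presAlg_scaleAl scalerDr !scalerA e2 scale1r addrK.
have hc : chi (Wmul (sW i) u) l = qpow Rr D (- k) * chi u l'.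
  by rewrite chi_mul Winv_sW.
rewrite actDr -actM h2 actBl !actZl actM hc scalerDr.
set y := qpow Rr D (- k); set z := thn Rr i - _.
have -> : y *: act (Tv Rr i) (act (Yg Rr l') m) - (y * z) *: act G m + act (Yg Rr l) m' -
    ((y * chi u l') *: act (Tv Rr i) m + (y * chi u l') *: m') =
    act (Tv Rr i) (y *: (act (Yg Rr l') m - chi u l' *: m)) +
    (act (Yg Rr l) m' - (y * chi u l') *: m' - (y * z) *: act G m).
  rewrite actZr actBr actZr scalerBr scalerA.
  exact: addr_shuffle.
apply: IH.
- exact/killedZ/hu.
- by apply/killedZ/killedB; [exact: killed_Yg | exact: killedZ].
- apply: killedB; last exact/killedZ/killed_comm.
  by apply: killedB; [exact: killed_Yg | exact: killedZ].
Qed.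

Lemma Yelt_shift b k : dint b -> Yelt Rr (b + (0, k)) = qpow Rr D (- k) *: Yelt Rr b.
Proof.
move=> hb; rewrite !YeltE /= addr0 scalerA opprD qpowD; last by have := dintN hb; rewrite /dint.
by congr (_ *: _); rewrite mulrC.
Qed.

Lemma Ov_Yelt g b : dint b -> Ov g * Yelt Rr b = Yelt Rr (Waff (val g) b) * Ov g.
Proof.
case: b => l k hb; rewrite Waff_d Yelt_shift; last exact/dint_Waff/dint_hZ.
by rewrite YeltE /= -presAlg_scaleAr Ov_Y presAlg_scaleAl.
Qed.

Lemma Yg_Ov g l : Yg Rr l * Ov g = Ov g * Yelt Rr (Waff (Winv (val g)) (l, 0)).
Proof. by rewrite Ov_Yelt ?dint_Waff ?dint_hZ // WaffK Yelt_hZ. Qed.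

Lemma killed_Ov us g m : killed us m -> killed [seq Wmul (val g) u | u <- us] (act (Ov g) m).
Proof.
elim: us m => [|u us IH] m /=; first by move=> ->; rewrite act0r.
move=> h l; rewrite -actM Yg_Ov actM chi_mul YeltE actZl.
set b := Waff _ _; have -> : act (Ov g) (qpow Rr D (- b.2) *: act (Yg Rr b.1) m) -
    (qpow Rr D (- b.2) * chi u b.1) *: act (Ov g) m =
  act (Ov g) (qpow Rr D (- b.2) *: (act (Yg Rr b.1) m - chi u b.1 *: m)).
  by rewrite !actZr actBr actZr scalerBr scalerA.
exact/IH/killedZ/h.
Qed.

Lemma all_killed m : exists us, killed us m.
Proof.
have [x ->] := polrep_ind m.
have : exists us, killed us vac by exists [:: Wone D]; apply/eigen_killed/eigen_vac.
move: vac; elim/presAlg_ind: x => [[i|g|l]|k|x y hx hy|x y hx hy] m0.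
- move=> [us h]; exists ([seq Wmul (sW i) u | u <- us] ++ us).
  by have := killed_T i h h (killed0 us); rewrite addr0.
- by move=> [us h]; eexists; exact: (killed_Ov g h).
- by move=> [us h]; exists us; exact: killed_Yg.
- by move=> [us h]; exists us; rewrite -polrep_scaleE; exact: killedZ.
- move=> h; have [us hu] := hx _ h; have [vs hv] := hy _ h; exists (us ++ vs).
  by rewrite actDl; apply: killedD; [exact: killed_catr | exact: killed_catl].
- by move=> /hy /hx; rewrite actM.
Qed.

Lemma eigen_den v m h : eigen v m ->
  act (den Rr h) m = (1 - qv (affcoroot (aopp (aact (Winv v) h)))) *: m.
Proof.
move=> hm; rewrite /den actBl act1 (eigen_Yelt hm) ?dintN ?dint_affcoroot //.
by rewrite scalerBl scale1r -aact_opp affcoroot_act affcoroot_opp.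
Qed.

Lemma den_neq0 h : 1 - qv (affcoroot h) != 0.
Proof. by rewrite subr_eq0 eq_sym qv_affcoroot_neq1. Qed.

Lemma den_comm h l : den Rr h * Yg Rr l = Yg Rr l * den Rr h.
Proof. by rewrite /den mulrBl mulrBr mul1r mulr1 -Yelt_hZ YeltC. Qed.

Lemma den_inj0 h m : act (den Rr h) m = 0 -> m = 0.
Proof.
have [us] := all_killed m; elim: us m => [|u us IH] m //= hk e.
have he : eigen u m.
  move=> l; apply/eqP; rewrite -subr_eq0; apply/eqP; apply: IH; first exact: hk.
  by rewrite actBr actZr -actM den_comm actM e act0r scaler0 subr0.
move: e; rewrite (eigen_den _ he) => /eqP; rewrite scaler_eq0 (negPf (den_neq0 _)) => /eqP.
exact.
Qed.

(** Write the denominator as [1 - c Y]. Induction on the list of characters gives a preimage of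
    [(Y - chi) m]; adding [c] times it to [m] gives a preimage of [k m], where [k] is the nonzero
    value of the denominator at the first character. *)
Lemma den_surj h m : exists m', act (den Rr h) m' = m.
Proof.
have [us] := all_killed m; elim: us m => [|u us IH] m /=.
  by move=> ->; exists 0; rewrite act0r.
move=> hk; pose b := - affcoroot h.
have [m1 h1] := IH _ (hk b.1).
pose c := qpow Rr D (- b.2); pose k := 1 - qv (affcoroot (aopp (aact (Winv u) h))).
have k0 : k != 0 by exact: den_neq0.
have e : act (den Rr h) (m + c *: m1) = k *: m.
  rewrite actDr actZr h1 /den actBl act1 -/b YeltE actZl -/c; apply: lin_solve.
  rewrite /k opprB addrCA subrr addr0 -qv_Waff; last exact/dintN/dint_affcoroot.
  by rewrite -aact_opp affcoroot_act affcoroot_opp.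
exists (k^-1 *: (m + c *: m1)); rewrite actZr e scalerA (mulVf k0).
exact: scale1r.
Qed.

End Spectrum.

(** * Modules over a presented algebra from operators satisfying its relations *)

Section PresentedAction.
Variables (K : fieldType) (G : Type) (rel : expr K G -> expr K G -> Prop).
Variables (E : lmodType K) (gact : G -> E -> E).
Hypothesis gactD : forall g m m', gact g (m + m') = gact g m + gact g m'.
Hypothesis gactZ : forall g (k : K) m, gact g (k *: m) = k *: gact g m.

Fixpoint expr_act (e : expr K G) (m : E) : E :=
  match e with
  | EGen g => gact g m
  | ECst k => k *: m
  | EAdd e1 e2 => expr_act e1 m + expr_act e2 m
  | EMul e1 e2 => expr_act e1 (expr_act e2 m)
  end.

Hypothesis gact_rel : forall e e' m, rel e e' -> expr_act e m = expr_act e' m.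

Lemma expr_actD e m m' : expr_act e (m + m') = expr_act e m + expr_act e m'.
Proof.
elim: e m m' => [g|k|e IH e' IH'|e IH e' IH'] m m' /=; first exact: gactD.
- exact: scalerDr.
- by rewrite IH IH' addrACA.
- by rewrite IH' IH.
Qed.

Lemma expr_actZ e (k : K) m : expr_act e (k *: m) = k *: expr_act e m.
Proof.
elim: e m => [g|k'|e IH e' IH'|e IH e' IH'] m /=; first exact: gactZ.
- by rewrite !scalerA mulrC.
- by rewrite IH IH' scalerDr.
- by rewrite IH' IH.
Qed.

Lemma expr_act_cong e e' : pcong rel e e' -> forall m, expr_act e m = expr_act e' m.
Proof.
elim=> {e e'} /=.
- by [].
- by move=> x y _ h m; rewrite h.
- by move=> x y z _ h1 _ h2 m; rewrite h1.
- by move=> x x' y y' _ h1 _ h2 m; rewrite h1 h2.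
- by move=> x x' y y' _ h1 _ h2 m; rewrite h2 h1.
- by move=> x y z m; rewrite addrA.
- by move=> x y m; rewrite addrC.
- by move=> x m; rewrite scale0r add0r.
- by move=> x m; rewrite scaleN1r addNr scale0r.
- by [].
- by move=> x m; rewrite scale1r.
- by [].
- by move=> x y z m; rewrite expr_actD.
- by move=> a b m; rewrite scalerDl.
- by move=> a b m; rewrite scalerA.
- by move=> a x m; rewrite expr_actZ.
- by move=> x y h m; apply: gact_rel.
Qed.

Definition pres_act (x : presAlg rel) : E -> E := expr_act (generic_quotient.repr x).

Lemma pres_actE e m : pres_act (pclass rel e) m = expr_act e m.
Proof. exact: expr_act_cong (pclass_repr _ _) _. Qed.
Lemma pres_actM x y m : pres_act (x * y) m = pres_act x (pres_act y m).
Proof. by rewrite -[x]pclassK -[y]pclassK -pclass_mul !pres_actE. Qed.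
Lemma pres_actDl x y m : pres_act (x + y) m = pres_act x m + pres_act y m.
Proof. by rewrite -[x]pclassK -[y]pclassK -pclass_add !pres_actE. Qed.
Lemma pres_actZl (k : K) x m : pres_act (k *: x) m = k *: pres_act x m.
Proof.
have -> : k *: x = (k *: (1 : presAlg rel)) * x by rewrite -presAlg_scaleAl mul1r.
by rewrite pres_actM -pclass_cst pres_actE.
Qed.
Lemma pres_act1 m : pres_act 1 m = m.
Proof. by rewrite -[1]/(pclass rel (ECst 1)) pres_actE /= scale1r. Qed.
Lemma pres_actZr (k : K) x m : pres_act x (k *: m) = k *: pres_act x m.
Proof. exact: expr_actZ. Qed.

End PresentedAction.

Lemma invf_sub_sqr (F : fieldType) (t : F) : t != 0 -> t^-1 * (1 - t ^+ 2) = - (t - t^-1).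
Proof. by move=> t0; rewrite mulrBr mulr1 expr2 mulrA (mulVf t0) mul1r opprB. Qed.

(** * The localization acting on the module, and the vectors [tau_w 1] *)

Section LocalizedAction.
Variables (Rr : realType) (D : rootDatum).
Implicit Types (u v : W D) (b : affwt D).
Implicit Types (g : Omegav Rr D) (h : rootI D * int) (us vs : seq (W D)).
Local Notation n := (Defs.rank D).
Local Notation node := 'I_n.+1.
Local Notation K := (parK Rr D).
Local Notation H := (daha Rr D).
Local Notation HL := (daha_loc Rr D).
Local Notation V := (polrep Rr D).
Local Notation vac := (Defs.vac Rr D).
Local Notation word := (@Wword D).
Implicit Types (i j : node) (l : seq node) (x y : H) (m : V).

Definition deninv h m : V := sval (cid (den_surj h m)).

Lemma deninvK h m : act (den Rr h) (deninv h m) = m.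
Proof. exact: svalP (cid (den_surj h m)). Qed.

Lemma den_inj h m m' : act (den Rr h) m = act (den Rr h) m' -> m = m'.
Proof.
move=> e; apply/eqP; rewrite -subr_eq0; apply/eqP; apply: (@den_inj0 _ _ h).
by rewrite actBr e subrr.
Qed.

Definition locgen_act (s : H + (rootI D * int)) : V -> V :=
  match s with inl a => act a | inr h => deninv h end.

Lemma locgen_actD s m m' : locgen_act s (m + m') = locgen_act s m + locgen_act s m'.
Proof.
case: s => [a|h] /=; first exact: actDr.
by apply: (@den_inj h); rewrite actDr !deninvK.
Qed.
Lemma locgen_actZ s (k : K) m : locgen_act s (k *: m) = k *: locgen_act s m.
Proof.
case: s => [a|h] /=; first exact: actZr.
by apply: (@den_inj h); rewrite actZr !deninvK.
Qed.
Lemma locgen_act_rel e e' m : loc_rel (den Rr (D := D)) e e' ->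
  expr_act locgen_act e m = expr_act locgen_act e' m.
Proof.
case=> [k|a b|a b|h|h] /=.
- by rewrite -polrep_scaleE.
- exact: actDl.
- exact: actM.
- by rewrite scale1r; apply: (@den_inj h); rewrite deninvK.
- by rewrite scale1r deninvK.
Qed.

Definition locact (x : HL) : V -> V := pres_act locgen_act x.

Lemma locactM (x y : HL) m : locact (x * y) m = locact x (locact y m).
Proof. exact: (pres_actM locgen_actD locgen_actZ locgen_act_rel). Qed.
Lemma locactDl (x y : HL) m : locact (x + y) m = locact x m + locact y m.
Proof. exact: (pres_actDl locgen_actD locgen_actZ locgen_act_rel). Qed.
Lemma locactZl (k : K) (x : HL) m : locact (k *: x) m = k *: locact x m.
Proof. exact: (pres_actZl locgen_actD locgen_actZ locgen_act_rel). Qed.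
Lemma locactZr (k : K) (x : HL) m : locact x (k *: m) = k *: locact x m.
Proof. exact: (pres_actZr locgen_actZ). Qed.
Lemma locact1 m : locact 1 m = m.
Proof. exact: (pres_act1 locgen_actD locgen_actZ locgen_act_rel). Qed.
Lemma locact_iota x m : locact (iota_loc x) m = act x m.
Proof. exact: (pres_actE locgen_actD locgen_actZ locgen_act_rel (EGen (inl x))). Qed.

Definition dloc h : HL := pgen (loc_rel (den Rr (D := D))) (inr h).

Lemma locact_dloc h m : locact (dloc h) m = deninv h m.
Proof. exact: (pres_actE locgen_actD locgen_actZ locgen_act_rel (EGen (inr h))). Qed.

Lemma iota_locD x y : iota_loc (x + y) = iota_loc x + iota_loc y.
Proof. by rewrite /iota_loc /to_loc /pgen (pclass_rel (loc_add _ x y)) pclass_add. Qed.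
Lemma iota_locM x y : iota_loc (x * y) = iota_loc x * iota_loc y.
Proof. by rewrite /iota_loc /to_loc /pgen (pclass_rel (loc_mul _ x y)) pclass_mul. Qed.
Lemma iota_loc_cst (k : K) : iota_loc (k *: (1 : H)) = k *: (1 : HL).
Proof. by rewrite /iota_loc /to_loc /pgen (pclass_rel (loc_cst _ k)) pclass_cst. Qed.
Lemma iota_loc1 : iota_loc (1 : H) = 1.
Proof. by have := iota_loc_cst 1; rewrite !scale1r. Qed.
Lemma iota_locZ (k : K) x : iota_loc (k *: x) = k *: iota_loc x.
Proof.
have -> : k *: x = (k *: (1 : H)) * x by rewrite -presAlg_scaleAl mul1r.
by rewrite iota_locM iota_loc_cst -presAlg_scaleAl mul1r.
Qed.
Lemma iota_locB x y : iota_loc (x - y) = iota_loc x - iota_loc y.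
Proof. by rewrite iota_locD -scaleN1r iota_locZ scaleN1r. Qed.

Lemma dlocV h : dloc h * iota_loc (den Rr h) = 1.
Proof.
rewrite /iota_loc /to_loc /dloc /pgen -pclass_mul (pclass_rel (loc_invl _ h)) pclass_cst.
exact: scale1r.
Qed.
Lemma dlocVr h : iota_loc (den Rr h) * dloc h = 1.
Proof.
rewrite /iota_loc /to_loc /dloc /pgen -pclass_mul (pclass_rel (loc_invr _ h)) pclass_cst.
exact: scale1r.
Qed.

Lemma den_simple i : 1 - Yelt Rr (- acoroot i) = den Rr (asimple i).
Proof. by rewrite /den acorootE. Qed.

Definition tcoef i : K := (thn Rr i)^-1 * (1 - thn Rr i ^+ 2).

Lemma tcoefE i : tcoef i = - (thn Rr i - (thn Rr i)^-1).
Proof.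
exact: invf_sub_sqr (thn_neq0 Rr i).
Qed.

Lemma tauvE i : tauv_simple Rr i = iota_loc (Tv Rr i) + tcoef i *: dloc (asimple i).
Proof. by rewrite /tauv_simple den_simple (rinvE (dlocV _) (dlocVr _)). Qed.

Lemma dloc_Y h (l : hZ D) : dloc h * iota_loc (Yg Rr l) = iota_loc (Yg Rr l) * dloc h.
Proof.
rewrite -[LHS]mulr1 -(dlocVr h) -mulrA [iota_loc (Yg _ _) * _]mulrA -iota_locM -den_comm.
by rewrite iota_locM !mulrA dlocV mul1r.
Qed.

(** The denominator term of [tau_i] is exactly what cancels the divided difference in the cross
    relation. *)
Lemma tauv_Yg i (l : hZ D) : tauv_simple Rr i * iota_loc (Yg Rr l) =
  iota_loc (Yelt Rr (Waff (sW i) (l, 0))) * tauv_simple Rr i.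
Proof.
have [G [h1 h2 _ _]] := Tv_Y Rr i l; rewrite tauvE mulrDl mulrDr.
rewrite -iota_locM h1 iota_locD iota_locM iota_locZ -addrA; congr (_ + _).
have dY b : dloc (asimple i) * iota_loc (Yelt Rr b) = iota_loc (Yelt Rr b) * dloc (asimple i).
  by rewrite YeltE iota_locZ -presAlg_scaleAr dloc_Y -presAlg_scaleAl.
have e : iota_loc G =
    dloc (asimple i) * (iota_loc (Yg Rr l) - iota_loc (Yelt Rr (Waff (sW i) (l, 0)))).
  by rewrite -iota_locB -h2 iota_locM den_simple mulrA dlocV mul1r.
rewrite -presAlg_scaleAl -presAlg_scaleAr -dY e mulrBr -[thn Rr i - _]opprK -tcoefE scaleNr
  scalerBr.
by rewrite opprB subrK.
Qed.

Lemma tauv_Yelt i b : dint b -> tauv_simple Rr i * iota_loc (Yelt Rr b) =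
  iota_loc (Yelt Rr (Waff (sW i) b)) * tauv_simple Rr i.
Proof.
case: b => l k hb; rewrite Waff_d Yelt_shift; last exact/dint_Waff/dint_hZ.
rewrite YeltE [in LHS]iota_locZ [in RHS](iota_locZ (qpow Rr D (- k))) /= -presAlg_scaleAr tauv_Yg.
exact: presAlg_scaleAl.
Qed.

Lemma tauv_den i h : tauv_simple Rr i * iota_loc (den Rr h) =
  iota_loc (den Rr (aact (sW i) h)) * tauv_simple Rr i.
Proof.
rewrite /den !iota_locB iota_loc1 mulrBr mulrBl mulr1 mul1r; congr (_ - _).
rewrite tauv_Yelt ?dintN ?dint_affcoroot //.
by rewrite -!affcoroot_opp -aact_opp affcoroot_act.
Qed.

Definition tauprod l : HL := \prod_(i <- l) tauv_simple Rr i.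

Lemma tauprod_den l h : tauprod l * iota_loc (den Rr h) =
  iota_loc (den Rr (aact (word l) h)) * tauprod l.
Proof.
elim: l => [|i l IH]; first by rewrite /tauprod big_nil mul1r mulr1 aact1.
by rewrite /tauprod !big_cons -/(tauprod l) -mulrA IH mulrA tauv_den aactM mulrA.
Qed.

(** [loc_vac] reads its argument as a right fraction, so one must be exhibited: the denominator of
    the leftmost factor is carried through the others by [tauprod_den]. *)
Lemma tauprod_fraction l : exists (x : H) (bs : seq (rootI D * int)),
  tauprod l * iota_loc (\prod_(b <- bs) den Rr b) = iota_loc x.
Proof.
elim: l => [|i l [x [bs e]]].
  by exists 1, [::]; rewrite /tauprod !big_nil iota_loc1 mulr1.
exists ((Tv Rr i * den Rr (asimple i) + tcoef i *: (1 : H)) * x),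
  (aact (Winv (word l)) (asimple i) :: bs).
rewrite /tauprod !big_cons -/(tauprod l) iota_locM mulrA -[_ * _ * iota_loc (den _ _)]mulrA.
rewrite tauprod_den aactVK mulrA -mulrA e [RHS]iota_locM; congr (_ * _).
rewrite tauvE mulrDl [in RHS]iota_locD iota_loc_cst [in RHS]iota_locM; congr (_ + _).
by rewrite -presAlg_scaleAl dlocV.
Qed.

Lemma dens_vac (bs : seq (rootI D * int)) : exists2 k : K, k != 0 &
  act (\prod_(b <- bs) den Rr b) vac = k *: vac.
Proof.
elim: bs => [|b bs [k k0 e]].
  by exists 1; rewrite ?oner_eq0 // big_nil act1 scale1r.
exists (k * (1 - qv Rr (affcoroot (aopp (aact (Winv (Wone D)) b))))).
  by rewrite mulf_neq0 ?den_neq0.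
by rewrite big_cons actM e actZr (eigen_den _ (@eigen_vac Rr D)) scalerA.
Qed.

(** The action of the localization gives every such fraction the same value on the generator, so the
    choice made in [loc_vac] is harmless once one fraction exists. *)
Lemma loc_vacE (z : HL) x (bs : seq (rootI D * int)) :
  z * iota_loc (\prod_(b <- bs) den Rr b) = iota_loc x -> loc_vac z = locact z vac.
Proof.
move=> e0; rewrite /loc_vac; case: xgetP => [m _ [y [bs' [k [e k0 ek ->]]]]|].
  have := congr1 (fun z => locact z vac) e.
  rewrite locactM !locact_iota ek locactZr => <-.
  by rewrite scalerA (mulVf k0) scale1r.
have [k k0 ek] := dens_vac bs.
by move/(_ (k^-1 *: act x vac)); case; exists x, bs, k.
Qed.

Definition evec l : V := locact (tauprod l) vac.

Lemma loc_vac_tau g l : loc_vac (iota_loc (Ov g) * tauprod l) = act (Ov g) (evec l).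
Proof.
have [x [bs e]] := tauprod_fraction l.
rewrite (@loc_vacE _ (Ov g * x) bs); last by rewrite -mulrA e -iota_locM.
by rewrite locactM locact_iota.
Qed.

Lemma eigen_evec l : eigen (word l) (evec l).
Proof.
elim: l => [|i l IH].
  by rewrite /evec /tauprod big_nil locact1; exact: eigen_vac.
move=> l'; rewrite /evec /tauprod big_cons -/(tauprod l) -locact_iota -locactM mulrA.
have dl : dint (Waff (sW i) (l', 0)) by exact/dint_Waff/dint_hZ.
have -> : iota_loc (Yg Rr l') * tauv_simple Rr i =
   tauv_simple Rr i * iota_loc (Yelt Rr (Waff (sW i) (l', 0))).
  by rewrite tauv_Yelt // -WaffM sWK Waff1 Yelt_hZ.
rewrite -mulrA !locactM locact_iota (eigen_Yelt IH dl) locactZr.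
by congr (_ *: _); rewrite /chi Wword_cons WinvM Winv_sW WaffM.
Qed.

(** The scalar by which [1 - Y^(-alpha_i^vee)] acts on [evec l]. *)
Definition edenom i l : K := 1 - qv Rr (affcoroot (aopp (aact (Winv (word l)) (asimple i)))).

Lemma edenom_neq0 i l : edenom i l != 0.
Proof. exact: den_neq0. Qed.

Lemma evec_cons i l : evec (i :: l) = act (Tv Rr i) (evec l) + (tcoef i / edenom i l) *: evec l.
Proof.
rewrite /evec /tauprod big_cons -/(tauprod l) locactM tauvE locactDl locact_iota locactZl
  locact_dloc.
congr (_ + _); rewrite -scalerA; congr (_ *: _); apply: (@den_inj (asimple i)).
rewrite deninvK actZr (eigen_den _ (@eigen_evec l)) scalerA -/(edenom i l).
by rewrite (mulVf (edenom_neq0 i l)) scale1r.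
Qed.

Lemma evec_Tprod l : exists us, killed us (act (Tprod Rr l) vac - evec l) /\
  forall u, u \in us -> exists2 l', word l' = u & (size l' < size l)%N.
Proof.
elim: l => [|i l [us [hk hu]]].
  by exists [::]; split=> //; rewrite /evec /tauprod /Tprod !big_nil act1 locact1 /= subrr.
exists ([seq Wmul (sW i) u | u <- us] ++ (us ++ [:: word l])); split.
  rewrite evec_cons /Tprod big_cons -/(Tprod Rr l) actM opprD addrA -actBr.
  apply: killed_T => //; first exact: killed_catr.
  apply/killed_catl/killedN/killedZ/eigen_killed/eigen_evec.
move=> u; rewrite !mem_cat => /or3P[/mapP[u' /hu[l' <- sl] ->]|/hu[l' <- sl]|].
- by exists (i :: l').
- by exists l' => //; exact: leqW.
- by rewrite inE => /eqP ->; exists l.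
Qed.

Lemma evec_red l l' : isred Rr l -> isred Rr l' -> word l = word l' -> evec l = evec l'.
Proof.
move=> r r' e; have [us [hk hu]] := evec_Tprod l; have [us' [hk' hu']] := evec_Tprod l'.
apply/eqP; rewrite -subr_eq0; apply/eqP.
apply: (@killed_eigen0 _ _ (us ++ us') (word l)).
(* The leading terms [T_w 1] of the two words coincide, which leaves the difference of the two error
   terms. *)
- have -> : evec l - evec l' = (act (Tprod Rr l') vac - evec l') - (act (Tprod Rr l) vac - evec l).
    by rewrite (Tprod_red r r' e) opprB [RHS]addrC addrA subrK.
  by apply: killedB; [exact: killed_catl | exact: killed_catr].
- by move=> l0; rewrite actBr eigen_evec e eigen_evec scalerBr.
- apply/negP; rewrite mem_cat => /orP[/hu|/hu'][l0 e0].
    by have := length_word_le Rr (Wone D) l0; rewrite Wmul1v e0 r lengthW1; lia.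
  by have := length_word_le Rr (Wone D) l0; rewrite Wmul1v e0 e r' lengthW1; lia.
Qed.

Lemma loc_vac_tauv g l : reduced g l ->
  loc_vac (tauv Rr (Wmul (val g) (word l))) = act (Ov g) (evec l).
Proof.
move=> r; have r1 : isred Rr l := proj1 (reducedE g l) r.
rewrite /tauv; case: xgetP => [x _ [g' [l' [r' /Omegav_uniq[<- e] ->]]]|].
  have r1' : isred Rr l' := proj1 (reducedE g' l') r'.
  rewrite -/(tauprod l') loc_vac_tau; congr act; exact: evec_red.
by move/(_ (iota_loc (Ov g) * tauprod l)); case; exists g, l.
Qed.

End LocalizedAction.

(** * Expansion into alcove walks *)

Section Walks.
Variables (Rr : realType) (D : rootDatum).
Implicit Types (u v : W D) (w : seq 'I_(Defs.rank D).+1) (p : seq (W D)).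
Local Notation n := (Defs.rank D).
Local Notation node := 'I_n.+1.
Local Notation K := (parK Rr D).
Local Notation V := (polrep Rr D).
Local Notation vac := (Defs.vac Rr D).
Implicit Types (i j : node).

Lemma Wmul_sW_neq u i : Wmul u (sW i) != u.
Proof.
apply/eqP => e; have := apos_simple i; rewrite -[asimple i]aact1.
have -> : Wone D = sW i by apply: (@Wmul_inj _ u); rewrite Wmulv1 e.
by rewrite sW_simple apos_opp apos_simple.
Qed.

(** The first list takes the crossing and the second the fold, mirroring the two terms of the
    expansion of [X^u tau_i]. *)
Fixpoint walks u w : seq (seq (W D)) :=
  if w is i :: w' then
    [seq u :: p | p <- walks (Wmul u (sW i)) w'] ++ [seq u :: p | p <- walks u w']
  else [:: [:: u]].

Lemma walks_head u w p : p \in walks u w -> nth (Wone D) p 0 = u.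
Proof.
case: w => [|i w] /=; first by rewrite inE => /eqP ->.
by rewrite mem_cat => /orP[] /mapP[q _ ->].
Qed.

Lemma uniq_walks u w : uniq (walks u w).
Proof.
elim: w u => [|i w IH] u //=; rewrite cat_uniq !map_inj_uniq ?IH //=; last 2 first.
- by move=> p q [].
- by move=> p q [].
rewrite andbT; apply/hasPn => _ /mapP[q hq ->]; apply/mapP => -[q' hq' [e]].
by have /eqP[] := Wmul_sW_neq u i; rewrite -(walks_head hq') -e (walks_head hq).
Qed.

Lemma walksP u w p : (p \in walks u w) <-> is_walk u w p.
Proof.
elim: w u p => [|i w IH] u p /=.
  rewrite inE; split=> [/eqP ->|[]]; first by split.
  by case: p => [|v [|? ?]] //= _ ->.
rewrite mem_cat; split.
  case/orP=> /mapP[q /IH[sq hq stq] ->]; split=> //=; rewrite ?sq //.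
    by case=> [|k] hk /=; [rewrite hq; left | exact: stq].
  by case=> [|k] hk /=; [rewrite hq; right | exact: stq].
case: p => [|v q] [] //= [sq] ev st; rewrite ev in st *.
have hq z : nth (Wone D) q 0 = z -> q \in walks z w.
  by move=> e; apply/IH; split=> // k hk; exact: (st k.+1 hk).
have := st 0%N isT; rewrite /= => -[]/hq h; apply/orP; [left|right]; exact: map_f.
Qed.

Definition pos_factor w k : K := (thn Rr (nth ord0 w k))^-1 * (1 - thn Rr (nth ord0 w k) ^+ 2)
  / (1 - qrho_opp Rr (betav w k)).
Definition neg_factor w k : K := (thn Rr (nth ord0 w k))^-1 * (1 - thn Rr (nth ord0 w k) ^+ 2)
  * qrho_opp Rr (betav w k) / (1 - qrho_opp Rr (betav w k)).

Definition walk_coef w p : K :=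
  (\prod_(k < size w | pos_fold Rr w p k) pos_factor w k) *
  (\prod_(k < size w | neg_fold Rr w p k) neg_factor w k).

Lemma prod_cons_shift (s : nat) (P : pred nat) (F : nat -> K) :
  \prod_(k < s.+1 | P k) F k = (if P 0%N then F 0%N else 1) * \prod_(k < s | P k.+1) F k.+1.
Proof. by rewrite big_mkcond big_ord_recl [in RHS]big_mkcond. Qed.

Lemma walk_coef_cons i w u p : walk_coef (i :: w) (u :: p) =
  ((if pos_fold Rr (i :: w) (u :: p) 0 then pos_factor (i :: w) 0 else 1) *
   (if neg_fold Rr (i :: w) (u :: p) 0 then neg_factor (i :: w) 0 else 1)) * walk_coef w p.
Proof.
rewrite /walk_coef [size (i :: w)]/=.
rewrite (prod_cons_shift (size w) (pos_fold Rr (i :: w) (u :: p)) (pos_factor (i :: w))).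
rewrite (prod_cons_shift (size w) (neg_fold Rr (i :: w) (u :: p)) (neg_factor (i :: w))).
exact: mulrACA.
Qed.

(** A denominator acts on the eigenvector of the letters to its right; this is why [beta_k] is built
    from the letters after the [k]-th. *)
Lemma edenomE i w : edenom Rr i w = 1 - qrho_opp Rr (betav (i :: w) 0).
Proof.
by rewrite /edenom affcoroot_opp qv_opp affcoroot_act -acorootE /betav /= drop0 Wword_rev.
Qed.

Lemma walk_coef_cross i w u p : nth (Wone D) p 0 = Wmul u (sW i) ->
  walk_coef (i :: w) (u :: p) = walk_coef w p.
Proof.
move=> e; rewrite walk_coef_cons /pos_fold /neg_fold /= e (negPf (Wmul_sW_neq u i)) /=.
by rewrite mulr1 mul1r.
Qed.

Lemma walk_coef_fold i w u p : nth (Wone D) p 0 = u ->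
  walk_coef (i :: w) (u :: p) =
  (if up u i then pos_factor (i :: w) 0 else neg_factor (i :: w) 0) * walk_coef w p.
Proof.
move=> e; rewrite walk_coef_cons /pos_fold /neg_fold /= e eqxx on_pos_side_self on_neg_side_self /=.
by case: (up u i) => /=; rewrite ?mulr1 ?mul1r.
Qed.

(** If [u] is not [up], the crossing is positive and its term is [X^u T_i^-1]; writing [T_i] as
    [T_i^-1] minus [tcoef i] leaves a multiple of [X^u]. *)
Lemma act_Xelt_step u i (m : V) : act (Xelt Rr u) (act (Tv Rr i) m) =
  act (Xelt Rr (Wmul u (sW i))) m - (if up u i then 0 else tcoef Rr i) *: act (Xelt Rr u) m.
Proof.
have := isX_step i (isX_Xelt Rr u); case: (up u i) => h.
  by rewrite (isX_uniq (isX_Xelt Rr _) h) actM scale0r subr0.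
rewrite (isX_uniq (isX_Xelt Rr _) h) actM /Tinv actBl actZl act1 actBr actZr tcoefE.
by rewrite scaleNr opprK subrK.
Qed.

(** The correction of [act_Xelt_step] is what puts [q^<-beta, rho_c>] into the numerator at negative
    folds. *)
Lemma fold_factor i w u : (if up u i then pos_factor (i :: w) 0 else neg_factor (i :: w) 0) =
  tcoef Rr i / edenom Rr i w - (if up u i then 0 else tcoef Rr i).
Proof.
rewrite /pos_factor /neg_factor /= -edenomE -/(tcoef Rr i); case: (up u i); first by rewrite subr0.
have d0 := edenom_neq0 Rr i w; have -> : qrho_opp Rr (betav (i :: w) 0) = 1 - edenom Rr i w.
  by rewrite edenomE opprB addrC subrK.
by rewrite mulrBr mulr1 mulrBl (mulfK d0).
Qed.

Lemma act_Xelt_evec u w : act (Xelt Rr u) (evec Rr w) =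
  \sum_(p <- walks u w) walk_coef w p *: act (Xelt Rr (walk_end p)) vac.
Proof.
elim: w u => [|i w IH] u /=.
  rewrite big_seq1 /walk_coef !big_ord0 mulr1 scale1r /evec /tauprod big_nil.
  by rewrite locact1.
rewrite evec_cons actDr actZr act_Xelt_step !IH big_cat !big_map /=.
rewrite -addrA; congr (_ + _).
  rewrite big_seq [RHS]big_seq; apply: eq_bigr => p hp.
  by rewrite (walk_coef_cross _ (walks_head hp)) /walk_end /=; case: p hp => // /walksP[].
rewrite addrC -scalerBl -fold_factor scaler_sumr big_seq [RHS]big_seq.
apply: eq_bigr => p hp; rewrite (walk_coef_fold _ _ (walks_head hp)) scalerA /walk_end /=.
by case: p hp => // /walksP[].
Qed.

Lemma act_sum (I : Type) (r : seq I) (F : I -> daha Rr D) (m : V) :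
  act (\sum_(k <- r) F k) m = \sum_(k <- r) act (F k) m.
Proof.
elim: r => [|k r IH]; last by rewrite !big_cons actDl IH.
by rewrite !big_nil -(scale0r (1 : daha Rr D)) actZl scale0r.
Qed.

Lemma act_Xelt_vac u : act (Xelt Rr u) vac = thw Rr u.2 *: Xvac Rr u.1.
Proof.
case: u => m z; rewrite (Xelt_split (isX_Xelt Rr (m, z))) actM Tw_vac actZr thwE.
by [].
Qed.

Lemma Tw_Ov (z : W0 D) (g : Omegav Rr D) : Tw Rr z * Ov g = Xelt Rr (Wmul (0, z) (val g)).
Proof.
apply: (isX_uniq _ (isX_Xelt Rr _)); apply: isX_Omega.
by have := isX_Tw z (isX1 Rr D); rewrite mul1r.
Qed.

End Walks.

Theorem theorem3p4 (Rr : realType) (D : rootDatum) (mu : hZd D)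
    (hmu : dominant mu)
    (g : Omegav Rr D) (w : seq 'I_(rank D).+1)
    (hred : reduced g w)
    (hw : Wmul (val g) (Wword w) = min_rep Rr mu) :
  let t_half (k : nat) := thn Rr (nth ord0 w k) in
  let qb (k : nat) := qrho_opp Rr (betav w k) in
  Pmac Rr mu =
  \sum_(v : W0 D)
    \sum_(p \in [set p | is_walk (Wmul ((0, v) : W D) (val g)) w p]%classic)
      (thw Rr (walk_dir p) * (thw Rr (w0 Rr D * v)%g)^-1
       * (\prod_(k < size w | pos_fold Rr w p k)
            ((t_half k)^-1 * (1 - t_half k ^+ 2) / (1 - qb k)))
       * (\prod_(k < size w | neg_fold Rr w p k)
            ((t_half k)^-1 * (1 - t_half k ^+ 2) * qb k / (1 - qb k))))
      *: Xvac Rr (walk_wt p).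
Proof.
move=> t_half qb; rewrite /Pmac /Emac -hw (loc_vac_tauv hred) /one0 act_sum.
apply: eq_bigr => v _; rewrite actZl -actM Tw_Ov act_Xelt_evec scaler_sumr.
(* The sum over the set of walks is evaluated on its duplicate-free enumeration. *)
have -> : [set p | is_walk (Wmul ((0, v) : W D) (val g)) w p]%classic =
    [set` walks (Wmul (0, v) (val g)) w]%classic.
  by apply/seteqP; split=> p /= /walksP.
rewrite -(fsbig_seq _ _ (uniq_walks _ w)); apply: eq_bigr => p _.
rewrite act_Xelt_vac !scalerA /walk_wt /walk_dir; congr (_ *: _).
rewrite -[in RHS]mulrA -/(walk_coef Rr w p).
by rewrite [LHS]mulrC mulrA.
Qed.
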